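(* Let $k\in\{1,\dots,6\}$. In the setting described in the context, let assumptions (A1)--(A5) hold (with $p\in(1,\infty)$ the exponent in (A5)), with the stability constant $\lambda$ in (A3) satisfying $\lambda<1/\cos\alpha_k$ (no condition if $k=1,2$). Let $u$ be the solution of $u'(t)+A(t)u(t)=B(t,u(t))$, $0<t<T$, $u(0)=u_0$, with nodal values $u_n^\star:=u(t_n)$, and define the consistency errors $d_n$ by $$\frac1\tau\sum_{i=0}^k\delta_iu^\star_{n-i}+A(t_n)u_n^\star=\sum_{i=0}^{k-1}\gamma_iB(t_{n-i-1},u^\star_{n-i-1})+d_n,\qquad k\le n\le N.$$ Let $u_n\in D$ be the implicit--explicit $k$-step BDF approximations with starting values $u_0,\dots,u_{k-1}\in D$, $$\frac1\tau\sum_{i=0}^k\delta_iu_{n-i}+A(t_n)u_n=\sum_{i=0}^{k-1}\gamma_iB(t_{n-i-1},u_{n-i-1}),\qquad n=k,\dots,N.$$ Assume that $$\big\|(d_n)_{n=k}^N\big\|_{L^p(X)}\le\delta\quad\text{and}\quad\frac1\tau\big\|(u_i-u_i^\star)_{i=0}^{k-1}\big\|_{L^p(X)}+\big\|(u_i-u_i^\star)_{i=0}^{k-1}\big\|_{L^p(D)}\le\delta.$$ Then there exist positive constants $\tilde\lambda_0$ and $\delta_0$ such that, for $\tilde\lambda\le\tilde\lambda_0$ (where $\tilde\lambda$ is the constant in (A4)) and $\delta\le\delta_0$, the errors $e_n=u_n-u_n^\star$ are bounded by $$\frac1\tau\big\|(e_n-e_{n-1})_{n=k}^N\big\|_{L^p(X)}+\big\|(e_n)_{n=k}^N\big\|_{L^p(D)}\le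 C\delta,\qquad\big\|(e_n)_{n=k}^N\big\|_{L^\infty(W)}\le C\delta,$$ with a constant $C$ depending on $\|(u_n^\star)_{n=0}^N\|_{L^\infty(W)}$, $\|(u_n^\star)_{n=0}^N\|_{L^p(D)}$ and $T$, but independent of $\delta$ and $\tau$.
   Context: **Spaces and operators.** $V\hookrightarrow H=H'\hookrightarrow V'$ is a Gelfand triple of complex Hilbert spaces; the duality pairing $\langle\cdot,\cdot\rangle$ between $V$ and $V'$ restricted to $V\times H$ coincides with the inner product $(\cdot,\cdot)$ of $H$. $T>0$. $D,W,X$ are Banach spaces with imbeddings $D\subset W\subset X$, $D\subset V$, $X\subset V'$. For $t\in[0,T]$, $A(t):V\to V'$ are bounded linear operators which also map $D\to X$, and $B(t,\cdot):V\cap W\to V'$ are nonlinear operators which also map $D\to X$. **Time grid and norms.** $N\in\mathbb N$, $N\ge k$, $\tau=T/N$, $t_n=n\tau$. For a sequence in a Banach space $Y$, $\|(v_n)_{n=a}^b\|_{L^p(Y)}=\big(\tau\sum_{n=a}^b\|v_n\|_Y^p\big)^{1/p}$ and $\|(v_n)_{n=a}^b\|_{L^\infty(Y)}=\max_{a\le n\le b}\|v_n\|_Y$. **BDF coefficients.** $\delta(\zeta)=\sum_{\ell=1}^k\frac1\ell(1-\zeta)^\ell=\sum_{i=0}^k\delta_i\zeta^i$ (the polynomial $\delta(\zeta)$ and its coefficients $\delta_i$ are not to be confused with the error bound $\delta$ or the threshold $\delta_0$ in the claim), $\gamma(\zeta)=\frac1\zeta[1-(1-\zeta)^k]=\sum_{i=0}^{k-1}\gamma_i\zeta^i$.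 $\alpha_k$ is the angle of A$(\alpha)$-stability of the $k$-step BDF method, i.e. the largest $\alpha\in(0,\pi/2]$ with $|\arg\delta(\zeta)|\le\pi-\alpha$ for $|\zeta|\le1$, $\zeta\neq1$: $\alpha_1=\alpha_2=90^\circ$, $\alpha_3\approx86.03^\circ$, $\alpha_4\approx73.35^\circ$, $\alpha_5\approx51.84^\circ$, $\alpha_6\approx17.84^\circ$. For $k=1,2$, $1/\cos\alpha_k=+\infty$. **Assumptions** ($\Sigma_\varphi=\{z\in\mathbb C\setminus\{0\}:|\arg z|<\varphi\}$). (A1) For all $s\in[0,T]$ there is a unique solution $v\in H^1(\mathbb R_+;V')\cap L^2(\mathbb R_+;V)\hookrightarrow C([0,\infty);H)$ of $v'(t)+A(s)v(t)=0$, $t>0$, $v(0)=v_0$. The solution map $E_s^H(t):H\to H$, $v_0\mapsto v(t)$, extends to a bounded analytic semigroup $\{E_s^H(z)\}_{z\in\Sigma_{\theta_s}}$ on $H$, where $\theta_s\in(0,\pi/2]$ is the maximal angle of analyticity (the supremum of all such angles). The domain $D(A_H(s))=D_H\hookrightarrow V$ of the generator $-A_H(s)$ of this semigroup is independent of $s\in[0,T]$ and compactly imbedded into $H$, and $\theta:=\inf_{s\in[0,T]}\theta_s>0$. (A2) If $\theta>\pi/2-\alpha_k$, then for all $s\in[0,T]$ the $k$-step BDF solution determined by $\frac1\tau\sum_{j=0}^k\delta_jv_{n-j}+A(s)v_n=f_n$, $k\le n\le N$, with given $f_n\in X$ and given starting values $v_0,\dots,v_{k-1}\in D$, is bounded by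 $$\tfrac1\tau\|(v_n-v_{n-1})_{n=k}^N\|_{L^p(X)}+\|(v_n)_{n=k}^N\|_{L^p(D)}\le C\big(\|(f_n)_{n=k}^N\|_{L^p(X)}+\tfrac1\tau\|(v_i)_{i=0}^{k-1}\|_{L^p(X)}+\|(v_i)_{i=0}^{k-1}\|_{L^p(D)}\big)$$ with $C$ independent of $\tau$ and $s\in[0,T]$. (A3) There are positive constants $M_1,M_2$ with $\|A(t)\|_{\mathcal L(D,X)}\le M_1$ for all $t\in[0,T]$ and $\sum_{i=1}^m\|A(\tau_i)-A(\tau_{i-1})\|_{\mathcal L(D,X)}\le M_2$ for every partition $0=\tau_0<\tau_1<\dots<\tau_m=T$. There is a constant $\lambda\ge1$ with $|\langle A(t)v,v\rangle|\le\lambda\,\mathrm{Re}\,\langle A(t)v,v\rangle$ for all $v\in V$, $t\in[0,T]$. (A4) There are $r_0>0$ and nonnegative constants $\tilde\lambda,C_B$ independent of $t\in[0,T]$ such that, for all $v,w$ in the tube $T^D_{u,r_0}:=\{v\in D:\min_{0\le t\le T}\|v-u(t)\|_W\le r_0\}$ around the solution $u$, $$\|B(t,v)-B(t,w)\|_X\le\tilde\lambda\|v-w\|_D+C_B(\|v\|_D+\|w\|_D)\|v-w\|_W.$$ (A5) For any $\varepsilon>0$ there is $C_\varepsilon>0$ with $\|v\|_W\le\varepsilon\|v\|_D+C_\varepsilon\|v\|_X$ for all $v\in D$. Moreover, for some $p\in(1,\infty)$ (the exponent used throughout), $W^{1,p}(0,T;X)\cap L^p(0,T;D)\hookrightarrow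 L^\infty(0,T;W)$ continuously: there is a constant $C_W>0$ such that for all $v\in W^{1,p}(0,T;X)\cap L^p(0,T;D)$ with $v(0)=0$: $\|v\|_{L^\infty(0,T;W)}\le C_W(\|v'\|_{L^p(0,T;X)}+\|v\|_{L^p(0,T;D)})$. *)

(* Defs.v *)
From HB Require Import structures.
From mathcomp Require Import all_boot all_order all_algebra sesquilinear.
From mathcomp Require Import complex.
From mathcomp Require Import all_classical all_reals all_analysis.

Set Implicit Arguments.
Unset Strict Implicit.
Unset Printing Implicit Defensive.

Import Order.TTheory GRing.Theory Num.Def Num.Theory.
Import numFieldNormedType.Exports.

Local Open Scope classical_set_scope.
Local Open Scope ring_scope.
Local Open Scope complex_scope.

(* Norms of normed modules over [R[i]] take values in [R[i]]; they are real
   and nonnegative, so nothing is lost by taking the real part. *)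
Definition rnorm {R : realType} {Y : normedModType R[i]} (y : Y) : R :=
  complex.Re `|y|.

Definition opnorm {R : realType} {Y Z : normedModType R[i]} (f : Y -> Z) :
    \bar R :=
  ereal_sup [set (rnorm (f y))%:E | y in [set y | rnorm y <= 1]].

(* [|arg z|] for the principal value of the argument in (-pi, pi] (z <> 0):
   arg z = +/- acos (Re z / |z|). *)
Definition absarg {R : realType} (z : R[i]) : R :=
  acos (complex.Re z / complex.Re `|z|).

Definition sector {R : realType} (phi : R) : set R[i] :=
  [set z | z != 0 /\ absarg z < phi].

Section Bochner.
Context {R : realType}.
Local Notation mu := (@lebesgue_measure R).

Record stepfun (Y : normedModType R[i]) := Stepfun {
  sf_len : nat ;
  sf_set : 'I_sf_len -> set R ;
  sf_val : 'I_sf_len -> Y ;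
  sf_meas : forall i, measurable (sf_set i : set (measurableTypeR R)) ;
  sf_fin : forall i, (mu (sf_set i) < +oo)%E }.

Definition sf_fun (Y : normedModType R[i]) (s : stepfun Y) (t : R) : Y :=
  \sum_(i < sf_len s) (\1_(sf_set i) t : R)%:C *: sf_val i.

Definition sf_int (Y : normedModType R[i]) (I : set R) (s : stepfun Y) : Y :=
  \sum_(i < sf_len s) (fine (mu (I `&` sf_set i)))%:C *: sf_val i.

Definition strongly_measurable (Y : normedModType R[i]) (I : set R)
    (f : R -> Y) : Prop :=
  exists s : nat -> stepfun Y,
    {ae mu, forall t, I t -> sf_fun (s n) t @[n --> \oo] --> f t}.

Definition is_bochner (Y : normedModType R[i]) (I : set R) (f : R -> Y)
    (y : Y) : Prop :=
  strongly_measurable I f /\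
  exists s : nat -> stepfun Y,
    (\int[mu]_(t in I) (rnorm (f t - sf_fun (s n) t))%:E)%E
      @[n --> \oo] --> 0%E /\
    sf_int I (s n) @[n --> \oo] --> y.

Definition Lpnorm (Y : normedModType R[i]) (p : \bar R) (I : set R)
    (f : R -> Y) : \bar R :=
  Lnorm mu p (EFin \o ((fun t => rnorm (f t)) \_ I)).

Definition inLp (Y : normedModType R[i]) (p : \bar R) (I : set R)
    (f : R -> Y) : Prop :=
  strongly_measurable I f /\ (Lpnorm p I f < +oo)%E.

(* For an interval [I] of left end point 0: [v] is the continuous
   representative of a function on [I] whose weak derivative is [g]. *)
Definition is_primitive (Y : normedModType R[i]) (I : set R) (g v : R -> Y) :
    Prop :=
  forall t, I t -> is_bochner `[0, t] g (v t - v 0).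

End Bochner.

(* The inner products are linear in the first and antilinear in the second
   argument; accordingly [V'] is the antidual of [V] and [pairing f v] is
   linear in [f : V'] and antilinear in [v : V]. *)
Record spaces (R : realType) (V H V' D W X : completeNormedModType R[i]) :=
  Spaces {
  ipV : {dot V for (@conjC R[i])} ;
  ipH : {dot H for (@conjC R[i])} ;
  ipVE : forall v, ipV v v = `|v| ^+ 2 ;
  ipHE : forall h, ipH h h = `|h| ^+ 2 ;
  pairing : {bilinear V' -> V -> R[i] | *%R & (@conjC R[i]) \; *%R} ;
  pairing_norm : forall f : V',
    opnorm (fun v : V => pairing f v : R[i]^o) = (rnorm f)%:E ;
  pairing_surj : forall l : {linear V -> R[i] | (@conjC R[i]) \; *%R},
    (exists M : R[i], forall v, `|l v| <= M * `|v|) ->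
    exists f : V', forall v, pairing f v = l v ;
  VtoH : {linear V -> H} ;
  HtoV' : {linear H -> V'} ;
  VtoH_cont : continuous VtoH ;
  VtoH_inj : injective VtoH ;
  VtoH_dense : dense (range VtoH) ;
  pairingE : forall (h : H) (v : V), pairing (HtoV' h) v = ipH h (VtoH v) ;
  DtoW : {linear D -> W} ;
  WtoX : {linear W -> X} ;
  DtoV : {linear D -> V} ;
  XtoV' : {linear X -> V'} ;
  DtoW_cont : continuous DtoW ;
  WtoX_cont : continuous WtoX ;
  DtoV_cont : continuous DtoV ;
  XtoV'_cont : continuous XtoV' ;
  DtoW_inj : injective DtoW ;
  WtoX_inj : injective WtoX ;
  DtoV_inj : injective DtoV ;
  XtoV'_inj : injective XtoV' ;
  DtoV'E : forall d, XtoV' (WtoX (DtoW d)) = HtoV' (VtoH (DtoV d)) }.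

Section Problem.
Context {R : realType} {V H V' D W X : completeNormedModType R[i]}.
Variable S : spaces V H V' D W X.

Definition DtoX (d : D) : X := WtoX S (DtoW S d).
Definition VtoV' (v : V) : V' := HtoV' S (VtoH S v).

(* The intersection of [V] and [W], as subspaces of [V']. *)
Definition VW : Type :=
  {x : V * W | VtoV' x.1 = XtoV' S (WtoX S x.2)}.

Definition DtoVW (d : D) : VW :=
  exist _ (DtoV S d, DtoW S d) (esym (DtoV'E S d)).

Record linear_family (T : R) := LinearFamily {
  opA : R -> {linear V -> V'} ;
  opA_cont : forall t, 0 <= t <= T -> continuous (opA t) ;
  opAX : R -> D -> X ;
  opAXE : forall t d, 0 <= t <= T -> XtoV' S (opAX t d) = opA t (DtoV S d) }.

Record nonlinear_family (T : R) := NonlinearFamily {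
  opB : R -> VW -> V' ;
  opBX : R -> D -> X ;
  opBXE : forall t d, 0 <= t <= T -> XtoV' S (opBX t d) = opB t (DtoVW d) }.

Definition bdf_delta (k : nat) : {poly R[i]} :=
  \sum_(1 <= l < k.+1) (l%:R^-1)%:P * (1 - 'X) ^+ l.

(* The division by ['X] is exact. *)
Definition bdf_gamma (k : nat) : {poly R[i]} := (1 - (1 - 'X) ^+ k) %/ 'X.

(* The angle of A(alpha)-stability of the k-step BDF method. *)
Definition alpha (k : nat) : R :=
  sup [set a | 0 < a <= pi / 2 /\
    forall z : R[i], `|z| <= 1 -> z != 1 ->
      absarg (bdf_delta k).[z] <= pi - a].

(* The BDF difference quotient [1/tau \sum_i delta_i v_{n-i}] for n >= k. *)
Definition bdf_diff (Y : normedModType R[i]) (k : nat) (tau : R)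
    (v : nat -> Y) (n : nat) : Y :=
  (tau^-1)%:C *: \sum_(i < k.+1) (bdf_delta k)`_i *: v (n - i)%N.

Definition dLp (Y : normedModType R[i]) (p tau : R) (a b : nat)
    (v : nat -> Y) : R :=
  (tau * \sum_(a <= n < b.+1) rnorm (v n) `^ p) `^ p^-1.

Definition dLoo (Y : normedModType R[i]) (a b : nat) (v : nat -> Y) : R :=
  \big[Num.max/0]_(a <= n < b.+1) rnorm (v n).

(* [v] is the continuous [H]-valued representative of the solution in
   H^1(R_+; V') /\ L^2(R_+; V) of v' + A v = 0, v(0) = v0. *)
Definition is_solution (A : V -> V') (v0 : H) (v : R -> H) : Prop :=
  {within `[0, +oo[, continuous v} /\ v 0 = v0 /\
  exists (vV : R -> V) (g : R -> V'),
    [/\ inLp 2%:E `[0, +oo[ vV,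
        inLp 2%:E `[0, +oo[ g,
        is_primitive `[0, +oo[ g (fun t => HtoV' S (v t)),
        {ae @lebesgue_measure R, forall t, 0 <= t -> VtoH S (vV t) = v t} &
        {ae @lebesgue_measure R, forall t, 0 <= t -> g t + A (vV t) = 0}].

(* A bounded analytic semigroup on the sector of angle [phi] is bounded and
   strongly continuous at 0 on all smaller sectors. *)
Record bounded_analytic_semigroup (phi : R) (E : R[i] -> H -> H) : Prop := {
  bas_linear : forall z, sector phi z -> linear (E z) ;
  bas_law : forall z w, sector phi z -> sector phi w ->
    forall h, E (z + w) h = E z (E w h) ;
  bas_holo : forall h z, sector phi z ->
    derivable (fun z : R[i]^o => E z h) z 1 ;
  bas_bounded : forall psi, 0 < psi < phi ->
    exists M : R, forall z, sector psi z ->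
      forall h, rnorm (E z h) <= M * rnorm h ;
  bas_cont0 : forall psi, 0 < psi < phi ->
    forall h, E z h @[z --> within (sector psi) (nbhs (0 : R[i]^o))] --> h }.

Definition extends_analytically (A : V -> V') (phi : R) : Prop :=
  exists E : R[i] -> H -> H, bounded_analytic_semigroup phi E /\
    forall v0 v, is_solution A v0 v -> forall t, 0 < t -> v t = E t%:C v0.

Definition analyticity_angle (A : V -> V') : R :=
  sup [set phi | 0 < phi <= pi / 2 /\ extends_analytically A phi].

(* [y = A_H h], where -A_H is the generator of the semigroup on [H]. *)
Definition generates (A : V -> V') (h y : H) : Prop :=
  exists2 v, is_solution A h v &
    (t^-1)%:C *: (v t - h) @[t --> 0^'+] --> - y.

Definition inf_angle (T : R) (A : R -> V -> V') : R :=
  inf [set analyticity_angle (A s) | s in `[0, T]].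

Definition semigroup_assumption (T : R) (A : linear_family T) : Prop :=
  [/\ forall s v0, 0 <= s <= T ->
        exists2 v, is_solution (opA A s) v0 v &
          forall w, is_solution (opA A s) v0 w ->
            forall t, 0 <= t -> w t = v t,
      forall s, 0 <= s <= T ->
        0 < analyticity_angle (opA A s) <= pi / 2 /\
        extends_analytically (opA A s) (analyticity_angle (opA A s)),
      exists DH : set H, forall s, 0 <= s <= T ->
        [/\ forall h, DH h <-> exists y, generates (opA A s) h y,
            exists M : R, forall h y, generates (opA A s) h y ->
              exists2 v, VtoH S v = h & rnorm v <= M * (rnorm h + rnorm y) &
            precompact [set h | exists2 y, generates (opA A s) h y &
              rnorm h + rnorm y <= 1]] &
      0 < inf_angle T (opA A)].

Definition discrete_maximal_regularity (k : nat) (T p : R)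
    (A : linear_family T) : Prop :=
  pi / 2 - alpha k < inf_angle T (opA A) ->
  exists2 C : R, 0 < C & forall (s : R) (N : nat) (f : nat -> X) (v : nat -> D),
    0 <= s <= T -> (k <= N)%N ->
    let tau := T / N%:R in
    (forall n, (k <= n <= N)%N ->
       bdf_diff k tau (fun m => DtoX (v m)) n + opAX A s (v n) = f n) ->
    tau^-1 * dLp p tau k N (fun n => DtoX (v n - v n.-1)) + dLp p tau k N v
    <= C * (dLp p tau k N f + tau^-1 * dLp p tau 0 k.-1 (fun i => DtoX (v i))
            + dLp p tau 0 k.-1 v).

Definition stability_assumption (T lambda : R) (A : linear_family T) : Prop :=
  (exists M1 M2 : R, [/\ 0 < M1, 0 < M2,
     forall t, 0 <= t <= T -> (opnorm (opAX A t) <= M1%:E)%E &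
     forall (m : nat) (s : nat -> R),
       s 0%N = 0 -> s m = T -> (forall i, (i < m)%N -> s i < s i.+1) ->
       (\sum_(1 <= i < m.+1)
          opnorm (fun d => (opAX A (s i) d - opAX A (s i.-1) d)%R)
        <= M2%:E)%E]) /\
  1 <= lambda /\
  forall t v, 0 <= t <= T ->
    complex.Re `|pairing S (opA A t v) v|
    <= lambda * complex.Re (pairing S (opA A t v) v).

Definition tube (T : R) (u : R -> D) (r0 : R) : set D :=
  [set v | exists2 t, 0 <= t <= T & rnorm (DtoW S (v - u t)) <= r0].

Definition local_lipschitz_assumption (T r0 ltilde CB : R) (u : R -> D)
    (B : nonlinear_family T) : Prop :=
  forall t v w, 0 <= t <= T -> tube T u r0 v -> tube T u r0 w ->
    rnorm (opBX B t v - opBX B t w)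
    <= ltilde * rnorm (v - w)
       + CB * (rnorm v + rnorm w) * rnorm (DtoW S (v - w)).

(* A function of W^{1,p}(0,T;X) /\ L^p(0,T;D) is given by its [D]-valued
   version [v], its continuous [X]-valued version [vX] and its derivative
   [g]. *)
Definition embedding_assumption (T p : R) : Prop :=
  (forall eps : R, 0 < eps -> exists2 Ceps : R, 0 < Ceps & forall v : D,
     rnorm (DtoW S v) <= eps * rnorm v + Ceps * rnorm (DtoX v)) /\
  exists2 CW : R, 0 < CW & forall (v : R -> D) (vX g : R -> X),
    inLp p%:E `[0, T] v -> inLp p%:E `[0, T] g ->
    is_primitive `[0, T] g vX ->
    {ae @lebesgue_measure R, forall t, 0 <= t <= T -> DtoX (v t) = vX t} ->
    vX 0 = 0 ->
    let I : set R := `[0, T]%classic in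
    (Lpnorm +oo I (fun t => DtoW S (v t))
     <= CW%:E * (Lpnorm p%:E I g + Lpnorm p%:E I v))%E.

(* u' + A(t) u = B(t, u) almost everywhere on (0, T), with values in [V']. *)
Definition solves_ivp (T : R) (A : linear_family T) (B : nonlinear_family T)
    (u0 : D) (u : R -> D) : Prop :=
  u 0 = u0 /\
  is_primitive `[0, T] (fun t => opB B t (DtoVW (u t)) - opA A t (DtoV S (u t)))
    (fun t => VtoV' (DtoV S (u t))).

(* The explicit right-hand side
   \sum_i gamma_i B(t_{n-i-1}, v_{n-i-1}) of the scheme, for n >= k. *)
Definition bdf_rhs (T : R) (k : nat) (tau : R) (B : nonlinear_family T)
    (v : nat -> D) (n : nat) : X :=
  \sum_(i < k) (bdf_gamma k)`_i *:
    opBX B ((n - i - 1)%:R * tau) (v (n - i - 1)%N).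

End Problem.

(* Main.v *)
(* The discrete maximal regularity (A2) is available as soon as
   theta > pi/2 - alpha_k, which is trivial if alpha_k = pi/2; otherwise the
   first point is to bound theta from below by arcsin(1/lambda).  Suppose that for some s the maximal angle phi of the
   semigroup E generated by -A(s) satisfies sin phi < 1/lambda.  Then z A(s)
   is uniformly coercive for z in the sector of angle phi, and energy estimates
   along rays give |E(z) h| <= |h| and |E'(z) h| <= K |h| / |z| there, with K
   uniform up to the boundary.  Cauchy-type bounds on all derivatives follow
   from the semigroup law, so the Taylor series at z + r |z|, with r depending
   only on K, extends E to a strictly larger sector, a contradiction.

   For the error bound, A(t_n) is frozen at A(t_m): the maximal regularity for
   A(t_m) on the horizon m, the bounded variation of A and the discrete
   Gronwall inequality bound the p-th power of the energy norm of e up to t_m.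
   As long as the errors stay in the tube of radius r0, the difference of the
   nonlinearities contributes a term absorbed for small tilde lambda and a term
   in |e_n|_W, which the embedding (A5), applied to the piecewise linear
   interpolant, again bounds by the energy at t_n.  Since the scheme is explicit
   in B, an induction on m with delta small keeps the errors inside the tube. *)
Require Import Defs.
From HB Require Import structures.
From mathcomp Require Import all_boot all_order all_algebra sesquilinear.
From mathcomp Require Import complex.
From mathcomp Require Import all_classical all_reals all_analysis.
From mathcomp Require Import measurable_realfun ess_sup_inf.
From mathcomp Require Import ring lra zify.
Import Order.TTheory GRing.Theory Num.Def Num.Theory.
Import numFieldNormedType.Exports.
Local Open Scope classical_set_scope.
Local Open Scope ring_scope.
Local Open Scope complex_scope.
Set Implicit Arguments.
Unset Strict Implicit.
Unset Printing Implicit Defensive.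

(** Sectors are coded by [q |z| < Re z], with [q] the cosine of the angle: an enlarged sector is a
    smaller [q], and membership is plain arithmetic. The value at [z] of the continued semigroup is
    the unique [g] with [E(x) g = E(z + x) h] for some [x > 0]; its laws then follow from those of
    [E], and Taylor series serve only for the injectivity of [E(x)] and the existence of [g]. The
    energy estimates need the generator to be [A] itself as a map from [V] to [V'], whereas [E] is
    known only through weak solutions; this identification is a part of its own.

    For the scheme, the error is split as [z + s] with [s] holding the starting values, because the
    transport of (A2) to shorter horizons needs zero starting values. Estimates are in [p]-th
    powers, which are additive in time as Gronwall needs. The bound on [ltilde] is fixed first, from
    the linear part and the coefficients of the method. Since (A4) also produces the product of the
    D-norm and the W-norm of the error with factor [CB], the induction runs in a tube of radius
    [rho <= r0] for which [CB * rho] stays within that bound. *)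

Section Rnorm.
Context {R : realType}.
Implicit Types (z w : R[i]).

Definition cabs z : R := complex.Re `|z|.

Lemma ge0_Re (z : R[i]) : 0 <= z -> (complex.Re z)%:C = z.
Proof. by move=> z0; apply: RRe_real; apply: ger0_real. Qed.

Lemma cabsE z : (cabs z)%:C = `|z|.
Proof. exact: ge0_Re. Qed.

Lemma cabs_ge0 z : 0 <= cabs z.
Proof. by rewrite -ler0c cabsE. Qed.

Lemma cabs0 : cabs 0 = 0.
Proof. by apply: complexI; rewrite cabsE normr0. Qed.

Lemma cabs_eq0 z : (cabs z == 0) = (z == 0).
Proof. by rewrite -(inj_eq (@complexI R)) cabsE normr_eq0. Qed.

Lemma cabs_gt0 z : (0 < cabs z) = (z != 0).
Proof. by rewrite lt_neqAle cabs_ge0 eq_sym cabs_eq0 andbT. Qed.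

Lemma cabsM z w : cabs (z * w) = cabs z * cabs w.
Proof. by apply: complexI; rewrite rmorphM /= !cabsE normrM. Qed.

Lemma cabsV z : cabs z^-1 = (cabs z)^-1.
Proof. by apply: complexI; rewrite fmorphV /= !cabsE normfV. Qed.

Lemma cabsN z : cabs (- z) = cabs z.
Proof. by rewrite /cabs normrN. Qed.

Lemma cabsD z w : cabs (z + w) <= cabs z + cabs w.
Proof. by rewrite -lecR rmorphD /= !cabsE; exact: ler_normD. Qed.

Lemma cabsC (x : R) : cabs x%:C = `|x|.
Proof. by rewrite /cabs normc_def /= expr0n /= addr0 sqrtr_sqr. Qed.

Lemma cabs_sqr z : cabs z ^+ 2 = complex.Re z ^+ 2 + complex.Im z ^+ 2.
Proof. by apply: complexI; rewrite rmorphXn /= cabsE -add_Re2_Im2. Qed.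

Lemma abs_Re_le z : `|complex.Re z| <= cabs z.
Proof.
rewrite -(@ler_pXn2r _ 2) ?nnegrE ?cabs_ge0 // cabs_sqr.
by rewrite -normrX ger0_norm ?sqr_ge0 // lerDl sqr_ge0.
Qed.

Lemma Re_le_cabs z : complex.Re z <= cabs z.
Proof. exact: le_trans (ler_norm _) (abs_Re_le z). Qed.

Section Norm.
Context {Y : normedModType R[i]}.
Implicit Types (x y : Y).

Lemma rnormE y : (rnorm y)%:C = `|y|.
Proof. exact: ge0_Re. Qed.

Lemma rnorm_ge0 y : 0 <= rnorm y.
Proof. by rewrite -ler0c rnormE. Qed.

Lemma rnorm0 : rnorm (0 : Y) = 0.
Proof. by apply: complexI; rewrite rnormE normr0. Qed.

Lemma rnorm_eq0 y : (rnorm y == 0) = (y == 0).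
Proof. by rewrite -(inj_eq (@complexI R)) rnormE normr_eq0. Qed.

Lemma rnormN y : rnorm (- y) = rnorm y.
Proof. by rewrite /rnorm normrN. Qed.

Lemma rnormD x y : rnorm (x + y) <= rnorm x + rnorm y.
Proof. by rewrite -lecR rmorphD /= !rnormE; exact: ler_normD. Qed.

Lemma rnormB x y : rnorm (x - y) <= rnorm x + rnorm y.
Proof. by rewrite -(rnormN y); exact: rnormD. Qed.

Lemma rdistC x y : rnorm (x - y) = rnorm (y - x).
Proof. by rewrite -rnormN opprB. Qed.

Lemma rnormZ a y : rnorm (a *: y) = cabs a * rnorm y.
Proof. by apply: complexI; rewrite rmorphM /= rnormE cabsE rnormE normrZ. Qed.

Lemma rnormZR (a : R) y : rnorm (a%:C *: y) = `|a| * rnorm y.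
Proof. by rewrite rnormZ cabsC. Qed.

Lemma rnorm_sum (I : Type) (r : seq I) (P : pred I) (F : I -> Y) :
  rnorm (\sum_(i <- r | P i) F i) <= \sum_(i <- r | P i) rnorm (F i).
Proof.
elim/big_ind2: _ => [|x a y b h1 h2|//]; first by rewrite rnorm0.
exact: le_trans (rnormD _ _) (lerD h1 h2).
Qed.

Lemma rnorm_dist_le x y : rnorm x - rnorm y <= rnorm (x - y).
Proof. by rewrite lerBlDr -{1}(subrK y x) rnormD. Qed.

Lemma nbhs_rnorm (y : Y) (e : R) : 0 < e -> \forall x \near y, rnorm (x - y) < e.
Proof.
move=> e0; have : \forall x \near y, `|y - x| < e%:C.
  by apply: cvgr_dist_lt => //; rewrite ltcR.
by apply: filterS => x; rewrite -rnormE ltcR rdistC.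
Qed.

(** Neighbourhoods over [R[i]] have radii in [R[i]]; a positive complex number is real, so real
    radii suffice. Later convergence arguments rely on this. *)
Lemma nbhs_rnormP (y : Y) (P : set Y) :
  nbhs y P <-> exists2 e : R, 0 < e & forall x, rnorm (x - y) < e -> P x.
Proof.
split=> [/nbhs_normP[e /= e0 he]|[e e0 he]].
  exists (complex.Re e) => [|x hx].
    by rewrite -ltcR ge0_Re // ltW.
  apply: he => /=; rewrite -rnormE rdistC -(ge0_Re (ltW e0)) ltcR //.
by near=> x; apply: he; near: x; exact: nbhs_rnorm.
Unshelve. all: end_near. Qed.

End Norm.

Section Cvg.
Context {Y : normedModType R[i]}.

Lemma cvg_rnormP (T : Type) (F : set_system T) (FF : Filter F) (f : T -> Y) (y : Y) :
  f x @[x --> F] --> y <->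
  forall e : R, 0 < e -> \forall x \near F, rnorm (f x - y) < e.
Proof.
split=> [h e e0|h]; first exact: h _ (nbhs_rnorm y e0).
move=> A /nbhs_rnormP[e e0 hA]; near=> x => /=; apply: hA; near: x; exact: h.
Unshelve. all: end_near. Qed.

End Cvg.

Lemma cont_bounded {Y Z : normedModType R[i]} (f : {linear Y -> Z}) :
  continuous f -> exists2 M : R, 0 < M & forall y, rnorm (f y) <= M * rnorm y.
Proof.
move=> /(_ 0) /cvg_rnormP /(_ 1 ltr01); rewrite raddf0 => /nbhs_rnormP[e e0 he].
have {}he x : rnorm x < e -> rnorm (f x) < 1.
  by move=> hx; have := he x; rewrite !subr0; apply.
exists (2 / e) => [|y]; first by rewrite divr_gt0.
have [->|y0] := eqVneq y 0; first by rewrite raddf0 !rnorm0 mulr0.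
have ny : 0 < rnorm y by rewrite lt_neqAle eq_sym rnorm_eq0 y0 rnorm_ge0.
have a0 : 0 < e / 2 / rnorm y by rewrite !divr_gt0.
have := he ((e / 2 / rnorm y)%:C *: y).
rewrite linearZ /= !rnormZR (gtr0_norm a0) divfK ?gt_eqF //.
move=> /(_ _)/ltW h; rewrite -ler_pdivrMl ?divr_gt0 // invf_div.
by rewrite -[leRHS]mul1r -ler_pdivrMr // mulrAC; apply: h; lra.
Qed.

End Rnorm.

(** * Real powers, a discrete Gronwall inequality and discrete norms *)

Section Powers.
Context {R : realType}.
Implicit Types (p a b x y : R).

Lemma le_powR p a b : 0 <= p -> 0 <= a -> a <= b -> a `^ p <= b `^ p.
Proof.
by move=> p0 a0 ab; apply: ge0_ler_powR; rewrite ?nnegrE // (le_trans a0).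
Qed.

Lemma le_powRV p a b : 0 < p -> 0 <= a -> 0 <= b -> a `^ p <= b `^ p -> a <= b.
Proof.
move=> p0 a0 b0 h; rewrite leNgt; apply/negP => ba.
by have := gt0_ltr_powR p0 b0 a0 ba; rewrite ltNge h.
Qed.

(** The sum is at most [n] times its largest term, whose [p]-th power is one of the summands on the
    right. *)
Lemma powR_sumle p n (F : nat -> R) : 0 < p -> (forall i, 0 <= F i) ->
  (\sum_(i < n) F i) `^ p <= n%:R `^ p * \sum_(i < n) F i `^ p.
Proof.
move=> p0 F0; case: n => [|n]; first by rewrite !big_ord0 mulr0 powR0 ?gt_eqF.
have [j _ hj] := @Order.TotalTheory.arg_maxP _ _ _ (@ord0 n) xpredT (fun i : 'I_n.+1 => F i) isT.
have h : \sum_(i < n.+1) F i <= n.+1%:R * F j.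
  apply: le_trans (ler_sum _ (fun i _ => hj i isT)) _.
  by rewrite sumr_const card_ord mulr_natl.
apply: le_trans (le_powR (ltW p0) _ h) _; first exact: sumr_ge0.
rewrite powRM ?ler0n ?F0 // ler_wpM2l ?powR_ge0 //.
by rewrite (bigD1 j) //= lerDl sumr_ge0 // => i _; exact: powR_ge0.
Qed.

Lemma powR_addle p a b : 0 < p -> 0 <= a -> 0 <= b ->
  (a + b) `^ p <= 2 `^ p * (a `^ p + b `^ p).
Proof.
move=> p0 a0 b0; have := @powR_sumle p 2 (fun i => if i == 0%N then a else b) p0.
by rewrite !big_ord_recl !big_ord0 /= !addr0; apply; case.
Qed.

Lemma powR_split p a b C (c : R) : 0 < p -> 0 <= a -> 0 <= b -> 0 <= C -> 0 <= c ->
  a + b <= C * c -> a `^ p + b `^ p <= 2 * C `^ p * c `^ p.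
Proof.
move=> p0 a0 b0 C0 c0 h.
have h1 : a `^ p <= (C * c) `^ p by apply: le_powR; [exact: ltW|by []|lra].
have h2 : b `^ p <= (C * c) `^ p by apply: le_powR; [exact: ltW|by []|lra].
by rewrite powRM // in h1 h2; lra.
Qed.

(** Keeps one factor [a] linear: this turns the power of a partial variation into a sum over
    increments, as Gronwall requires. *)
Lemma powR_le_lin p a b : 1 < p -> 0 <= a -> a <= b -> a `^ p <= b `^ (p - 1) * a.
Proof.
move=> p1 a0 ab; have p0 : 0 < p by apply: lt_trans p1.
rewrite -(@mulr_powRB1 _ a p) // mulrC ler_wpM2r //.
by apply: le_powR => //; rewrite subr_ge0 ltW.
Qed.

Lemma discrete_gronwall (k m : nat) (Y c : nat -> R) (a : R) :
  0 <= a -> (forall j, 0 <= c j) ->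
  (forall n, (k <= n <= m)%N -> Y n <= a + \sum_(k <= j < n) c j * Y j) ->
  forall n, (k <= n <= m)%N -> Y n <= a * expR (\sum_(k <= j < n) c j).
Proof.
move=> a0 c0 H.
(* The induction bounds the right-hand side of the hypothesis; one step multiplies its bound by at
   most [1 + c n <= expR (c n)]. *)
suff h : forall n, (k <= n <= m)%N ->
    a + \sum_(k <= j < n) c j * Y j <= a * expR (\sum_(k <= j < n) c j).
  by move=> n hn; apply: le_trans (H n hn) (h n hn).
elim=> [|n IH] hn.
  by rewrite !big_geq // addr0 expR0 mulr1.
have [->|kn] := eqVneq k n.+1; first by rewrite !big_geq // addr0 expR0 mulr1.
have {}kn : (k <= n)%N by lia.
have hn' : (k <= n <= m)%N by lia.
rewrite !big_nat_recr //= expRD mulrA addrA.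
have hY := H n hn'; have I := IH hn'.
set s := \sum_(k <= j < n) c j * Y j in hY I *.
set e := a * expR _ in I *.
apply: (@le_trans _ _ (e + c n * e)).
  by apply: lerD => //; rewrite ler_wpM2l //; apply: le_trans hY I.
rewrite -[X in X + _]mulr1 [c n * e]mulrC -mulrDr ler_wpM2l ?expR_ge1Dx //.
by rewrite mulr_ge0 ?expR_ge0.
Qed.

End Powers.

Section DLp.
Context {R : realType} {Y : normedModType R[i]}.
Implicit Types (p tau : R) (v : nat -> Y).

Lemma dLp_ge0 p tau a b v : 0 <= dLp p tau a b v.
Proof. exact: powR_ge0. Qed.

Lemma dLp_powE p tau a b v : 0 < p -> 0 <= tau ->
  dLp p tau a b v `^ p = tau * \sum_(a <= n < b.+1) rnorm (v n) `^ p.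
Proof.
move=> p0 t0; rewrite /dLp -powRrM mulVf ?gt_eqF // powRr1 // mulr_ge0 //.
by apply: sumr_ge0 => i _; exact: powR_ge0.
Qed.

Lemma dLp_zero p tau a b v : 0 < p -> 
  (forall n, (a <= n <= b)%N -> v n = 0) -> dLp p tau a b v = 0.
Proof.
move=> p0 h; rewrite /dLp big_nat_cond big1; first by rewrite mulr0 powR0 ?invr_eq0 ?gt_eqF.
by move=> i /andP[hi _]; rewrite h ?rnorm0 ?powR0 ?gt_eqF //; lia.
Qed.

End DLp.

Section DLpSplit.
Context {R : realType} {Y1 Y2 : normedModType R[i]}.

(** Passes from a sum of two norms, as in (A2), to [p]-th powers. Each of the two nonnegative terms
    is at most [C * c], whence the factor 2. *)
Lemma dLp_split (p tau C c : R) a b (v : nat -> Y1) (w : nat -> Y2) :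
  0 < p -> 0 < tau -> 0 <= C -> 0 <= c ->
  tau^-1 * dLp p tau a b v + dLp p tau a b w <= C * c ->
  tau * \sum_(a <= n < b.+1) ((tau^-1 * rnorm (v n)) `^ p + rnorm (w n) `^ p)
  <= 2 * C `^ p * c `^ p.
Proof.
move=> p0 t0 C0 c0; have ti0 : 0 <= tau^-1 by rewrite invr_ge0 ltW.
move: (dLp_ge0 p tau a b v) (dLp_ge0 p tau a b w).
move: (dLp_powE a b v p0 (ltW t0)) (dLp_powE a b w p0 (ltW t0)).
move: (dLp _ _ _ _ v) (dLp _ _ _ _ w) => y1 y2 e1 e2 h1 h2.
move/(powR_split p0 (mulr_ge0 ti0 h1) h2 C0 c0); apply: le_trans.
rewrite (powRM _ ti0 h1) e1 e2 mulrCA -mulrDr [X in _ <= tau * (X + _)]mulr_sumr -big_split /=.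
rewrite ler_wpM2l ?(ltW t0) // le_eqVlt; apply/orP; left; apply/eqP.
by apply: eq_bigr => n _; rewrite powRM // rnorm_ge0.
Qed.

End DLpSplit.

(** * Maximal regularity on shorter horizons *)

Section Discrete.
Context {R : realType} {V H V' D W X : completeNormedModType R[i]}.
Variable S : spaces V H V' D W X.

Lemma DtoX_is_linear : linear (DtoX S).
Proof. by move=> a x y; rewrite /DtoX !linearP. Qed.

HB.instance Definition _ :=
  GRing.isLinear.Build R[i] D X *:%R (DtoX S) DtoX_is_linear.

(** [opAX] is only given as a function from [D] to [X]; linearity is pulled back from [V'] along the
    injective [XtoV']. *)
Lemma opAX_linear T (A : linear_family S T) t : 0 <= t <= T -> linear (opAX A t).
Proof.
move=> ht a x y; apply: (@XtoV'_inj _ _ _ _ _ _ _ S).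
by rewrite linearP !opAXE // !linearP.
Qed.

Lemma opAXB T (A : linear_family S T) t x y : 0 <= t <= T ->
  opAX A t (x - y) = opAX A t x - opAX A t y.
Proof.
move=> ht; have := opAX_linear A ht (-1) y x.
by rewrite !scaleN1r [x - y]addrC => ->; rewrite addrC.
Qed.

Lemma opAX0 T (A : linear_family S T) t : 0 <= t <= T -> opAX A t 0 = 0.
Proof. by move=> ht; rewrite -(subrr 0) opAXB // subrr. Qed.

Lemma opAXZ T (A : linear_family S T) t a x : 0 <= t <= T ->
  opAX A t (a *: x) = a *: opAX A t x.
Proof. by move=> ht; rewrite -[a *: x]addr0 opAX_linear // opAX0 // addr0. Qed.

Section Bdf.
Context {Y : normedModType R[i]}.
Implicit Types (v w : nat -> Y).

Lemma bdf_diffB k (tau : R) v w n :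
  bdf_diff k tau (fun m => v m - w m) n = bdf_diff k tau v n - bdf_diff k tau w n.
Proof.
rewrite /bdf_diff -scalerBr -sumrB; congr (_ *: _).
by apply: eq_bigr => i _; rewrite scalerBr.
Qed.

Definition bdf_mass k : R := \sum_(i < k.+1) cabs (bdf_delta k : {poly R[i]})`_i.

Lemma bdf_mass_ge0 k : 0 <= bdf_mass k.
Proof. by apply: sumr_ge0 => i _; exact: cabs_ge0. Qed.

Lemma bdf_diff_le k (tau : R) v n : 0 < tau ->
  rnorm (bdf_diff k tau v n)
  <= bdf_mass k * (tau^-1 * \sum_(i < k.+1) rnorm (v (n - i)%N)).
Proof.
move=> t0; rewrite /bdf_diff rnormZR gtr0_norm ?invr_gt0 //.
rewrite mulrCA ler_wpM2l ?invr_ge0 ?(ltW t0) //.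
apply: le_trans (rnorm_sum _ _ _) _; rewrite mulr_suml.
apply: ler_sum => i _; rewrite rnormZ; apply: ler_wpM2l; first exact: cabs_ge0.
by rewrite (bigD1 i) //= lerDl sumr_ge0 // => j _; exact: rnorm_ge0.
Qed.

End Bdf.

(* The [p]-th power of the energy norm
   [|(v_n - v_(n-1))/tau|_{L^p(X)} + |v_n|_{L^p(D)}] over [a <= n <= b]. *)
Definition energy (p tau : R) (v : nat -> D) (a b : nat) : R :=
  tau * \sum_(a <= n < b.+1)
    ((tau^-1 * rnorm (DtoX S (v n - v n.-1))) `^ p + rnorm (v n) `^ p).

Lemma energy_summand_ge0 p tau (v : nat -> D) n :
  0 <= (tau^-1 * rnorm (DtoX S (v n - v n.-1))) `^ p + rnorm (v n) `^ p.
Proof. by rewrite addr_ge0 // powR_ge0. Qed.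

Lemma energy_ge0 p tau v a b : 0 <= tau -> 0 <= energy p tau v a b.
Proof.
by move=> t0; rewrite mulr_ge0 // sumr_ge0 // => i _; exact: energy_summand_ge0.
Qed.

(** [G] is [F] moved by [N - m] steps, and its terms before index [k + (N - m)] can only add. With
    the next lemma this serves for delayed sequences. *)
Lemma sum_shift_ge (k m N : nat) (F G : nat -> R) : (k <= m <= N)%N ->
  (forall n, 0 <= G n) ->
  (forall n, (k <= n <= m)%N -> G (n + (N - m))%N = F n) ->
  \sum_(k <= n < m.+1) F n <= \sum_(k <= n < N.+1) G n.
Proof.
move=> h G0 e; rewrite [leRHS](@big_cat_nat _ _ _ (k + (N - m))) //=; last 2 first.
- by rewrite leq_addr.
- by lia.
rewrite big_addn.
have -> : (N.+1 - (N - m) = m.+1)%N by lia.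
rewrite [X in _ <= _ + X](_ : _ = \sum_(k <= n < m.+1) F n); last first.
  by apply: eq_big_nat => i hi; apply: e; lia.
by rewrite lerDr sumr_ge0.
Qed.

Lemma sum_shift_eq (k m N : nat) (F G : nat -> R) : (k <= m <= N)%N ->
  (forall n, (k <= n < k + (N - m))%N -> G n = 0) ->
  (forall n, (k <= n <= m)%N -> G (n + (N - m))%N = F n) ->
  \sum_(k <= n < N.+1) G n = \sum_(k <= n < m.+1) F n.
Proof.
move=> h G0 e; rewrite (@big_cat_nat _ _ _ (k + (N - m))) //=; last 2 first.
- by rewrite leq_addr.
- by lia.
rewrite big_nat_cond big1 ?add0r; last by move=> i /andP[hi _]; exact: G0.
rewrite big_addn.
have -> : (N.+1 - (N - m) = m.+1)%N by lia.
by apply: eq_big_nat => i hi; apply: e; lia.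
Qed.

Definition delay (Y : zmodType) (d : nat) (v : nat -> Y) (n : nat) : Y :=
  if (n < d)%N then 0 else v (n - d)%N.

Lemma delayE (Y : zmodType) d (v : nat -> Y) n : delay d v (n + d) = v n.
Proof. by rewrite /delay ltnNge leq_addl addnK. Qed.

(* The a priori bound (A2) holds only over the full horizon [N]; since the
   operator is frozen, it is transported to any horizon [m <= N] by delaying a
   sequence with zero starting values by [N - m] steps. *)
Lemma maximal_regularity_horizon (k : nat) (T p : R) (A : linear_family S T) :
  (0 < k)%N -> 0 < T -> 1 < p -> discrete_maximal_regularity k p A ->
  pi / 2 - alpha k < inf_angle S T (opA A) ->
  exists2 C : R, 0 < C & forall (s : R) (N m : nat) (f : nat -> X) (z : nat -> D),
    0 <= s <= T -> (k <= m <= N)%N -> (forall n, (n < k)%N -> z n = 0) ->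
    let tau := T / N%:R in
    (forall n, (k <= n <= m)%N ->
       bdf_diff k tau (fun j => DtoX S (z j)) n + opAX A s (z n) = f n) ->
    energy p tau z k m <= C * (tau * \sum_(k <= n < m.+1) rnorm (f n) `^ p).
Proof.
move=> k0 T0 p1 mr /mr[C C0 {mr}hC]; have p0 : 0 < p by apply: lt_trans p1.
exists (2 * C `^ p) => [|s N m f z hs hm z0 tau hz].
  by rewrite mulr_gt0 // powR_gt0.
have t0 : 0 < tau by rewrite divr_gt0 // ltr0n; lia.
pose d := (N - m)%N; pose z' := delay d z.
pose f' n := if (n < k + d)%N then 0 else f (n - d)%N.
have z'0 n : (n < k + d)%N -> z' n = 0.
  by move=> hn; rewrite /z' /delay; case: ifP => // hnd; apply: z0; lia.
(* Below [k + d] the whole BDF window sees only zeros, so the residual is 0. From [k + d] on, the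
   window stays at indices at least [d], and the equation is that of [z] at [n - d]. *)
have eqn n : (k <= n <= N)%N ->
    bdf_diff k tau (fun j => DtoX S (z' j)) n + opAX A s (z' n) = f' n.
  move=> hn; rewrite /f'; case: ifP => hnk.
    rewrite z'0 // opAX0 // addr0 /bdf_diff big1 ?scaler0 // => i _.
    by rewrite z'0 ?linear0 ?scaler0 //; lia.
  have -> : z' n = z (n - d)%N by rewrite /z' /delay; case: ifP => //; lia.
  rewrite -hz; last by rewrite /d in hnk *; lia.
  congr (_ + _); rewrite /bdf_diff; congr (_ *: _); apply: eq_bigr => i _.
  congr (_ *: DtoX S _); rewrite /z' /delay; case: ifP => [|_].
    by have := ltn_ord i; rewrite /d in hnk *; lia.
  by congr z; lia.
have kN : (k <= N)%N by lia.
have := hC s N f' z' hs kN eqn; rewrite -/tau.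
rewrite (@dLp_zero _ _ _ _ 0 _ (fun i => DtoX S (z' i))) //; last first.
  by move=> n hn; rewrite z'0 ?linear0 //; lia.
rewrite (@dLp_zero _ _ _ _ 0 _ z') //; last by move=> n hn; rewrite z'0 //; lia.
rewrite mulr0 !addr0.
move/(dLp_split p0 t0 (ltW C0) (dLp_ge0 _ _ _ _ _)).
move: (dLp_powE k N f' p0 (ltW t0)); move: (dLp _ _ _ _ f') => y ->.
rewrite (_ : \sum_(k <= n < N.+1) rnorm (f' n) `^ p
           = \sum_(k <= n < m.+1) rnorm (f n) `^ p); last first.
  apply: sum_shift_eq => // n hn.
    by rewrite /f' ifT ?rnorm0 ?powR0 ?gt_eqF // /d; lia.
  by rewrite /f' /d ltn_add2r ltnNge; case/andP: hn => -> /=; rewrite addnK.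
apply: le_trans; rewrite /energy ler_wpM2l ?(ltW t0) //.
apply: sum_shift_ge; [by []|move=> n|move=> n hn].
  exact: energy_summand_ge0.
have e : (n + (N - m)).-1 = (n.-1 + (N - m))%N by lia.
by rewrite e /z' !delayE.
Qed.

End Discrete.

(** * The embedding into W at grid points *)

Section Integrals.
Context {R : realType}.
Local Notation mu := (@lebesgue_measure R).
Local Open Scope ereal_scope.
Import HBNNSimple.

(* Monotonicity without measurability: the integral is a supremum over
   simple functions, which may be cut off on the exceptional null set. *)
Lemma ge0_le_integral_ae d (U : measurableType d) (nu : {measure set U -> \bar R})
    (D : set U) (f g : U -> \bar R) :
  (forall x, D x -> 0 <= f x) -> (forall x, D x -> 0 <= g x) ->
  {ae nu, forall x, D x -> f x <= g x} ->
  \int[nu]_(x in D) f x <= \int[nu]_(x in D) g x.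
Proof.
move=> f0 g0 [N [mN N0 hN]].
rewrite !ge0_integralE //; apply: ge_ereal_sup => _ [h /= hf <-].
apply: le_ereal_sup_tmp.
have mC := measurableC mN.
exists (sintegral nu (proj_nnsfun h mC)).
  exists (proj_nnsfun h mC) => // x.
  have -> : proj_nnsfun h mC x = (h x * \1_(~` N) x)%R by [].
  rewrite indicE; have [xN|xN] := boolP (x \in ~` N); last first.
    by rewrite mulr0 erestrict_ge0.
  rewrite mulr1; apply: le_trans (hf x) _; rewrite !patchE.
  case: ifPn => // xD; rewrite leNgt; apply/negP => fg.
  have /(_ x) := hN; rewrite /= => /(_ _); have := set_mem xN; apply: contra_not.
  by apply=> /(_ (set_mem xD)); rewrite leNgt fg.
rewrite -[leLHS](_ : \int[nu]_x (h x)%:E = _); last by rewrite integral_nnsfun // patch_setT.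
rewrite -[leRHS](_ : \int[nu]_x (proj_nnsfun h mC x)%:E = _); last first.
  by rewrite integral_nnsfun // patch_setT.
rewrite le_eqVlt; apply/orP; left; apply/eqP; apply: ae_eq_integral => //.
- by apply/measurable_EFinP; exact: measurable_funP.
- by apply/measurable_EFinP; exact: measurable_funP.
exists N; split => // x /= hx; apply: contrapT => xN; apply: hx => _.
by rewrite -[RHS]/((h x * \1_(~` N) x)%R%:E) indicE mem_set // mulr1.
Qed.

Lemma mu_oc (a b : R) : (a <= b)%R -> mu `]a, b]%classic = (b - a)%:E.
Proof.
move=> ab; have := lebesgue_measure_itv `]a, b]; rewrite /= lte_fin => h.
apply: etrans h _; case: ltP => [_|ba]; first by rewrite EFinB.
by rewrite (@le_anti _ _ a b) ?ab // subrr.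
Qed.

Lemma integral_step (tau : R) (N : nat) (b : nat -> R) : (0 <= tau)%R ->
  (forall i, (0 <= b i)%R) ->
  \int[mu]_t (\sum_(i < N) (b i)%:E * (\1_(`]i%:R * tau, i.+1%:R * tau]%classic) t)%:E)
  = (tau * \sum_(i < N) b i)%:E.
Proof.
move=> t0 b0; rewrite ge0_integral_sum //; first last.
- by move=> i x _; rewrite mule_ge0 ?lee_fin.
- by move=> i; apply: measurable_funeM; apply/measurable_EFinP; exact: measurable_indic.
rewrite mulr_sumr -sumEFin; apply: eq_bigr => i _.
rewrite ge0_integralZl_EFin //; last first.
  by apply/measurable_EFinP; exact: measurable_indic.
rewrite integral_indic // setIT; transitivity ((b i)%:E * (i.+1%:R * tau - i%:R * tau)%:E).
  by congr (_ * _); apply: mu_oc; rewrite ler_wpM2r // ler_nat.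
by rewrite -EFinM -natr1 mulrDl mul1r addrAC subrr add0r mulrC.
Qed.

Lemma cell_ex (tau t : R) (N : nat) : (0 < t)%R -> (t <= N%:R * tau)%R ->
  exists2 i : nat, (i < N)%N & (i%:R * tau < t <= i.+1%:R * tau)%R.
Proof.
move=> t0; elim: N => [|N IH]; first by rewrite mul0r leNgt t0.
move=> h; have [/IH[i iN hi]|tN] := leP t (N%:R * tau)%R.
  by exists i => //; lia.
by exists N => //; rewrite tN.
Qed.

(** Only the dominating step function has to be measurable: [ge0_le_integral_ae] compares it with
    [f] cell by cell. *)
Lemma Lpnorm_le_step (Y : normedModType R[i]) (p tau : R) (N : nat) (f : R -> Y)
    (b : nat -> R) :
  (0 < p)%R -> (0 <= tau)%R -> (forall i, (0 <= b i)%R) ->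
  (forall i t, (i < N)%N -> (i%:R * tau < t <= i.+1%:R * tau)%R ->
    (rnorm (f t) <= b i)%R) ->
  Lpnorm p%:E `[0%R, (N%:R * tau)%R]%classic f
  <= ((tau * \sum_(i < N) b i `^ p) `^ p^-1)%:E.
Proof.
move=> p0 t0 b0 hf; rewrite /Lpnorm unlock /= -poweR_EFin.
have S0 : (0 <= tau * \sum_(i < N) b i `^ p)%R.
  by rewrite mulr_ge0 // sumr_ge0 // => i _; exact: powR_ge0.
apply: gt0_ler_poweR; rewrite ?invr_ge0 ?(ltW p0) //.
- by rewrite in_itv /= leey integral_ge0 // => x _; exact: poweR_ge0.
- by rewrite in_itv /= leey lee_fin S0.
rewrite -(@integral_step tau N (fun i => b i `^ p)%R) //; last by move=> i; exact: powR_ge0.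
apply: ge0_le_integral_ae => [x _|x _|].
- by rewrite lee_fin powR_ge0.
- by apply: sume_ge0 => i _; rewrite mule_ge0 // lee_fin ?powR_ge0.
(* The half-open cells cover the interval except for the point 0. *)
exists [set 0%R]; split; [exact: measurable_set1|exact: lebesgue_measure_set1|].
move=> t /= h; apply: contrapT => tn0; apply: h => _.
have sum0 : 0 <= \sum_(i < N) (b i `^ p)%:E * (\1_(`]i%:R * tau, i.+1%:R * tau]%classic) t)%:E.
  by apply: sume_ge0 => i _; rewrite mule_ge0 // lee_fin ?powR_ge0.
rewrite patchE; case: ifPn => [|_]; last first.
  by rewrite normr0 powR0 ?gt_eqF.
rewrite inE /= in_itv /= => /andP[t0' tN].
have tp : (0 < t)%R by rewrite lt_neqAle t0' andbT eq_sym; apply/eqP.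
have [i iN hi] := cell_ex tp tN.
rewrite ger0_norm ?rnorm_ge0 //.
apply: (@le_trans _ _ (b i `^ p)%:E).
  by rewrite lee_fin le_powR ?rnorm_ge0 ?(ltW p0) // hf.
rewrite (bigD1 (Ordinal iN)) //= indicE mem_set ?mule1; last by rewrite /= in_itv.
by rewrite leeDl //; apply: sume_ge0 => j _; rewrite mule_ge0 // lee_fin ?powR_ge0.
Qed.

End Integrals.

Section Interpolation.
Context {R : realType}.
Local Notation mu := (@lebesgue_measure R).

(** The primitive, vanishing at 0, of the indicator of the [i]-th cell divided by [tau]; see
    [mu_ramp]. *)
Definition ramp (tau : R) (i : nat) (t : R) : R :=
  Num.min 1 (Num.max 0 (t / tau - i%:R)).

Lemma ramp_bounds tau i t : 0 <= ramp tau i t <= 1.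
Proof. by rewrite /ramp le_min ler01 le_max lexx ge_min lexx. Qed.

Lemma ramp_left (tau : R) i t : 0 < tau -> t <= i%:R * tau -> ramp tau i t = 0.
Proof.
move=> t0 h; rewrite /ramp max_l ?min_r ?ler01 //.
by rewrite subr_le0 ler_pdivrMr.
Qed.

Lemma ramp_right (tau : R) i t : 0 < tau -> i.+1%:R * tau <= t -> ramp tau i t = 1.
Proof.
move=> t0 h; rewrite /ramp min_l //.
by rewrite le_max lerBrDr nat1r ler_pdivlMr // h orbT.
Qed.

Lemma dist_min_le (a x y : R) : `|Num.min a x - Num.min a y| <= `|x - y|.
Proof.
have := ler_norm (x - y); have := ler_norm (y - x); rewrite (distrC y x).
have := normr_ge0 (x - y); rewrite ler_norml; set n := `|x - y|.
by rewrite /Num.min; case: ltP => ?; case: ltP => ????; apply/andP; split; lra.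
Qed.

Lemma dist_max_le (a x y : R) : `|Num.max a x - Num.max a y| <= `|x - y|.
Proof.
have := ler_norm (x - y); have := ler_norm (y - x); rewrite (distrC y x).
have := normr_ge0 (x - y); rewrite ler_norml; set n := `|x - y|.
by rewrite /Num.max; case: ltP => ?; case: ltP => ????; apply/andP; split; lra.
Qed.

Lemma ramp_lipschitz (tau : R) i s t : 0 < tau ->
  `|ramp tau i t - ramp tau i s| <= `|t - s| / tau.
Proof.
move=> t0; apply: le_trans (dist_min_le _ _ _) _; apply: le_trans (dist_max_le _ _ _) _.
by rewrite opprB addrA subrK -mulrBl normrM (@gtr0_norm _ tau^-1) ?invr_gt0.
Qed.

Lemma mu_ramp (tau : R) i t : 0 < tau -> 0 <= t ->
  fine (mu (`[0, t]%classic `&` `]i%:R * tau, i.+1%:R * tau]%classic)) = tau * ramp tau i t.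
Proof.
move=> t0 tge; set a := i%:R * tau; set b := i.+1%:R * tau.
have a0 : 0 <= a by rewrite mulr_ge0 ?ler0n // ltW.
have ab : b = a + tau by rewrite /a /b -natr1 mulrDl mul1r.
have -> : `[0, t]%classic `&` `]a, b]%classic = `]a, (Num.min t b)]%classic :> set R.
  apply/seteqP; split => x /=; rewrite !in_itv /=.
    by case=> /andP[_ h1] /andP[h2 h3]; rewrite h2 le_min h1 h3.
  case/andP=> ax; rewrite le_min => /andP[-> ->]; split; rewrite ?andbT ?ax //.
  by rewrite ltW // (le_lt_trans a0).
have [ta|at_] := leP t a.
  rewrite ramp_left // mulr0 set_itv_ge ?measure0 //.
  by rewrite bnd_simp -leNgt ge_min ta.
rewrite mu_oc /=; last by rewrite le_min (ltW at_) /= ab lerDl ltW.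
have [bt|tb] := leP b t.
  by rewrite ramp_right // mulr1 ab addrAC subrr add0r.
rewrite /ramp max_r; last by rewrite subr_ge0 ler_pdivlMr // ltW.
rewrite min_r; last first.
  by rewrite lerBlDr ler_pdivrMr // mulrDl mul1r addrC -ab ltW.
by rewrite mulrBr mulrC divfK ?gt_eqF // mulrC.
Qed.

(** A half-open interval of positive length does not fit into a null set. *)
Lemma ae_point (P : set R) a b : {ae mu, forall t, P t} -> a < b ->
  exists2 t, a < t <= b & P t.
Proof.
move=> [N [mN N0 hN]] ab; apply: contrapT => h.
have sub : `]a, b]%classic `<=` N.
  move=> t /=; rewrite in_itv /= => ht; apply: hN => /= Pt.
  by apply: h; exists t.
have : (mu `]a, b]%classic <= mu N)%E by apply: le_measure; rewrite ?inE.
have -> : mu N = 0%E by exact: N0.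
by rewrite (mu_oc (ltW ab)) lee_fin subr_le0 leNgt ab.
Qed.

Section Interp.
Context {Y : normedModType R[i]}.
Implicit Types (z : nat -> Y).

(** The piecewise linear interpolant of [z - z 0]. Written as increments times ramps, it has its
    primitive property and its Lipschitz bound term by term. *)
Definition interp (tau : R) (N : nat) z (t : R) : Y :=
  \sum_(i < N) (ramp tau i t)%:C *: (z i.+1 - z i).

Lemma interp_cell tau N z j t : 0 < tau -> z 0%N = 0 -> (j < N)%N ->
  j%:R * tau < t <= j.+1%:R * tau ->
  interp tau N z t = (1 - ramp tau j t)%:C *: z j + (ramp tau j t)%:C *: z j.+1.
Proof.
move=> t0 z0 jN /andP[jt tj].
rewrite /interp -(big_mkord xpredT (fun i => (ramp tau i t)%:C *: (z i.+1 - z i))).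
rewrite (@big_cat_nat _ _ _ j) //=; last exact: ltnW.
rewrite [X in _ + X](@big_cat_nat _ _ _ j.+1) //= big_nat1 addrA.
rewrite [X in _ + X]big_nat_cond [X in _ + X]big1 ?addr0; last first.
  move=> i /andP[/andP[ji _] _]; rewrite ramp_left ?scale0r //.
  by apply: le_trans tj _; rewrite ler_wpM2r ?ler_nat // ltW.
rewrite (eq_big_nat _ _ (F2 := fun i => z i.+1 - z i)); last first.
  move=> i /andP[_ ij]; rewrite ramp_right ?scale1r //.
  by apply: le_trans _ (ltW jt); rewrite ler_wpM2r ?ler_nat // ltW.
rewrite telescope_sumr // z0 subr0 rmorphB /= scalerBl scale1r scalerBr.
by rewrite [_ *: _ - _]addrC addrA.
Qed.

Lemma interp_end tau N z : 0 < tau -> z 0%N = 0 -> interp tau N z (N%:R * tau) = z N.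
Proof.
move=> t0 z0; rewrite /interp.
rewrite -(big_mkord xpredT (fun i => (ramp tau i (N%:R * tau))%:C *: (z i.+1 - z i))).
rewrite (eq_big_nat _ _ (F2 := fun i => z i.+1 - z i)); last first.
  move=> i /andP[_ ij]; rewrite ramp_right ?scale1r //.
  by rewrite ler_wpM2r ?ler_nat // ltW.
by rewrite telescope_sumr // z0 subr0.
Qed.

Lemma interp0 tau N z : 0 < tau -> interp tau N z 0 = 0.
Proof.
move=> t0; rewrite /interp big1 // => i _.
by rewrite ramp_left ?scale0r // mulr_ge0 ?ler0n // ltW.
Qed.

Lemma interp_le tau N z j t : 0 < tau -> z 0%N = 0 -> (j < N)%N ->
  j%:R * tau < t <= j.+1%:R * tau ->
  rnorm (interp tau N z t) <= rnorm (z j) + rnorm (z j.+1).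
Proof.
move=> t0 z0 jN h; rewrite (interp_cell t0 z0 jN h).
have /andP[r0 r1] := ramp_bounds tau j t.
apply: le_trans (rnormD _ _) _; rewrite !rnormZR !ger0_norm ?subr_ge0 //.
have := rnorm_ge0 (z j); have := rnorm_ge0 (z j.+1); set A := rnorm _; set B := rnorm _.
by move=> A0 B0; apply: lerD; rewrite ler_piMl // gerBl.
Qed.

Lemma interp_lipschitz tau N z : 0 < tau ->
  exists2 L, 0 < L & forall s t,
    rnorm (interp tau N z t - interp tau N z s) <= L * `|t - s|.
Proof.
(* The summand 1 keeps the constant positive when all increments vanish. *)
move=> t0; exists (1 + \sum_(i < N) rnorm (z i.+1 - z i) / tau) => [|s t].
  by rewrite ltr_wpDr // sumr_ge0 // => i _; rewrite divr_ge0 ?rnorm_ge0 // ltW.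
rewrite /interp -sumrB; apply: le_trans (rnorm_sum _ _ _) _.
rewrite mulrDl mul1r -[leLHS]add0r lerD ?normr_ge0 // mulr_suml.
apply: ler_sum => i _; rewrite -scalerBl -rmorphB rnormZR mulrC -mulrA.
by rewrite ler_wpM2l ?rnorm_ge0 // mulrC ramp_lipschitz.
Qed.

End Interp.

Lemma interpE (Y Z : normedModType R[i]) (f : {linear Y -> Z}) tau N (z : nat -> Y) t :
  f (interp tau N z t) = interp tau N (fun i => f (z i)) t.
Proof. by rewrite /interp linear_sum; apply: eq_bigr => i _; rewrite linearZ linearB. Qed.

Section Steps.
Context {Y : normedModType R[i]}.

Lemma cell_measurable (tau : R) i :
  measurable (`]i%:R * tau, i.+1%:R * tau]%classic : set (measurableTypeR R)).
Proof. exact: measurable_itv. Qed.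

Lemma cell_finite (tau : R) i : 0 <= tau ->
  (mu `](i%:R * tau)%R, (i.+1%:R * tau)%R]%classic < +oo)%E.
Proof. by move=> t0; rewrite mu_oc ?ltry // ler_wpM2r // ler_nat. Qed.

Definition grid_step (tau : R) (t0 : 0 <= tau) (N : nat) (y : nat -> Y) : stepfun Y :=
  @Stepfun R Y N (fun i => `]i%:R * tau, i.+1%:R * tau]%classic) (fun i => y i)
    (fun i => cell_measurable tau i) (fun i => cell_finite i t0).

Lemma grid_step_cell (tau : R) (t0 : 0 <= tau) N y j t : (j < N)%N ->
  j%:R * tau < t <= j.+1%:R * tau -> sf_fun (grid_step t0 N y) t = y j.
Proof.
move=> jN /andP[jt tj]; rewrite /sf_fun /= (bigD1 (Ordinal jN)) //=.
rewrite indicE mem_set ?scale1r /=; last by rewrite in_itv /= jt tj.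
rewrite big1 ?addr0 // => i ij; rewrite indicE memNset ?scale0r //= in_itv /=.
move=> /andP[it ti]; have [h|h|h] := ltngtP i j; last first.
- by move/negP: ij; apply; apply/eqP/val_inj.
- have : j.+1%:R * tau <= i%:R * tau by rewrite ler_wpM2r ?ler_nat.
  lra.
- have : i.+1%:R * tau <= j%:R * tau by rewrite ler_wpM2r ?ler_nat.
  lra.
Qed.

(** Step functions with the values at left end points on ever finer grids converge. At [t = 0],
    which lies in no half-open cell, the step functions vanish, and so does [f]. *)
Lemma lipschitz_strongly_measurable (f : R -> Y) (L T : R) : 0 < L -> 0 < T ->
  f 0 = 0 -> (forall s t, rnorm (f t - f s) <= L * `|t - s|) ->
  strongly_measurable `[0, T]%classic f.
Proof.
move=> L0 T0 f0 hL.
have h0 n : 0 <= T / n.+1%:R by rewrite divr_ge0 // ltW.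
exists (fun n => grid_step (h0 n) n.+1 (fun j => f (j%:R * (T / n.+1%:R)))).
apply: aeW => t /=; rewrite in_itv /= => /andP[t0 tT].
apply/cvg_rnormP => e e0.
have : \forall n \near \oo, L * (T / n.+1%:R) < e.
  near=> n; rewrite mulrA ltr_pdivrMr // [e * _]mulrC -ltr_pdivrMr //.
  by rewrite -natr1; apply: ltr_wpDr => //; near: n; exact: nbhs_infty_gtr.
apply: filterS => n hn; have [->|tn0] := eqVneq t 0.
  rewrite f0 subr0 /sf_fun /= big1 ?rnorm0 // => i _.
  rewrite indicE memNset ?scale0r //= in_itv /= => /andP[].
  by rewrite ltNge mulr_ge0 ?ler0n.
have tp : 0 < t by rewrite lt_neqAle eq_sym tn0.
have tT' : t <= n.+1%:R * (T / n.+1%:R) by rewrite mulrC divfK.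
have [j jn hj] := cell_ex tp tT'.
rewrite (grid_step_cell _ _ jn hj) rdistC; apply: le_lt_trans (hL _ _) _.
apply: le_lt_trans hn; rewrite ler_wpM2l ?(ltW L0) //.
move: hj; rewrite -[j.+1%:R]natr1 mulrDl mul1r => /andP[h1 h2].
by rewrite ger0_norm ?subr_ge0 ?(ltW h1) // lerBlDl.
Unshelve. all: end_near. Qed.

End Steps.

End Interpolation.

Section Embedding.
Context {R : realType} {V H V' D W X : completeNormedModType R[i]}.
Variable S : spaces V H V' D W X.
Local Notation mu := (@lebesgue_measure R).

(** The step function approximates itself, so its Bochner integral is [sf_int], which [mu_ramp]
    identifies with the interpolant summand by summand. *)
Lemma grid_step_primitive {Y : normedModType R[i]} (tau T : R) (N : nat)
    (t0 : 0 <= tau) (z : nat -> Y) : 0 < tau ->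
  is_primitive `[0, T]%classic
    (sf_fun (grid_step t0 N (fun i => (tau^-1)%:C *: (z i.+1 - z i))))
    (interp tau N z).
Proof.
move=> tp t /=; rewrite in_itv /= => /andP[t_ge0 _].
set s := grid_step _ _ _; split; first by exists (fun=> s); apply: aeW => u _; exact: cvg_cst.
exists (fun=> s); split.
  rewrite (_ : (fun _ => _) = fun=> 0%E); first exact: cvg_cst.
  apply/funext => n; apply: integral0_eq => u _.
  by rewrite subrr rnorm0.
rewrite interp0 // subr0 (_ : (fun _ => _) = fun=> interp tau N z t); first exact: cvg_cst.
apply/funext => n; rewrite /sf_int /interp; apply: eq_bigr => i _ /=.
by rewrite mu_ramp // scalerA -rmorphM /= mulrAC divff ?gt_eqF // mul1r.
Qed.

Lemma lee_scale_add (x y : \bar R) (a b c : R) : 0 <= c ->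
  (x <= a%:E -> y <= b%:E -> c%:E * (x + y) <= (c * (a + b))%:E)%E.
Proof.
move=> c0 xa yb; rewrite EFinM EFinD; apply: lee_wpmul2l; first by rewrite lee_fin.
exact: leeD.
Qed.

(** (A5) is applied to the interpolant of [z] on the whole interval, where [z N] is the value at
    [T]. Hence only the terminal node is reached here; the other nodes come later by delaying. *)
Lemma terminal_embedding (T p : R) : 0 < T -> 1 < p -> embedding_assumption S T p ->
  exists2 C : R, 0 < C & forall (N : nat) (z : nat -> D), (0 < N)%N -> z 0%N = 0 ->
    rnorm (DtoW S (z N)) `^ p <= C * energy S p (T / N%:R) z 1 N.
Proof.
move=> T0 p1 [_ [CW CW0 hW]]; have p0 : 0 < p by apply: lt_trans p1.
(* The outer [2^p] splits the sum of the two norms; the inner [2^p * 2] comes from bounding the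
   interpolant on a cell by the sum of its two end values. *)
exists (CW `^ p * (2 `^ p * (1 + 2 `^ p * 2))) => [|N z N0 z0].
  by rewrite !mulr_gt0 ?powR_gt0 // ltr_wpDr ?mulr_ge0 ?powR_ge0.
set tau := T / N%:R; have t0 : 0 < tau by rewrite divr_gt0 // ltr0n.
have TN : N%:R * tau = T by rewrite mulrC divfK // pnatr_eq0 -lt0n.
set I : set R := `[0, T]%classic in hW.
pose v := interp tau N z.
pose y i := (tau^-1)%:C *: (DtoX S (z i.+1) - DtoX S (z i)).
pose s := grid_step (ltW t0) N y.
pose a := (tau * \sum_(i < N) (tau^-1 * rnorm (DtoX S (z i.+1 - z i))) `^ p) `^ p^-1.
pose b := (tau * \sum_(i < N) (rnorm (z i) + rnorm (z i.+1)) `^ p) `^ p^-1.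
have ha : (Lpnorm p%:E I (sf_fun s) <= a%:E)%E.
  rewrite /I -TN; apply: (@Lpnorm_le_step _ _ p tau N _ (fun i => tau^-1 * rnorm (DtoX S (z i.+1 - z i))) p0 (ltW t0)) => [i|i t iN it].
    by rewrite mulr_ge0 ?rnorm_ge0 // invr_ge0 ltW.
  rewrite (grid_step_cell _ _ iN it) /y rnormZR gtr0_norm ?invr_gt0 //.
  by rewrite linearB.
have hb : (Lpnorm p%:E I v <= b%:E)%E.
  rewrite /I -TN; apply: (@Lpnorm_le_step _ _ p tau N _ (fun i => rnorm (z i) + rnorm (z i.+1)) p0 (ltW t0)) => [i|i t iN it].
    by rewrite addr_ge0 ?rnorm_ge0.
  exact: interp_le.
have [L L0 hL] := interp_lipschitz N z t0.
have hv : inLp p%:E `[0, T]%classic v.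
  split; last by apply: le_lt_trans hb _; rewrite ltry.
  exact: (lipschitz_strongly_measurable L0 T0 (interp0 N z t0) hL).
have hg : inLp p%:E `[0, T]%classic (sf_fun s).
  split; last by apply: le_lt_trans ha _; rewrite ltry.
  by exists (fun=> s); apply: aeW => u _; exact: cvg_cst.
have hvX : {ae mu, forall t, 0 <= t <= T ->
    DtoX S (v t) = interp tau N (fun i => DtoX S (z i)) t}.
  by apply: aeW => t _; exact: (interpE (DtoX S)).
move: (hW v (interp tau N (fun i => DtoX S (z i))) (sf_fun s) hv hg).
move=> /(_ (@grid_step_primitive _ tau T N (ltW t0) (fun i => DtoX S (z i)) t0)).
move=> /(_ hvX (interp0 N _ t0)).
move=> h; have {}h : (Lpnorm +oo I (fun t => DtoW S (v t)) <= (CW * (a + b))%:E)%E.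
  exact: le_trans h (lee_scale_add (ltW CW0) ha hb).
(* (A5) yields a bound almost everywhere only. If it failed at [T], it would fail by continuity on
   an interval ending at [T], which contains a point where it holds. *)
have key : rnorm (DtoW S (z N)) <= CW * (a + b).
  rewrite leNgt; apply/negP => lt_.
  set e := rnorm (DtoW S (z N)) - CW * (a + b); have e0 : 0 < e by rewrite subr_gt0.
  have [M M0 hM] := cont_bounded (@DtoW_cont _ _ _ _ _ _ _ S).
  have : {ae mu, forall t, I t -> rnorm (DtoW S (v t)) <= CW * (a + b)}.
    move: h; rewrite /Lpnorm unlock ifT; last first.
      apply: lt_le_trans (_ : (mu `]0%R, 1%R]%classic <= mu setT)%E); last first.
        by apply: le_measure; rewrite ?inE.
      by rewrite mu_oc // subr0 lte_fin.
    move/ess_supP; apply: filterS => t /=; rewrite patchE => + It.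
    by rewrite mem_set // lee_fin ger0_norm ?rnorm_ge0.
  (* [L] is the Lipschitz constant of [v] in [D] and [M] bounds the embedding into [W]: on this
     interval the W-norm changes by at most [e / 2], half of the supposed gap. *)
  move=> /(@ae_point _ _ (Num.max 0 (T - e / (2 * (M * L)))) T) [].
    by rewrite gt_max T0 /= ltrBlDr ltrDl divr_gt0 // mulr_gt0 // mulr_gt0.
  move=> t; rewrite gt_max => /andP[/andP[tp tl] tT].
  have It : I t by rewrite /I /= in_itv /= (ltW tp).
  move=> /(_ It) hle.
  have zT : z N = v T by rewrite -TN; symmetry; exact: interp_end.
  have h2 : rnorm (DtoW S (z N)) - rnorm (DtoW S (v t)) <= e / 2.
    apply: le_trans (rnorm_dist_le _ _) _; rewrite -linearB zT.
    apply: le_trans (hM _) _; apply: le_trans (ler_wpM2l (ltW M0) (hL _ _)) _.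
    rewrite ger0_norm ?subr_ge0 // mulrA -ler_pdivlMl ?mulr_gt0 //.
    rewrite lerBlDr -lerBlDl; apply: le_trans _ (ltW tl).
    by rewrite lerD2l lerN2 invfM mulrA mulrC.
  move: h2 hle; rewrite /e; lra.
have a0 : 0 <= a by exact: powR_ge0.
have b0 : 0 <= b by exact: powR_ge0.
have rt (F : 'I_N -> R) : ((tau * \sum_(i < N) F i `^ p) `^ p^-1) `^ p = tau * \sum_(i < N) F i `^ p.
  rewrite -powRrM mulVf ?gt_eqF // powRr1 // mulr_ge0 ?(ltW t0) //.
  by apply: sumr_ge0 => i _; exact: powR_ge0.
have ea := rt (fun i => tau^-1 * rnorm (DtoX S (z i.+1 - z i))); rewrite -/a in ea.
have eb := rt (fun i => rnorm (z i) + rnorm (z i.+1)); rewrite -/b in eb.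
move: key; clearbody a b => key.
apply: (le_trans (le_powR (ltW p0) (rnorm_ge0 _) key)).
rewrite (powRM _ (ltW CW0) (addr_ge0 a0 b0)) -[leRHS]mulrA.
apply: ler_wpM2l; first exact: powR_ge0.
apply: (le_trans (powR_addle p0 a0 b0)); rewrite ea eb -[leRHS]mulrA.
apply: ler_wpM2l; first exact: powR_ge0.
rewrite -mulrDr /energy mulrCA; apply: ler_wpM2l; first exact: ltW.
rewrite big_add1 big_mkord.
set A := \sum_(i < N) (_ `^ p).
set B := \sum_(i < N) rnorm (z i.+1) `^ p.
have -> : \sum_(i < N) ((tau^-1 * rnorm (DtoX S (z i.+1 - z i.+1.-1))) `^ p +
    rnorm (z i.+1) `^ p) = A + B by rewrite big_split.
have A0 : 0 <= A by apply: sumr_ge0 => i _; exact: powR_ge0.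
have B0 : 0 <= B by apply: sumr_ge0 => i _; exact: powR_ge0.
(* Left end points are traded for right ones, at no cost since [z 0] vanishes. *)
have shift : \sum_(i < N) rnorm (z i) `^ p <= B.
  have e : \sum_(i < N.+1) rnorm (z i) `^ p = B.
    by rewrite big_ord_recl /= z0 rnorm0 powR0 ?gt_eqF // add0r.
  rewrite -e.
  by rewrite big_ord_recr /= lerDl powR_ge0.
have hB : \sum_(i < N) (rnorm (z i) + rnorm (z i.+1)) `^ p <= 2 `^ p * (B + B).
  apply: (@le_trans _ _ (\sum_(i < N) (2 `^ p * (rnorm (z i) `^ p + rnorm (z i.+1) `^ p)))).
    by apply: ler_sum => i _; rewrite powR_addle ?rnorm_ge0.
  by rewrite -mulr_sumr big_split /= ler_wpM2l ?powR_ge0 // lerD2r.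
apply: le_trans (lerD (lexx A) hB) _.
have P0 : 0 <= 2 `^ p :> R by exact: powR_ge0.
have : 0 <= 2 `^ p * A by rewrite mulr_ge0.
by set P := 2 `^ p; nra.
Qed.

End Embedding.

(** * Rearranged sums, operator norms and the variation of A *)

Section Sums.
Context {R : realType}.

Lemma sum_back_le (F : nat -> R) (k m a : nat) : (a <= k)%N -> (forall j, 0 <= F j) ->
  \sum_(k <= n < m.+1) F (n - a)%N <= \sum_(0 <= j < m.+1 - a) F j.
Proof.
move=> ak F0; have -> : k = (k - a + a)%N by rewrite subnK.
rewrite big_addn; under eq_bigr do rewrite addnK.
have [h|h] := leqP (k - a) (m.+1 - a).
  by rewrite [leRHS](@big_cat_nat _ _ _ (k - a)) //= lerDr sumr_ge0.
by rewrite big_geq ?sumr_ge0 // ltnW.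
Qed.

(** Exchange of summations over the triangle [k <= n <= l < m]; the term [n = m] on the left has an
    empty inner sum. *)
Lemma sum_triangle (k m : nat) (G F : nat -> R) :
  \sum_(k <= n < m.+1) (\sum_(n <= l < m) F l) * G n
  = \sum_(k <= l < m) F l * \sum_(k <= n < l.+1) G n.
Proof.
transitivity (\sum_(k <= n < m.+1) \sum_(k <= l < m | (n <= l)%N) F l * G n).
  apply: eq_big_nat => n /andP[kn _]; rewrite (big_nat_widenl _ _ _ _ _ kn) /= mulr_suml.
  by apply: eq_bigl => l.
rewrite (exchange_big_dep_nat xpredT) //=; apply: eq_big_nat => l /andP[_ lm].
rewrite mulr_sumr [RHS](big_nat_widen _ _ m.+1) //; last exact: ltnW.
Qed.

Lemma sum_nat_sub_ge (F : nat -> R) (k m N : nat) : (m <= N)%N ->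
  (forall j, 0 <= F j) -> \sum_(k <= j < m) F j <= \sum_(0 <= j < N) F j.
Proof.
move=> mN F0; have [km|mk] := leqP k m; last by rewrite big_geq ?sumr_ge0 // ltnW.
rewrite [leRHS](@big_cat_nat _ _ _ m) //= (@big_cat_nat _ _ _ k 0 m) //=.
by rewrite -addrA addrCA lerDl addr_ge0 // sumr_ge0.
Qed.

End Sums.

Section Opnorm.
Context {R : realType} {Y Z : normedModType R[i]}.

Lemma opnorm_ge0 (f : Y -> Z) : (0 <= opnorm f)%E.
Proof.
apply: le_trans (_ : (rnorm (f 0))%:E <= _)%E; first by rewrite lee_fin rnorm_ge0.
by apply: ereal_sup_ubound; exists 0 => //=; rewrite rnorm0.
Qed.

(** Normalizing [y] takes a real factor only, so homogeneity under real scalars is enough; this also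
    covers the antilinear pairing with an element of [V']. *)
Lemma opnorm_le (f : Y -> Z) (y : Y) : (forall (a : R) x, f (a%:C *: x) = a%:C *: f x) ->
  (opnorm f < +oo)%E -> rnorm (f y) <= fine (opnorm f) * rnorm y.
Proof.
move=> fZ fin; have ffin : opnorm f \is a fin_num by rewrite ge0_fin_numE ?opnorm_ge0.
have [->|y0] := eqVneq y 0.
  by have := fZ 0 0; rewrite !scale0r => ->; rewrite !rnorm0 mulr0.
have ny : 0 < rnorm y by rewrite lt_neqAle eq_sym rnorm_eq0 y0 rnorm_ge0.
rewrite -ler_pdivrMr // -lee_fin fineK //.
apply: ereal_sup_ubound; exists ((rnorm y)^-1%:C *: y) => /=.
  by rewrite rnormZR gtr0_norm ?invr_gt0 // mulVf ?gt_eqF.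
by rewrite fZ rnormZR gtr0_norm ?invr_gt0 // mulrC.
Qed.

End Opnorm.

Section Variation.
Context {R : realType} {V H V' D W X : completeNormedModType R[i]}.
Variable S : spaces V H V' D W X.

(** Delaying by [N - m] steps moves node [m] to the terminal node [N]. The energy does not change,
    because the added values are zero. *)
Lemma horizon_embedding (T p : R) : 0 < T -> 1 < p -> embedding_assumption S T p ->
  exists2 C : R, 0 < C & forall (N k m : nat) (z : nat -> D), (0 < k)%N ->
    (k <= m <= N)%N -> (forall n, (n < k)%N -> z n = 0) ->
    rnorm (DtoW S (z m)) `^ p <= C * energy S p (T / N%:R) z k m.
Proof.
move=> T0 p1 emb; have p0 : 0 < p by apply: lt_trans p1.
have [C C0 hC] := terminal_embedding T0 p1 emb.
exists C => // N k m z k0 km z0.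
have zd n : (n < k + (N - m))%N -> delay (N - m) z n = 0.
  by move=> hn; rewrite /delay; case: ifP => // hnd; apply: z0; lia.
have := hC N (delay (N - m) z); rewrite zd; last by lia.
have -> : delay (N - m) z N = z m.
  by rewrite /delay ifF; [congr z|]; lia.
have N0 : (0 < N)%N by lia.
move=> /(_ N0 erefl) h; apply: (le_trans h).
apply: ler_wpM2l; first exact: ltW.
rewrite /energy; apply: ler_wpM2l; first by rewrite divr_ge0 // ltW.
rewrite (@big_cat_nat _ _ _ k) //=; last by lia.
have zero n : (n < k + (N - m))%N -> 
    (((T / N%:R)^-1 * rnorm (DtoX S (delay (N - m) z n - delay (N - m) z n.-1))) `^ p
      + rnorm (delay (N - m) z n) `^ p) = 0.
  move=> hn; rewrite !zd //; last by lia.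
  by rewrite subrr linear0 !rnorm0 mulr0 powR0 ?gt_eqF // addr0.
rewrite big_nat_cond big1 ?add0r; last by move=> n hn; apply: zero; lia.
rewrite (@sum_shift_eq _ k m N (fun n => ((T / N%:R)^-1 * rnorm (DtoX S (z n - z n.-1))) `^ p
      + rnorm (z n) `^ p)) // => [n hn|n hn]; first by apply: zero; lia.
have e : (n + (N - m)).-1 = (n.-1 + (N - m))%N by lia.
by rewrite e !delayE.
Qed.

(** [terminal_embedding] for the sequence whose only nonzero entry is [x], at the last node. It
    controls the starting errors in [W] one at a time. *)
Lemma single_embedding (T p : R) : 0 < T -> 1 < p -> embedding_assumption S T p ->
  exists2 C : R, 0 < C & forall (N : nat) (x : D), (0 < N)%N ->
    let tau := T / N%:R in
    rnorm (DtoW S x) `^ p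
    <= C * (tau * ((tau^-1 * rnorm (DtoX S x)) `^ p + rnorm x `^ p)).
Proof.
move=> T0 p1 emb; have p0 : 0 < p by apply: lt_trans p1.
have [C C0 hC] := terminal_embedding T0 p1 emb.
exists C => // N x N0 /=; have := hC N (fun n => if n == N then x else 0) N0.
have -> : (0 == N)%N = false by lia.
move=> /(_ erefl); rewrite eqxx /energy big_nat_recr //= eqxx.
rewrite big_nat_cond big1 ?add0r; last first.
  move=> n /andP[hn _]; have -> : (n == N) = false by lia.
  have -> : (n.-1 == N) = false by lia.
  by rewrite subrr linear0 !rnorm0 mulr0 powR0 ?gt_eqF // addr0.
have -> : (N.-1 == N) = false by lia.
by rewrite subr0.
Qed.

(* A(t_m) - A(t_n) telescopes, and (sum beta)^p <= M2^(p-1) sum beta. *)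
Lemma variation_sum_le (T p lambda : R) (A : linear_family S T) : 0 < T -> 1 < p ->
  stability_assumption lambda A ->
  exists2 M2 : R, 0 < M2 & forall N : nat, (0 < N)%N -> let tau := T / N%:R in
    exists beta : nat -> R, [/\ forall l, 0 <= beta l,
      \sum_(0 <= l < N) beta l <= M2 &
      forall (k m : nat) (z : nat -> D), (m <= N)%N ->
        \sum_(k <= n < m.+1)
           rnorm (opAX A (m%:R * tau) (z n) - opAX A (n%:R * tau) (z n)) `^ p
        <= M2 `^ (p - 1) *
           \sum_(k <= l < m) beta l * \sum_(k <= n < l.+1) rnorm (z n) `^ p].
Proof.
move=> T0 p1 [[M1 [M2 [_ M20 _ hM]]] _]; have p0 : 0 < p by apply: lt_trans p1.
exists M2 => // N N0 tau; have t0 : 0 < tau by rewrite divr_gt0 // ltr0n.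
have TN : N%:R * tau = T by rewrite mulrC divfK // pnatr_eq0 -lt0n.
have tn n : (n <= N)%N -> 0 <= n%:R * tau <= T.
  by move=> nN; rewrite mulr_ge0 ?(ltW t0) //= -TN ler_wpM2r ?ler_nat // ltW.
pose dA l d := opAX A (l.+1%:R * tau) d - opAX A (l%:R * tau) d.
have dAZ l a d : (l < N)%N -> dA l (a *: d) = a *: dA l d.
  by move=> lN; rewrite /dA !opAXZ ?scalerBr // tn // ltnW.
have := hM N (fun n => n%:R * tau); rewrite mul0r TN => /(_ erefl erefl).
have inc i : (i < N)%N -> i%:R * tau < i.+1%:R * tau.
  by move=> _; rewrite ltr_pM2r // ltr_nat.
move=> /(_ inc); rewrite big_add1 /= => hsum.
(* Each increment is a summand of a sum of nonnegative terms that is at most [M2]. *)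
have fin l : (l < N)%N -> (opnorm (dA l) < +oo)%E.
  move=> lN; apply: le_lt_trans (ltry M2); apply: le_trans hsum.
  rewrite (@big_cat_nat _ _ _ l) //=; last exact: ltnW.
  rewrite [X in (_ + X)%E]big_ltn //.
  rewrite addeCA leeDl // adde_ge0 // sume_ge0 // => i _; exact: opnorm_ge0.
pose beta l := if (l < N)%N then fine (opnorm (dA l)) else 0.
have b0 l : 0 <= beta l by rewrite /beta; case: ifP => // _; rewrite fine_ge0 // opnorm_ge0.
have bsum : \sum_(0 <= l < N) beta l <= M2.
  rewrite -lee_fin; apply: le_trans hsum; rewrite -sumEFin.
  rewrite !big_mkord; apply: lee_sum => l _; rewrite /beta ltn_ord fineK //.
  by rewrite ge0_fin_numE ?opnorm_ge0 // fin.
have dAle l d : (l < N)%N -> rnorm (dA l d) <= beta l * rnorm d.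
  move=> lN; rewrite /beta lN; apply: opnorm_le; last exact: fin.
  by move=> a x; exact: dAZ.
exists beta; split => // k m z mN.
(* Read backwards, the triangle gives for each [n] the variation from [n] to [m], so the claim can
   be proved term by term in [n]. *)
rewrite -sum_triangle mulr_sumr; apply: ler_sum_nat => n /andP[kn nm].
have tele : opAX A (m%:R * tau) (z n) - opAX A (n%:R * tau) (z n) = \sum_(n <= l < m) dA l (z n).
  by rewrite /dA (telescope_sumr (fun l => opAX A (l%:R * tau) (z n))).
have B0 : 0 <= \sum_(n <= l < m) beta l by rewrite sumr_ge0.
have hB : \sum_(n <= l < m) beta l <= M2.
  by apply: le_trans bsum; apply: sum_nat_sub_ge.
apply: (@le_trans _ _ (((\sum_(n <= l < m) beta l) * rnorm (z n)) `^ p)).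
  apply: le_powR; rewrite ?rnorm_ge0 ?(ltW p0) // tele.
  apply: le_trans (rnorm_sum _ _ _) _; rewrite mulr_suml; apply: ler_sum_nat => l /andP[_ lm].
  by apply: dAle; apply: leq_trans mN.
rewrite powRM ?rnorm_ge0 // mulrA ler_wpM2r ?powR_ge0 //.
exact: powR_le_lin.
Qed.

End Variation.

(** * Stability of the scheme *)

Section RealSums.
Context {R : realType}.

Lemma powR_add4_le (p a b c d : R) : 0 < p -> 0 <= a -> 0 <= b -> 0 <= c -> 0 <= d ->
  (a + b + c + d) `^ p <= 4 `^ p * (a `^ p + b `^ p + c `^ p + d `^ p).
Proof.
move=> p0 a0 b0 c0 d0.
have := @powR_sumle R p 4 (fun i => nth 0 [:: a; b; c; d] i) p0.
rewrite !big_ord_recl !big_ord0 /= !addr0 !addrA; apply.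
by case=> [|[|[|[|[|i]]]]].
Qed.

(** [q^p] comes from splitting each window sum; the second factor [q] arises because each offset
    [i < q] contributes at most one copy of the full sum. *)
Lemma powR_window_sum_le (p : R) (q k m a : nat) (F : nat -> R) : 0 < p ->
  (forall j, 0 <= F j) -> (q + a <= k.+1)%N ->
  \sum_(k <= n < m.+1) (\sum_(i < q) F (n - i - a)%N) `^ p
  <= q%:R `^ p * q%:R * \sum_(0 <= j < m.+1 - a) F j `^ p.
Proof.
move=> p0 F0 qk.
apply: (@le_trans _ _ (\sum_(k <= n < m.+1) q%:R `^ p * \sum_(i < q) F (n - i - a)%N `^ p)).
  by apply: ler_sum => n _; apply: (powR_sumle q (F := fun i => F (n - i - a)%N)).
rewrite -mulr_sumr -mulrA; apply: ler_wpM2l; first exact: powR_ge0.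
rewrite exchange_big /=.
apply: (@le_trans _ _ (\sum_(i < q) \sum_(0 <= j < m.+1 - a) F j `^ p)); last first.
  by rewrite sumr_const card_ord mulr_natl.
apply: ler_sum => i _; have ia : (i + a <= k)%N by have := ltn_ord i; lia.
under eq_bigr do rewrite -subnDA.
apply: le_trans (sum_back_le (F := fun j => F j `^ p) m ia (fun j => powR_ge0 _ _)) _.
apply: sum_nat_sub_ge; last by move=> j; exact: powR_ge0.
by rewrite leq_sub2l // leq_addl.
Qed.

(** The residual has four parts: [b] from differences of [B], [d] from consistency errors, [x] from
    starting values, [w] from freezing [A]. As [B] is taken at earlier nodes only, the sum over [b]
    stops before [m]. *)
Lemma rhs_power_sum (p G Dl : R) (k m : nat) (f b d x w : nat -> R) :
  0 < p -> 0 <= G -> 0 <= Dl -> (0 < k)%N ->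
  (forall n, 0 <= f n) -> (forall n, 0 <= b n) -> (forall n, 0 <= d n) ->
  (forall n, 0 <= x n) -> (forall n, 0 <= w n) ->
  (forall n, (k <= n <= m)%N ->
     f n <= G * (\sum_(i < k) b (n - i - 1)%N) + d n
            + Dl * (\sum_(i < k.+1) x (n - i)%N) + w n) ->
  \sum_(k <= n < m.+1) f n `^ p <=
  4 `^ p * (G `^ p * (k%:R `^ p * k%:R) * (\sum_(0 <= j < m) b j `^ p)
     + \sum_(k <= n < m.+1) d n `^ p
     + Dl `^ p * (k.+1%:R `^ p * k.+1%:R) * (\sum_(0 <= j < m.+1) x j `^ p)
     + \sum_(k <= n < m.+1) w n `^ p).
Proof.
move=> p0 G0 Dl0 k0 f0 b0 d0 x0 w0 hf.
pose s1 n := \sum_(i < k) b (n - i - 1)%N; pose s2 n := \sum_(i < k.+1) x (n - i)%N.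
have s10 n : 0 <= s1 n by exact: sumr_ge0.
have s20 n : 0 <= s2 n by exact: sumr_ge0.
apply: (@le_trans _ _ (\sum_(k <= n < m.+1)
   4 `^ p * ((G `^ p * s1 n `^ p + d n `^ p + Dl `^ p * s2 n `^ p) + w n `^ p))).
  apply: ler_sum_nat => n /andP[kn nm].
  have hn : (k <= n <= m)%N by rewrite kn -ltnS.
  apply: (le_trans (le_powR (ltW p0) (f0 n) (hf n hn))).
  rewrite -(powRM _ G0 (s10 n)) -(powRM _ Dl0 (s20 n)).
  exact: (powR_add4_le p0 (mulr_ge0 G0 (s10 n)) (d0 n) (mulr_ge0 Dl0 (s20 n)) (w0 n)).
rewrite -mulr_sumr; apply: ler_wpM2l; first exact: powR_ge0.
rewrite !big_split /= -!mulr_sumr -!mulrA.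
have e1 : \sum_(k <= n < m.+1) s1 n `^ p <= k%:R `^ p * k%:R * \sum_(0 <= j < m) b j `^ p.
  have := @powR_window_sum_le p k k m 1 b p0 b0; rewrite subn1; apply; lia.
have e2 : \sum_(k <= n < m.+1) s2 n `^ p
    <= k.+1%:R `^ p * k.+1%:R * \sum_(0 <= j < m.+1) x j `^ p.
  have := @powR_window_sum_le p k.+1 k m 0 x p0 x0; rewrite subn0 addn0 => /(_ (leqnn _)).
  by under [X in X <= _ -> _]eq_bigr do under eq_bigr do rewrite subn0.
apply: lerD => //; apply: lerD; [apply: lerD => //|]; apply: ler_wpM2l; rewrite ?powR_ge0 // mulrA //.
Qed.

End RealSums.

(** * The error equation and the recursion for its energy *)

Section Error.
Context {R : realType} {V H V' D W X : completeNormedModType R[i]}.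
Variable S : spaces V H V' D W X.

Definition gamma_mass k : R := \sum_(i < k) cabs (bdf_gamma k : {poly R[i]})`_i.

Lemma gamma_mass_ge0 k : 0 <= gamma_mass k.
Proof. by apply: sumr_ge0 => i _; exact: cabs_ge0. Qed.

Lemma bdf_rhs_dist (T tau : R) k (B : nonlinear_family S T) (v u : nat -> D) n (b : nat -> R) :
  (forall i, (i < k)%N -> rnorm (opBX B ((n - i - 1)%:R * tau) (v (n - i - 1)%N)
      - opBX B ((n - i - 1)%:R * tau) (u (n - i - 1)%N)) <= b (n - i - 1)%N) ->
  (forall j, 0 <= b j) ->
  rnorm (bdf_rhs k tau B v n - bdf_rhs k tau B u n)
  <= gamma_mass k * \sum_(i < k) b (n - i - 1)%N.
Proof.
move=> hb b0; rewrite /bdf_rhs -sumrB; apply: (le_trans (rnorm_sum _ _ _)).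
rewrite mulr_suml; apply: ler_sum => i _; rewrite -scalerBr rnormZ.
apply: ler_wpM2l; first exact: cabs_ge0.
apply: (le_trans (hb i (ltn_ord i))).
by rewrite (bigD1 i) //= lerDl sumr_ge0.
Qed.

(** (A4) is used with second argument [u t], after estimating the norm of [v] by those of [v - u t]
    and [u t]. In the product of the D-norm and the W-norm of the error, the W-norm is replaced by
    [rho]; hence a coefficient that shrinks with the radius. *)
Lemma tube_lipschitz (T r0 ltilde CB rho t : R) (u : R -> D) (B : nonlinear_family S T)
    (v : D) :
  0 <= CB -> rho <= r0 -> 0 <= t <= T ->
  local_lipschitz_assumption r0 ltilde CB u B ->
  rnorm (DtoW S (v - u t)) <= rho ->
  rnorm (opBX B t v - opBX B t (u t)) <=
  (ltilde + CB * rho) * rnorm (v - u t)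
  + 2 * CB * (rnorm (u t) * rnorm (DtoW S (v - u t))).
Proof.
move=> CB0 rr ht lip hv; set w := rnorm (DtoW S _) in hv *.
have r0ge : 0 <= r0 by apply: le_trans rr; apply: le_trans hv; exact: rnorm_ge0.
have tv : tube S T u r0 v by exists t => //; apply: le_trans hv rr.
have tu : tube S T u r0 (u t) by exists t => //; rewrite subrr linear0 rnorm0.
apply: (le_trans (lip t v (u t) ht tv tu)); rewrite -/w.
have hD : rnorm v <= rnorm (v - u t) + rnorm (u t).
  by rewrite -{1}(subrK (u t) v) rnormD.
have w0 : 0 <= w by exact: rnorm_ge0.
have := rnorm_ge0 (v - u t); have := rnorm_ge0 (u t).
set E := rnorm (v - u t) in hD *; set U := rnorm (u t) in hD * => U0 E0.
rewrite mulrDl -addrA lerD2l.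
apply: (@le_trans _ _ (CB * ((E + U + U) * w))).
  by rewrite -mulrA ler_wpM2l // ler_wpM2r // lerD2r.
have : CB * (E * w) <= CB * (E * rho) by rewrite ler_wpM2l // ler_wpM2l.
nra.
Qed.

Lemma addr_exchange (Z : zmodType) (a c x y : Z) : a - c + x = a + y - c + (x - y).
Proof. by rewrite (addrAC a y) -[RHS]addrA (addrCA y) subrr addr0. Qed.

(** The difference of the two schemes for [e = z + s]. As [s] vanishes from [k] on, it enters only
    through the BDF difference; the last term is the price of freezing [A] at [tm]. *)
Lemma error_equation (k n : nat) (tau T tm : R) (A : linear_family S T)
    (B : nonlinear_family S T) (us v : nat -> D) (d : nat -> X) :
  (k <= n)%N -> 0 <= n%:R * tau <= T ->
  bdf_diff k tau (fun m => DtoX S (us m)) n + opAX A (n%:R * tau) (us n)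
    = bdf_rhs k tau B us n + d n ->
  bdf_diff k tau (fun m => DtoX S (v m)) n + opAX A (n%:R * tau) (v n)
    = bdf_rhs k tau B v n ->
  let e j := v j - us j in
  let z j := if (j < k)%N then 0 else e j in
  let s j := if (j < k)%N then e j else 0 in
  bdf_diff k tau (fun j => DtoX S (z j)) n + opAX A tm (z n)
  = (bdf_rhs k tau B v n - bdf_rhs k tau B us n) - d n
    - bdf_diff k tau (fun j => DtoX S (s j)) n
    + (opAX A tm (z n) - opAX A (n%:R * tau) (z n)).
Proof.
move=> kn ht hu hv e z s.
have ze : z n = v n - us n by rewrite /z ltnNge kn.
have hz : bdf_diff k tau (fun j => DtoX S (z j)) n
    = bdf_diff k tau (fun j => DtoX S (v j)) n - bdf_diff k tau (fun j => DtoX S (us j)) n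
      - bdf_diff k tau (fun j => DtoX S (s j)) n.
  rewrite -!bdf_diffB; congr (bdf_diff k tau _ n); apply/funext => j.
  by rewrite -!linearB /z /s; case: ifP => _; rewrite ?subrr ?subr0.
have -> : opAX A (n%:R * tau) (z n) = opAX A (n%:R * tau) (v n) - opAX A (n%:R * tau) (us n).
  by rewrite ze opAXB.
rewrite hz.
have -> : bdf_rhs k tau B v n - bdf_rhs k tau B us n - d n
    = bdf_diff k tau (fun j => DtoX S (v j)) n - bdf_diff k tau (fun j => DtoX S (us j)) n
      + (opAX A (n%:R * tau) (v n) - opAX A (n%:R * tau) (us n)).
  by rewrite -addrA -opprD -hu -hv opprD addrACA.
exact: addr_exchange.
Qed.

End Error.

Section Recursion.
Context {R : realType} {V H V' D W X : completeNormedModType R[i]}.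
Variable S : spaces V H V' D W X.

Lemma energy_D_le (p tau : R) (z : nat -> D) (a b c : nat) : 0 < tau ->
  (b <= c.+1)%N ->
  tau * \sum_(a <= j < b) rnorm (z j) `^ p <= energy S p tau z a c.
Proof.
move=> t0 bc; apply: ler_wpM2l; first exact: ltW.
apply: (@le_trans _ _ (\sum_(a <= j < c.+1) rnorm (z j) `^ p)).
  have [ab|ba] := leqP a b.
    rewrite [leRHS](@big_cat_nat _ _ _ b) //= lerDl sumr_ge0 // => i _; exact: powR_ge0.
  by rewrite big_geq ?(ltnW ba) // sumr_ge0 // => i _; exact: powR_ge0.
by apply: ler_sum => j _; rewrite lerDr powR_ge0.
Qed.

(** [Y m] reappears on the right only with the factor [(ltilde + CB * rho)^p], to be absorbed. All
    other energies on the right belong to earlier nodes, with weights summable in [j]: the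
    increments of [A] and the norms of the exact solution. *)
Lemma energy_recursion (k N m : nat) (T p CM M2 C1 C2 r0 ltilde CB rho MD delta : R)
    (A : linear_family S T) (B : nonlinear_family S T) (u : R -> D) (d : nat -> X)
    (v : nat -> D) (beta : nat -> R) :
  let tau := T / N%:R in
  let us := fun n : nat => u (n%:R * tau) in
  let e := fun n => v n - us n in
  let z := fun n => if (n < k)%N then 0 else e n in
  let Y := energy S p tau z k in
  (0 < k)%N -> (k <= m <= N)%N -> 0 < T -> 1 < p -> 0 <= CM -> 0 <= C1 -> 0 <= C2 ->
  0 <= ltilde -> 0 <= CB -> 0 <= rho -> rho <= r0 ->
  (forall f : nat -> X,
     (forall n, (k <= n <= m)%N ->
       bdf_diff k tau (fun j => DtoX S (z j)) n + opAX A (m%:R * tau) (z n) = f n) ->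
     Y m <= CM * (tau * \sum_(k <= n < m.+1) rnorm (f n) `^ p)) ->
  (forall l, 0 <= beta l) ->
  (\sum_(k <= n < m.+1)
      rnorm (opAX A (m%:R * tau) (z n) - opAX A (n%:R * tau) (z n)) `^ p
   <= M2 `^ (p - 1) *
      \sum_(k <= l < m) beta l * \sum_(k <= n < l.+1) rnorm (z n) `^ p) ->
  (forall j, (k <= j < m)%N -> rnorm (DtoW S (e j)) `^ p <= C2 * Y j) ->
  (forall j, (j < k)%N -> rnorm (DtoW S (e j)) `^ p <= C1 * (2 * delta `^ p)) ->
  local_lipschitz_assumption r0 ltilde CB u B ->
  tau * \sum_(0 <= j < N.+1) rnorm (us j) `^ p <= MD `^ p ->
  (forall n, (k <= n <= N)%N ->
     bdf_diff k tau (fun m => DtoX S (us m)) n + opAX A (n%:R * tau) (us n)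
     = bdf_rhs k tau B us n + d n) ->
  (forall n, (k <= n <= N)%N ->
     bdf_diff k tau (fun m => DtoX S (v m)) n + opAX A (n%:R * tau) (v n)
     = bdf_rhs k tau B v n) ->
  tau * \sum_(k <= n < N.+1) rnorm (d n) `^ p <= delta `^ p ->
  tau * \sum_(0 <= j < k) ((tau^-1 * rnorm (DtoX S (e j))) `^ p + rnorm (e j) `^ p)
    <= 2 * delta `^ p ->
  (forall j, (j < m)%N -> rnorm (DtoW S (e j)) <= rho) ->
  Y m <= CM * (4 `^ p *
    (gamma_mass k `^ p * (k%:R `^ p * k%:R) *
       (2 `^ p * ((ltilde + CB * rho) `^ p * (2 * delta `^ p + Y m)
          + (2 * CB) `^ p * (C1 * (2 * delta `^ p) * MD `^ p
             + C2 * \sum_(k <= j < m) (tau * rnorm (us j) `^ p) * Y j)))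
     + delta `^ p
     + bdf_mass k `^ p * (k.+1%:R `^ p * k.+1%:R) * (2 * delta `^ p)
     + M2 `^ (p - 1) * \sum_(k <= l < m) beta l * Y l)).
Proof.
move=> tau us e z Y k0 km T0 p1 CM0 C10 C20 lt0 CB0 rho0 rr hMR b0 hBV hE hS lip hU hu hv hd hst hw.
have p0 : 0 < p by apply: lt_trans p1.
have N0 : (0 < N)%N by clear -k0 km; lia.
have t0 : 0 < tau by rewrite divr_gt0 // ltr0n.
have tge : 0 <= tau by exact: ltW.
have ti0 : 0 <= tau^-1 by rewrite invr_ge0.
have TN : N%:R * tau = T by rewrite mulrC divfK // pnatr_eq0 -lt0n.
have tn n : (n <= N)%N -> 0 <= n%:R * tau <= T.
  by move=> nN; rewrite mulr_ge0 //= -TN ler_wpM2r // ler_nat.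
pose s j := if (j < k)%N then e j else 0.
pose eps := ltilde + CB * rho.
have eps0 : 0 <= eps by rewrite addr_ge0 // mulr_ge0.
pose b j := eps * rnorm (e j) + 2 * CB * (rnorm (us j) * rnorm (DtoW S (e j))).
have CB2 : 0 <= 2 * CB by rewrite mulr_ge0.
have bge j : 0 <= b j.
  by apply: addr_ge0; apply: mulr_ge0 => //; rewrite ?rnorm_ge0 // mulr_ge0 ?rnorm_ge0.
pose x j := tau^-1 * rnorm (DtoX S (s j)).
have xge j : 0 <= x j by rewrite mulr_ge0 ?rnorm_ge0.
pose F n := (bdf_rhs k tau B v n - bdf_rhs k tau B us n) - d n
    - bdf_diff k tau (fun j => DtoX S (s j)) n
    + (opAX A (m%:R * tau) (z n) - opAX A (n%:R * tau) (z n)).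
have eqF n : (k <= n <= m)%N ->
    bdf_diff k tau (fun j => DtoX S (z j)) n + opAX A (m%:R * tau) (z n) = F n.
  move=> hn; have hnN : (k <= n <= N)%N by clear -hn km; lia.
  have kn : (k <= n)%N by clear -hn; lia.
  have nN : (n <= N)%N by clear -hn km; lia.
  exact: (error_equation _ kn (tn n nN) (hu n hnN) (hv n hnN)).
apply: (le_trans (hMR F eqF)); apply: ler_wpM2l => //.
have hF n : (k <= n <= m)%N -> rnorm (F n) <=
    gamma_mass k * (\sum_(i < k) b (n - i - 1)%N) + rnorm (d n)
    + bdf_mass k * (\sum_(i < k.+1) x (n - i)%N)
    + rnorm (opAX A (m%:R * tau) (z n) - opAX A (n%:R * tau) (z n)).
  move=> hn; apply: (le_trans (rnormD _ _)); rewrite lerD2r.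
  apply: (le_trans (rnormB _ _)); apply: lerD; last first.
    by rewrite /x -mulr_sumr; exact: (bdf_diff_le _ _ _ t0).
  apply: (le_trans (rnormB _ _)); rewrite lerD2r.
  apply: bdf_rhs_dist => // i ik; have jm : (n - i - 1 < m)%N by clear -hn k0; lia.
  have jN : (n - i - 1 <= N)%N by clear -hn km; lia.
  exact: (tube_lipschitz CB0 rr (tn _ jN) lip (hw _ jm)).
have := rhs_power_sum p0 (gamma_mass_ge0 k) (bdf_mass_ge0 k) k0 (fun n => rnorm_ge0 (F n))
  bge (fun n => rnorm_ge0 (d n)) xge (fun n => rnorm_ge0 _) hF.
move=> /(ler_wpM2l tge) h; apply: (le_trans h); rewrite mulrCA.
apply: ler_wpM2l; first exact: powR_ge0.
rewrite [leLHS]mulrDr [X in X + _ <= _]mulrDr [X in X + _ + _ <= _]mulrDr.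
have Sx : tau * \sum_(0 <= j < m.+1) x j `^ p <= 2 * delta `^ p.
  apply: le_trans hst; apply: ler_wpM2l => //.
  rewrite (@big_cat_nat _ _ _ k) //=; last by clear -km; lia.
  rewrite [X in _ + X]big_nat_cond [X in _ + X]big1 ?addr0; last first.
    move=> j /andP[hj _]; rewrite /x /s ltnNge; have -> /= : (k <= j)%N by clear -hj; lia.
    by rewrite linear0 rnorm0 mulr0 powR0 // gt_eqF.
  apply: ler_sum_nat => j /andP[_ jk]; rewrite /x /s jk lerDl; exact: powR_ge0.
have Sw : tau * \sum_(k <= n < m.+1)
      rnorm (opAX A (m%:R * tau) (z n) - opAX A (n%:R * tau) (z n)) `^ p
    <= M2 `^ (p - 1) * \sum_(k <= l < m) beta l * Y l.
  apply: (le_trans (ler_wpM2l tge hBV)); rewrite mulrCA.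
  apply: ler_wpM2l; first exact: powR_ge0.
  rewrite mulr_sumr; apply: ler_sum_nat => l /andP[kl lm]; rewrite mulrCA.
  by apply: ler_wpM2l => //; exact: energy_D_le.
have Sd : tau * \sum_(k <= n < m.+1) rnorm (d n) `^ p <= delta `^ p.
  apply: le_trans hd; apply: ler_wpM2l => //.
  rewrite [leRHS](@big_cat_nat _ _ _ m.+1) //=; [|by clear -km; lia|by clear -km; lia].
  by rewrite lerDl sumr_ge0 // => i _; exact: powR_ge0.
(* The sum over earlier nodes is estimated by the full energy at [m]; this is the term to be
   absorbed. *)
have SD : tau * \sum_(0 <= j < m) rnorm (e j) `^ p <= 2 * delta `^ p + Y m.
  rewrite (@big_cat_nat _ _ _ k) //=; last by clear -km; lia.
  rewrite mulrDr; apply: lerD.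
    apply: le_trans hst; apply: ler_wpM2l => //.
    by apply: ler_sum => j _; rewrite lerDr powR_ge0.
  rewrite (eq_big_nat _ _ (F2 := fun j => rnorm (z j) `^ p)); last first.
    by move=> j /andP[kj _]; rewrite /z ltnNge kj.
  exact: energy_D_le.
(* Nodes before [k] use the smallness of the starting errors, later ones the embedding at node [j];
   there [tau * rnorm (us j)^p] remains as a Gronwall weight. *)
have SU : tau * \sum_(0 <= j < m) (rnorm (us j) `^ p * rnorm (DtoW S (e j)) `^ p)
   <= C1 * (2 * delta `^ p) * MD `^ p
      + C2 * \sum_(k <= j < m) (tau * rnorm (us j) `^ p) * Y j.
  rewrite (@big_cat_nat _ _ _ k) //=; last by clear -km; lia.
  rewrite mulrDr; apply: lerD.
    apply: (@le_trans _ _ (C1 * (2 * delta `^ p) * (tau * \sum_(0 <= j < k) rnorm (us j) `^ p))).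
      rewrite mulrCA; apply: ler_wpM2l => //; rewrite mulr_sumr.
      apply: ler_sum_nat => j /andP[_ jk]; rewrite mulrC.
      by apply: ler_wpM2r; [exact: powR_ge0|exact: hS].
    apply: ler_wpM2l; first by rewrite mulr_ge0 // mulr_ge0 // powR_ge0.
    apply: le_trans hU; apply: ler_wpM2l => //.
    apply: sum_nat_sub_ge; [by clear -km; lia|move=> j; exact: powR_ge0].
  rewrite !mulr_sumr; apply: ler_sum_nat => j hj; rewrite mulrA mulrCA.
  by apply: ler_wpM2l; [rewrite mulr_ge0 // powR_ge0|exact: hE].
have Sb : tau * \sum_(0 <= j < m) b j `^ p
    <= 2 `^ p * (eps `^ p * (2 * delta `^ p + Y m)
          + (2 * CB) `^ p * (C1 * (2 * delta `^ p) * MD `^ p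
             + C2 * \sum_(k <= j < m) (tau * rnorm (us j) `^ p) * Y j)).
  apply: (@le_trans _ _ (tau * \sum_(0 <= j < m) 2 `^ p * (eps `^ p * rnorm (e j) `^ p
      + (2 * CB) `^ p * (rnorm (us j) `^ p * rnorm (DtoW S (e j)) `^ p)))).
    apply: ler_wpM2l => //; apply: ler_sum => j _.
    have h1 : 0 <= eps * rnorm (e j) by rewrite mulr_ge0 ?rnorm_ge0.
    have h3 : 0 <= rnorm (us j) * rnorm (DtoW S (e j)) by rewrite mulr_ge0 ?rnorm_ge0.
    have h2 : 0 <= 2 * CB * (rnorm (us j) * rnorm (DtoW S (e j))) by rewrite mulr_ge0.
    apply: (le_trans (powR_addle p0 h1 h2)).
    by rewrite (powRM _ eps0 (rnorm_ge0 _)) (powRM _ CB2 h3) (powRM _ (rnorm_ge0 _) (rnorm_ge0 _)).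
  rewrite -mulr_sumr mulrCA; apply: ler_wpM2l; first exact: powR_ge0.
  rewrite big_split /= -!mulr_sumr mulrDr; apply: lerD; rewrite mulrCA.
    by apply: ler_wpM2l => //; exact: powR_ge0.
  by apply: ler_wpM2l => //; exact: powR_ge0.
have K0 (a : R) q : 0 <= a `^ p * (q%:R `^ p * q%:R) by rewrite !mulr_ge0 ?powR_ge0.
apply: lerD => //; apply: lerD; last by rewrite mulrCA; apply: ler_wpM2l.
by apply: lerD => //; rewrite mulrCA; apply: ler_wpM2l.
Qed.

End Recursion.

(** * Absorption, choice of constants and the induction in the tube *)

Section Stability.
Context {R : realType}.

(** [Y] occurs on the right with a coefficient at most 1/2; moving it to the left doubles the
    rest. *)
Lemma absorb_recursion (Y CM P4 g P2 ep dp CBp C1 MDp C2 Su h M2p Sb : R) :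
  Y <= CM * (P4 * (g * (P2 * (ep * (2 * dp + Y) + CBp * (C1 * (2 * dp) * MDp + C2 * Su)))
         + dp + h * (2 * dp) + M2p * Sb)) ->
  CM * P4 * g * P2 * ep <= 1 / 2 -> 0 <= dp -> 0 <= Y ->
  Y <= 2 * (1 + 2 * (CM * P4 * g * P2) * CBp * C1 * MDp + CM * P4 * (1 + 2 * h)) * dp
       + (2 * (CM * P4 * g * P2 * CBp * C2) * Su + 2 * (CM * P4 * M2p) * Sb).
Proof.
move=> hY hq d0 Y0; set q := CM * P4 * g * P2 * ep in hq.
have h1 : q * (2 * dp + Y) <= 1 / 2 * (2 * dp + Y).
  by apply: ler_wpM2r => //; rewrite addr_ge0 // mulr_ge0.
have : Y <= q * (2 * dp + Y) + (2 * (CM * P4 * g * P2) * CBp * C1 * MDp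
     + CM * P4 * (1 + 2 * h)) * dp + (CM * P4 * g * P2 * CBp * C2) * Su + (CM * P4 * M2p) * Sb.
  by apply: (le_trans hY); rewrite /q le_eqVlt; apply/orP; left; apply/eqP; ring.
lra.
Qed.

Lemma rpow_inv_le (p a w de : R) : 0 < p -> 0 <= a -> 0 <= w -> 0 <= de ->
  w `^ p <= a * de `^ p -> w <= a `^ p^-1 * de.
Proof.
move=> p0 a0 w0 d0 h; apply: (le_powRV p0 w0); first by rewrite mulr_ge0 ?powR_ge0.
by rewrite powRM ?powR_ge0 // -powRrM mulVf ?gt_eqF // powRr1.
Qed.

Lemma dLoo_le (Y : normedModType R[i]) (a b : nat) (v : nat -> Y) (c : R) : 0 <= c ->
  (forall n, (a <= n <= b)%N -> rnorm (v n) <= c) -> dLoo a b v <= c.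
Proof.
move=> c0 h; rewrite /dLoo big_nat_cond; elim/big_ind : _ => //.
  by move=> x y hx hy; rewrite ge_max hx.
by move=> i hi; apply: h; clear -hi; lia.
Qed.

Lemma dLp_scaled_powE (Y : normedModType R[i]) (p tau : R) a b (v : nat -> Y) :
  0 < p -> 0 < tau ->
  (tau^-1 * dLp p tau a b v) `^ p
  = tau * \sum_(a <= n < b.+1) (tau^-1 * rnorm (v n)) `^ p.
Proof.
move=> p0 t0; have ti0 : 0 <= tau^-1 by rewrite invr_ge0 ltW.
rewrite (powRM _ ti0 (dLp_ge0 _ _ _ _ _)) (dLp_powE _ _ _ p0 (ltW t0)) mulrCA mulr_sumr.
by congr (_ * _); apply: eq_bigr => n _; rewrite powRM // rnorm_ge0.
Qed.

Context {V H V' D W X : completeNormedModType R[i]}.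
Variable S : spaces V H V' D W X.

(** Differences of [e] and of [z] disagree only at [n = k], where the last starting error enters. *)
Lemma difference_power_sum (p tau dp : R) (k N : nat) (e : nat -> D) :
  let z := fun n => if (n < k)%N then 0 else e n in
  0 < p -> 0 < tau -> (0 < k <= N)%N ->
  tau * \sum_(0 <= j < k) (tau^-1 * rnorm (DtoX S (e j))) `^ p <= dp ->
  tau * \sum_(k <= n < N.+1) (tau^-1 * rnorm (DtoX S (e n - e n.-1))) `^ p
  <= 2 `^ p * (energy S p tau z k N + dp).
Proof.
move=> z p0 t0 kN hst.
have tge := ltW t0; have ti0 : 0 <= tau^-1 by rewrite invr_ge0.
pose s n := if (n < k)%N then e n else 0.
apply: (@le_trans _ _ (tau * \sum_(k <= n < N.+1)
   2 `^ p * ((tau^-1 * rnorm (DtoX S (z n - z n.-1))) `^ p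
             + (tau^-1 * rnorm (DtoX S (s n.-1))) `^ p))).
  apply: ler_wpM2l => //; apply: ler_sum_nat => n /andP[kn _].
  have -> : e n - e n.-1 = (z n - z n.-1) - s n.-1.
    rewrite /z /s ltnNge kn /=; case: ifP => _; last by rewrite subr0.
    by rewrite subr0.
  have h1 : 0 <= tau^-1 * rnorm (DtoX S (z n - z n.-1)) by rewrite mulr_ge0 ?rnorm_ge0.
  have h2 : 0 <= tau^-1 * rnorm (DtoX S (s n.-1)) by rewrite mulr_ge0 ?rnorm_ge0.
  apply: le_trans (powR_addle p0 h1 h2); apply: le_powR; [exact: ltW|by rewrite mulr_ge0 ?rnorm_ge0|].
  by rewrite -mulrDr ler_wpM2l // linearB rnormB.
rewrite -mulr_sumr mulrCA; apply: ler_wpM2l; first exact: powR_ge0.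
rewrite big_split mulrDr; apply: lerD.
  by apply: ler_wpM2l => //; apply: ler_sum => n _; rewrite lerDl powR_ge0.
apply: le_trans hst; apply: ler_wpM2l => //.
rewrite big_ltn; last by clear -kN; lia.
rewrite [X in _ + X <= _]big_nat_cond [X in _ + X <= _]big1; last first.
  move=> n /andP[/andP[kn _] _]; rewrite /s ifF ?linear0 ?rnorm0 ?mulr0 ?powR0 ?gt_eqF //.
  by clear -kn; lia.
rewrite (@big_cat_nat _ _ _ k.-1) //=; last by rewrite leq_pred.
have hk : (k.-1 < k)%N by clear -kN; lia.
rewrite /s hk addr0 [X in _ <= _ + X]big_ltn // addrCA lerDl addr_ge0 //.
  by rewrite sumr_ge0 // => i _; exact: powR_ge0.
by rewrite sumr_ge0 // => i _; exact: powR_ge0.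
Qed.

Theorem discrete_stability (k : nat) (T p lambda : R) (A : linear_family S T) :
  (0 < k)%N -> 0 < T -> 1 < p -> discrete_maximal_regularity k p A ->
  pi / 2 - alpha k < inf_angle S T (opA A) ->
  stability_assumption lambda A -> embedding_assumption S T p ->
  exists2 ltilde0 : R, 0 < ltilde0 &
  forall r0 ltilde CB MW MD : R,
  0 < r0 -> 0 <= ltilde -> 0 <= CB -> ltilde <= ltilde0 ->
  exists delta0 C : R, 0 < delta0 /\ 0 < C /\
  forall (B : nonlinear_family S T) (u0 : D) (u : R -> D),
  solves_ivp A B u0 u -> local_lipschitz_assumption r0 ltilde CB u B ->
  forall (N : nat), (k <= N)%N ->
  let tau := T / N%:R in
  let ustar := fun n : nat => u (n%:R * tau) in
  dLoo 0 N (fun n => DtoW S (ustar n)) <= MW -> dLp p tau 0 N ustar <= MD ->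
  forall (d : nat -> X) (v : nat -> D) (delta : R),
  (forall n, (k <= n <= N)%N ->
     bdf_diff k tau (fun m => DtoX S (ustar m)) n
       + opAX A (n%:R * tau) (ustar n)
     = bdf_rhs k tau B ustar n + d n) ->
  (forall n, (k <= n <= N)%N ->
     bdf_diff k tau (fun m => DtoX S (v m)) n + opAX A (n%:R * tau) (v n)
     = bdf_rhs k tau B v n) ->
  let e := fun n => v n - ustar n in
  dLp p tau k N d <= delta ->
  tau^-1 * dLp p tau 0 k.-1 (fun i => DtoX S (e i)) + dLp p tau 0 k.-1 e
    <= delta ->
  delta <= delta0 ->
  tau^-1 * dLp p tau k N (fun n => DtoX S (e n - e n.-1)) + dLp p tau k N e
    <= C * delta /\
  dLoo k N (fun n => DtoW S (e n)) <= C * delta.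
Proof.
move=> k0 T0 p1 mr hth st emb; have p0 : 0 < p by apply: lt_trans p1.
have [CM CM0 hMR] := maximal_regularity_horizon k0 T0 p1 mr hth.
have [M2 M20 hBV] := variation_sum_le T0 p1 st.
have [C2 C20 hE] := horizon_embedding T0 p1 emb.
have [C1 C10 hS] := single_embedding T0 p1 emb.
clear mr hth st emb.
pose g : R := gamma_mass k `^ p * (k%:R `^ p * k%:R).
pose h : R := bdf_mass k `^ p * (k.+1%:R `^ p * k.+1%:R).
pose K1 := CM * 4 `^ p * g * 2 `^ p.
have g0 : 0 <= g by rewrite !mulr_ge0 ?powR_ge0.
have h0 : 0 <= h by rewrite !mulr_ge0 ?powR_ge0.
have CMge := ltW CM0; have C1ge := ltW C10; have C2ge := ltW C20; have M2ge := ltW M20.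
have K10 : 0 <= K1 by rewrite !mulr_ge0 ?powR_ge0.
have K11 : 0 < 2 * (K1 + 1) by rewrite mulr_gt0 // ltr_wpDl.
(* Makes [K1 * (2 * lt0)^p] equal to [K1 / (2 * (K1 + 1))], below 1/2; [K1] collects the factors of
   the Lipschitz coefficient in the recursion. *)
pose lt0 := ((2 * (K1 + 1))^-1) `^ p^-1 / 2.
have lt00 : 0 < lt0 by rewrite divr_gt0 // powR_gt0 // invr_gt0.
exists lt0 => // r0 ltilde CB MW MD r00 ltge CB0 ltle.
(* Inside the smaller tube [CB * rho] is at most [lt0], so [ltilde + CB * rho] is at most
   [2 * lt0]. *)
pose rho := Num.min r0 (lt0 / (CB + 1)).
have CB1 : 0 < CB + 1 by rewrite ltr_wpDl.
have rho0 : 0 < rho by rewrite lt_min r00 divr_gt0.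
have rr : rho <= r0 by rewrite ge_min lexx.
have heps : ltilde + CB * rho <= 2 * lt0.
  rewrite mulr_natl mulr2n lerD //.
  apply: (@le_trans _ _ ((CB + 1) * (lt0 / (CB + 1)))); last by rewrite mulrC divfK ?gt_eqF.
  apply: ler_pM => //; [exact: ltW|by rewrite lerDl|by rewrite ge_min lexx orbT].
have eps0 : 0 <= ltilde + CB * rho by rewrite addr_ge0 // mulr_ge0 // ltW.
have hq : CM * 4 `^ p * g * 2 `^ p * (ltilde + CB * rho) `^ p <= 1 / 2.
  have : (ltilde + CB * rho) `^ p <= (2 * (K1 + 1))^-1.
    apply: (le_trans (le_powR (ltW p0) eps0 heps)).
    rewrite /lt0 mulrC divfK ?pnatr_eq0 // -powRrM mulVf ?gt_eqF // powRr1 //.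
    by rewrite invr_ge0 ltW.
  move=> /(ler_wpM2l K10) hh; apply: (le_trans hh).
  by rewrite ler_pdivrMr //; lra.
pose CBp := (2 * CB) `^ p; pose MDp := MD `^ p.
have CBp0 : 0 <= CBp by exact: powR_ge0.
have MDp0 : 0 <= MDp by exact: powR_ge0.
pose a0 := 2 * (1 + 2 * K1 * CBp * C1 * MDp + CM * 4 `^ p * (1 + 2 * h)).
have a00 : 0 < a0.
  have x1 : 0 <= 2 * K1 * CBp * C1 * MDp by rewrite !mulr_ge0 ?powR_ge0.
  have x2 : 0 <= CM * 4 `^ p * (1 + 2 * h).
    by apply: mulr_ge0; [rewrite mulr_ge0 ?powR_ge0|rewrite addr_ge0 // mulr_ge0].
  by rewrite /a0; lra.
pose cU := 2 * (K1 * CBp * C2); pose cb := 2 * (CM * 4 `^ p * M2 `^ (p - 1)).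
have cU0 : 0 <= cU by rewrite !mulr_ge0 ?powR_ge0.
have cb0 : 0 <= cb by rewrite !mulr_ge0 ?powR_ge0.
(* Bounds the total Gronwall weight: the terms [tau * rnorm (us j)^p] sum to at most [MDp], the
   increments of [A] to at most [M2]. *)
pose L := cU * MDp + cb * M2.
pose K2 := a0 * expR L.
have K20 : 0 < K2 by rewrite mulr_gt0 // expR_gt0.
pose cW := (C2 * K2) `^ p^-1; pose cS := (C1 * 2) `^ p^-1.
have cW0 : 0 <= cW by exact: powR_ge0.
have cS0 : 0 <= cS by exact: powR_ge0.
have den : 0 < cW + cS + 1 by rewrite ltr_wpDl // addr_ge0.
(* One summand each for the difference quotients, the norm in [L^p(D)] and the maximum in [W]. The
   first has [K2 + 2] because a starting error enters the difference at [n = k]. *)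
pose C := 2 * (K2 + 2) `^ p^-1 + K2 `^ p^-1 + cW.
(* For such [delta] both [cS * delta] (starting errors) and [cW * delta] (later errors) are at most
   [rho]. *)
exists (rho / (cW + cS + 1)), C; split; first by rewrite divr_gt0.
have C0 : 0 < C.
  have : 0 < (K2 + 2) `^ p^-1 by rewrite powR_gt0 // addr_gt0.
  by have := powR_ge0 K2 p^-1; rewrite /C; lra.
split=> // B u0 u _ lip N kN tau us _ hMD d v de hu hv e hd hst hde.
have N0 : (0 < N)%N by apply: leq_trans kN.
have t0 : 0 < tau by rewrite divr_gt0 // ltr0n.
have tge := ltW t0.
have TN : N%:R * tau = T by rewrite mulrC divfK // pnatr_eq0 -lt0n.
have tn n : (n <= N)%N -> 0 <= n%:R * tau <= T.
  by move=> nN; rewrite mulr_ge0 //= -TN ler_wpM2r // ler_nat.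
have de0 : 0 <= de by apply: le_trans hd; exact: dLp_ge0.
pose dp := de `^ p; have dp0 : 0 <= dp by exact: powR_ge0.
pose z n := if (n < k)%N then 0 else e n.
pose Y := energy S p tau z k.
have Y0 m : 0 <= Y m by exact: energy_ge0.
have hst' : tau * \sum_(0 <= j < k) ((tau^-1 * rnorm (DtoX S (e j))) `^ p + rnorm (e j) `^ p)
    <= 2 * dp.
  have := @dLp_split _ _ _ p tau 1 de 0 k.-1 (fun i => DtoX S (e i)) e p0 t0 ler01 de0.
  by rewrite mul1r powR1 mulr1 prednK //; apply.
clear hst.
have hd' : tau * \sum_(k <= n < N.+1) rnorm (d n) `^ p <= dp.
  by rewrite -(dLp_powE _ _ _ p0 tge); apply: le_powR; [exact: ltW|exact: dLp_ge0|].
have hU : tau * \sum_(0 <= j < N.+1) rnorm (us j) `^ p <= MDp.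
  by rewrite -(dLp_powE _ _ _ p0 tge); apply: le_powR; [exact: ltW|exact: dLp_ge0|].
clear hd hMD.
have small c : 0 <= c -> c <= cW + cS + 1 -> c * de <= rho.
  move=> c0 hc; apply: (@le_trans _ _ ((cW + cS + 1) * (rho / (cW + cS + 1)))).
    exact: ler_pM.
  by rewrite mulrC divfK // gt_eqF.
have wS j : (j < k)%N -> rnorm (DtoW S (e j)) `^ p <= C1 * (2 * dp).
  move=> jk; apply: (le_trans (hS N (e j) N0)); apply: ler_wpM2l => //.
  apply: le_trans hst'; apply: ler_wpM2l => //.
  rewrite big_mkord (bigD1 (Ordinal jk)) //= lerDl sumr_ge0 // => i _.
  by apply: addr_ge0; exact: powR_ge0.
have wE m : (k <= m <= N)%N -> rnorm (DtoW S (e m)) `^ p <= C2 * Y m.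
  move=> hm; have z0 n : (n < k)%N -> z n = 0 by move=> nk; rewrite /z nk.
  have -> : e m = z m by rewrite /z ltnNge; case/andP: hm => -> _.
  exact: hE.
have [beta [b0 bs hB]] := hBV N N0; rewrite -/tau in hB.
clear hBV hE hS.
pose c j := cU * (tau * rnorm (us j) `^ p) + cb * beta j.
have c0 j : 0 <= c j.
  by rewrite addr_ge0 // mulr_ge0 // mulr_ge0 // powR_ge0.
have rec m : (k <= m <= N)%N -> (forall j, (j < m)%N -> rnorm (DtoW S (e j)) <= rho) ->
    Y m <= a0 * dp + \sum_(k <= j < m) c j * Y j.
  move=> hm hw.
  have mN : (m <= N)%N by case/andP: hm.
  have hMRm (f : nat -> X) : (forall n, (k <= n <= m)%N ->
       bdf_diff k tau (fun j => DtoX S (z j)) n + opAX A (m%:R * tau) (z n) = f n) ->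
      Y m <= CM * (tau * \sum_(k <= n < m.+1) rnorm (f n) `^ p).
    by apply: (hMR _ N m f z (tn m mN) hm) => n nk; rewrite /z nk.
  have wEm j : (k <= j < m)%N -> rnorm (DtoW S (e j)) `^ p <= C2 * Y j.
    by move=> hj; apply: wE; clear -hj mN; lia.
  have := energy_recursion k0 hm T0 p1 CMge C1ge C2ge ltge CB0 (ltW rho0) rr hMRm b0
    (hB k m z mN) wEm wS lip hU hu hv hd' hst' hw.
  move=> /absorb_recursion /(_ hq dp0 (Y0 m)) hY; apply: (le_trans hY).
  rewrite lerD2l le_eqVlt; apply/orP; left; apply/eqP.
  rewrite !mulr_sumr -big_split /=; apply: eq_bigr => j _.
  change (cU * ((tau * rnorm (us j) `^ p) * Y j) + cb * (beta j * Y j) = c j * Y j).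
  by rewrite /c mulrDl !mulrA.
clear hMR hB hu hv lip hd'.
have cs m : (m <= N)%N -> \sum_(k <= j < m) c j <= L.
  move=> mN; apply: (@le_trans _ _ (\sum_(0 <= j < N) c j)); first exact: sum_nat_sub_ge.
  rewrite big_split /= -!mulr_sumr; apply: lerD; apply: ler_wpM2l => //.
  apply: le_trans hU; apply: ler_wpM2l => //.
  by apply: sum_nat_sub_ge => // j; exact: powR_ge0.
have main m : (k <= m <= N)%N -> (forall j, (j < m)%N -> rnorm (DtoW S (e j)) <= rho) ->
    Y m <= K2 * dp.
  move=> hm hw; have mN : (m <= N)%N by case/andP: hm.
  have km : (k <= m)%N by case/andP: hm.
  have A0 : 0 <= a0 * dp by rewrite mulr_ge0 // ltW.
  have hrec n : (k <= n <= m)%N -> Y n <= a0 * dp + \sum_(k <= j < n) c j * Y j.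
    move=> hn; apply: rec => [|j jn]; first by clear -hn mN; lia.
    by apply: hw; clear -hn jn; lia.
  have hg := discrete_gronwall A0 c0 hrec.
  have mm : (k <= m <= m)%N by rewrite km leqnn.
  apply: (le_trans (hg m mm)); rewrite /K2 [leRHS]mulrAC.
  by apply: ler_wpM2l => //; rewrite ler_expR cs.
have wK m : (k <= m <= N)%N -> Y m <= K2 * dp -> rnorm (DtoW S (e m)) <= cW * de.
  move=> hm hY; apply: (rpow_inv_le p0 _ (rnorm_ge0 _) de0); first by rewrite mulr_ge0 // ltW.
  by apply: (le_trans (wE m hm)); rewrite -mulrA; apply: ler_wpM2l.
(* The starting errors are small by hypothesis. For [m >= k] the energy bound at [m] needs the tube
   condition at earlier nodes only, and gives it at [m]. *)
have wrho m : (m <= N)%N -> rnorm (DtoW S (e m)) <= rho.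
  elim/ltn_ind: m => m IH mN; have [mk|km] := ltnP m k.
    apply: le_trans (small cS cS0 _); last by rewrite -addrA addrCA lerDl addr_ge0.
    apply: (rpow_inv_le p0 _ (rnorm_ge0 _) de0); first by rewrite mulr_ge0.
    by apply: (le_trans (wS m mk)); rewrite mulrA.
  have hm : (k <= m <= N)%N by rewrite km.
  apply: le_trans (small cW cW0 _); last by rewrite -addrA lerDl addr_ge0.
  apply: wK => //; apply: main => // j jm; apply: IH => //.
  exact: leq_trans (ltnW jm) mN.
have YK m : (k <= m <= N)%N -> Y m <= K2 * dp.
  move=> hm; apply: main => // j jm; apply: wrho; clear -hm jm; lia.
have NN : (k <= N <= N)%N by rewrite kN leqnn.
have K2ge := ltW K20.
have r2 : 0 <= (K2 + 2) `^ p^-1 by exact: powR_ge0.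
have r1 : 0 <= K2 `^ p^-1 by exact: powR_ge0.
split; last first.
  apply: dLoo_le => [|n hn]; first by rewrite mulr_ge0 // ltW.
  apply: (le_trans (wK n hn (YK n hn))); apply: ler_wpM2r => //.
  by rewrite /C lerDr addr_ge0 // mulr_ge0.
have hb : dLp p tau k N e <= K2 `^ p^-1 * de.
  apply: (rpow_inv_le p0 K2ge (dLp_ge0 _ _ _ _ _) de0).
  apply: le_trans (YK N NN); rewrite (dLp_powE _ _ _ p0 tge).
  rewrite (eq_big_nat _ _ (F2 := fun n => rnorm (z n) `^ p)); last first.
    by move=> n /andP[kn _]; rewrite /z ltnNge kn.
  exact: energy_D_le.
have ha : tau^-1 * dLp p tau k N (fun n => DtoX S (e n - e n.-1))
    <= 2 * (K2 + 2) `^ p^-1 * de.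
  have ge0 : 0 <= tau^-1 * dLp p tau k N (fun n => DtoX S (e n - e n.-1)).
    by rewrite mulr_ge0 ?dLp_ge0 // invr_ge0.
  have K22 : 0 <= K2 + 2 by rewrite addr_ge0.
  apply: (le_powRV p0 ge0); first by rewrite !mulr_ge0.
  rewrite (dLp_scaled_powE _ _ _ p0 t0).
  have hs : tau * \sum_(0 <= j < k) (tau^-1 * rnorm (DtoX S (e j))) `^ p <= 2 * dp.
    apply: le_trans hst'; apply: ler_wpM2l => //.
    by apply: ler_sum => j _; rewrite lerDl powR_ge0.
  have kN' : (0 < k <= N)%N by rewrite k0.
  apply: (le_trans (difference_power_sum p0 t0 kN' hs)).
  rewrite -mulrA (powRM _ (ler0n R 2) (mulr_ge0 r2 de0)) (powRM _ r2 de0).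
  apply: ler_wpM2l; first exact: powR_ge0.
  rewrite -powRrM mulVf ?gt_eqF // powRr1 // [leRHS]mulrDl lerD2r.
  exact: YK.
apply: (le_trans (lerD ha hb)); rewrite -mulrDl; apply: ler_wpM2r => //.
by rewrite /C lerDl.
Qed.

End Stability.

(** * Semigroups analytic in a cone *)

Section RealCriteria.
Context {R : realType}.

Lemma is_derive_eps (phi : R -> R) (s l : R) :
  (forall e : R, 0 < e -> exists2 dl : R, 0 < dl & forall h, `|h| < dl ->
     `|phi (s + h) - phi s - h * l| <= e * `|h|) ->
  is_derive s 1 phi l.
Proof.
move=> H.
have cv : h^-1 *: (phi (h *: 1 + s) - phi s) @[h --> 0^'] --> l.
  apply/cvgrPdist_le => e e0; have [dl dl0 hd] := H e e0.
  near=> h; have h0 : h != 0 by near: h; exact: nbhs_dnbhs_neq.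
  have hh : `|h| < dl.
    by near: h; apply: dnbhs0_lt.
  have -> : l - h^-1 *: (phi (h *: 1 + s) - phi s) = - (h^-1 * (phi (s + h) - phi s - h * l)).
    by rewrite /GRing.scale /= mulr1 [h + s]addrC; field.
  by rewrite normrN normrM normfV mulrC ler_pdivrMr ?normr_gt0 // hd.
split; first by apply/cvg_ex; exists l.
by apply: cvg_lim.
Unshelve. all: end_near. Qed.

End RealCriteria.

Section Deriv.
Context {R : realType}.

(** Remainder form with real [e]: nothing is divided by [h], so bounded linear maps, restriction to
    lines and inner products pass through by direct estimates. *)
Definition rderiv (Y : normedModType R[i]) (f : R -> Y) (s : R) (d : Y) : Prop :=
  forall e : R, 0 < e -> exists2 dl : R, 0 < dl & forall h : R, `|h| < dl ->
    rnorm (f (s + h) - f s - h%:C *: d) <= e * `|h|.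

Definition cderiv (Y : normedModType R[i]) (f : R[i] -> Y) (z : R[i]) (d : Y) : Prop :=
  forall e : R, 0 < e -> exists2 dl : R, 0 < dl & forall h : R[i], cabs h < dl ->
    rnorm (f (z + h) - f z - h *: d) <= e * cabs h.

Context {Y : normedModType R[i]}.
Implicit Types (f g : R[i] -> Y) (z u : R[i]) (d : Y).

Lemma dnbhs0_cabsP (P : set R[i]) :
  nbhs (0 : R[i]^o)^' P <->
  exists2 dl : R, 0 < dl & forall h, h != 0 -> cabs h < dl -> P h.
Proof.
split=> [|[dl dl0 hd]].
  rewrite /dnbhs /within => /nbhs_rnormP[dl dl0 hd]; exists dl => // h h0 hh.
  by apply: (hd h) => //; rewrite subr0.
rewrite /dnbhs /within; apply/nbhs_rnormP; exists dl => // h hh h0.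
by apply: hd => //; move: hh; rewrite subr0.
Qed.

Lemma cderiv_cvg f z d :
  h^-1 *: (f (h *: (1 : R[i]^o) + z) - f z) @[h --> (0 : R[i]^o)^'] --> d <-> cderiv f z d.
Proof.
rewrite cvg_rnormP; split=> H e e0.
  have /dnbhs0_cabsP[dl dl0 hd] := H e e0; exists dl => // h hh.
  have [->|h0] := eqVneq h 0.
    by rewrite addr0 subrr scale0r subr0 rnorm0 cabs0 mulr0.
  have /ltW := hd h h0 hh.
  have -> : h^-1 *: (f (h *: (1 : R[i]^o) + z) - f z) - d = h^-1 *: (f (z + h) - f z - h *: d).
    by rewrite [RHS]scalerBr scalerA mulVf // scale1r [z + h]addrC /GRing.scale /= mulr1.
  by rewrite rnormZ cabsV mulrC ler_pdivrMr // cabs_gt0.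
have [dl dl0 hd] := H (e / 2) (divr_gt0 e0 (ltr0Sn R 1)).
apply/dnbhs0_cabsP; exists dl => // h h0 hh.
have -> : h^-1 *: (f (h *: (1 : R[i]^o) + z) - f z) - d = h^-1 *: (f (z + h) - f z - h *: d).
  by rewrite [RHS]scalerBr scalerA mulVf // scale1r [z + h]addrC /GRing.scale /= mulr1.
rewrite rnormZ cabsV mulrC ltr_pdivrMr ?cabs_gt0 //.
by apply: (le_lt_trans (hd h hh)); rewrite ltr_pM2r ?cabs_gt0 //; lra.
Qed.

Lemma derivable_cderiv f z : derivable (f : R[i]^o -> Y) z 1 -> exists d, cderiv f z d.
Proof. by move=> /cvg_ex[d hd]; exists d; apply/cderiv_cvg. Qed.

Lemma cderiv_derivable f z d : cderiv f z d -> derivable (f : R[i]^o -> Y) z 1.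
Proof. by move=> /cderiv_cvg hd; apply/cvg_ex; exists d. Qed.

Lemma cderiv_near f g z d (dl : R) : 0 < dl ->
  (forall h, cabs h < dl -> f (z + h) = g (z + h)) -> cderiv f z d -> cderiv g z d.
Proof.
move=> dl0 fg H e e0; have [dl' dl'0 hd] := H e e0.
exists (Num.min dl dl') => [|h]; first by rewrite lt_min dl0.
rewrite lt_min => /andP[h1 h2]; rewrite -fg // -[z]addr0 -fg ?cabs0 // addr0.
exact: hd.
Qed.

Lemma cderiv_linear (Z : normedModType R[i]) (L : Y -> Z) (M : R) f z d :
  (forall x y, L (x - y) = L x - L y) -> (forall a x, L (a *: x) = a *: L x) ->
  (forall x, rnorm (L x) <= M * rnorm x) ->
  cderiv f z d -> cderiv (fun w => L (f w)) z (L d).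
Proof.
move=> LB LZ hM H e e0.
have M0 : 0 < `|M| + 1 by rewrite ltr_wpDl.
have [dl dl0 hd] := H (e / (`|M| + 1)) (divr_gt0 e0 M0); exists dl => // h hh.
rewrite -!LB -LZ -LB; apply: (le_trans (hM _)).
have hM1 : M <= `|M| + 1 by have := ler_norm M; lra.
apply: (le_trans (ler_wpM2r (rnorm_ge0 _) hM1)).
apply: (le_trans (ler_wpM2l (ltW M0) (hd h hh))).
rewrite le_eqVlt; apply/orP; left; apply/eqP; field; exact: lt0r_neq0.
Qed.

Lemma cderiv_line f z u s d : cderiv f (z + s%:C * u) d ->
  rderiv (fun s => f (z + s%:C * u)) s (u *: d).
Proof.
move=> H e e0.
have u1 : 0 < cabs u + 1 by rewrite ltr_wpDl ?cabs_ge0.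
have [dl dl0 hd] := H (e / (cabs u + 1)) (divr_gt0 e0 u1).
exists (dl / (cabs u + 1)) => [|h hh]; first by rewrite divr_gt0.
have hu : cabs (h%:C * u) <= `|h| * (cabs u + 1).
  by rewrite cabsM cabsC ler_wpM2l // lerDl.
have := hd (h%:C * u); rewrite rmorphD mulrDl addrA scalerA => /(_ _) h1.
apply: (le_trans (h1 _)).
  by apply: (le_lt_trans hu); rewrite -ltr_pdivlMr.
apply: (le_trans (ler_wpM2l _ hu)); first by rewrite divr_ge0 ?ltW.
by rewrite mulrA mulrAC divfK ?gt_eqF // mulrC.
Qed.

Lemma cderiv_unique f z d d' : cderiv f z d -> cderiv f z d' -> d = d'.
Proof.
move=> /cderiv_cvg h1 /cderiv_cvg h2; apply: (cvg_unique _ h1 h2) => //.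
Qed.

Lemma cderiv_cont f z d : cderiv f z d -> forall e : R, 0 < e ->
  exists2 dl : R, 0 < dl & forall h, cabs h < dl -> rnorm (f (z + h) - f z) < e.
Proof.
move=> H e e0; have [dl dl0 hd] := H 1 ltr01.
have M0 : 0 < 1 + rnorm d by rewrite ltr_wpDr ?rnorm_ge0.
exists (Num.min dl (e / (1 + rnorm d))) => [|h]; first by rewrite lt_min dl0 divr_gt0.
rewrite lt_min => /andP[h1 h2].
rewrite -[X in rnorm X](subrK (h *: d)); apply: (le_lt_trans (rnormD _ _)).
apply: (@le_lt_trans _ _ (cabs h * (1 + rnorm d))); last by rewrite -ltr_pdivlMr.
by rewrite mulrDr mulr1 rnormZ lerD2r -[leRHS]mul1r hd.
Qed.

End Deriv.

Section Inner.
Context {R : realType} {V H V' D W X : completeNormedModType R[i]}.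
Variable S : spaces V H V' D W X.

Lemma conjC_Re (z : R[i]) : complex.Re (conjC z) = complex.Re z.
Proof. by case: z. Qed.

Definition rip (x y : H) : R := complex.Re (ipH S x y).

Lemma ripDl x y z : rip (x + y) z = rip x z + rip y z.
Proof. by rewrite /rip linearDl raddfD. Qed.

Lemma ripNl x z : rip (- x) z = - rip x z.
Proof. by rewrite /rip linearNl raddfN. Qed.

Lemma ripBl x y z : rip (x - y) z = rip x z - rip y z.
Proof. by rewrite ripDl ripNl. Qed.

Lemma Re_realM (t : R) (z : R[i]) : complex.Re (t%:C * z) = t * complex.Re z.
Proof. by case: z => a b /=; rewrite mul0r subr0. Qed.

Lemma ripZl (t : R) x y : rip (t%:C *: x) y = t * rip x y.
Proof. by rewrite /rip linearZl_LR /= Re_realM. Qed.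

Lemma ripC x y : rip x y = rip y x.
Proof. by rewrite /rip hermC expr0 mul1r conjC_Re. Qed.

Lemma ripDr x y z : rip x (y + z) = rip x y + rip x z.
Proof. by rewrite ripC ripDl ripC [rip z x]ripC. Qed.

Lemma rip_sqr x : rip x x = rnorm x ^+ 2.
Proof. by rewrite /rip ipHE -rnormE -rmorphXn. Qed.

Lemma rnorm_sqrD x y : rnorm (x + y) ^+ 2 = rnorm x ^+ 2 + 2 * rip x y + rnorm y ^+ 2.
Proof. by rewrite -!rip_sqr ripDl !ripDr [rip y x]ripC; ring. Qed.

Lemma rip_le x y : `|rip x y| <= rnorm x * rnorm y.
Proof.
have [->|y0] := eqVneq y 0.
  by rewrite rnorm0 mulr0 ripC -(subrr x) ripBl subrr normr0.
have ny : 0 < rnorm y by rewrite lt_neqAle eq_sym rnorm_eq0 y0 rnorm_ge0.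
have nx := rnorm_ge0 x.
rewrite -(@ler_pXn2r _ 2) ?nnegrE ?mulr_ge0 ?(ltW ny) // -normrX ger0_norm ?sqr_ge0 //.
rewrite exprMn -ler_pdivrMr ?exprn_gt0 // -subr_ge0.
(* The coefficient of the real projection of [x] onto [y], which minimizes the distance tested
   below. *)
set t := rip x y / rnorm y ^+ 2.
have : 0 <= rnorm (x + (- t)%:C *: y) ^+ 2 by rewrite sqr_ge0.
rewrite rnorm_sqrD rnormZR exprMn real_normK ?num_real // [rip x _]ripC ripZl [rip y x]ripC.
suff -> : rnorm x ^+ 2 + 2 * (- t * rip x y) + (- t) ^+ 2 * rnorm y ^+ 2
    = rnorm x ^+ 2 - rip x y ^+ 2 / rnorm y ^+ 2 by [].
rewrite /t; field; exact: lt0r_neq0.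
Qed.

Lemma rderiv_rip (f : R -> H) s d g : rderiv f s d ->
  is_derive s 1 (fun s => rip (f s) g) (rip d g).
Proof.
move=> Hd; apply: is_derive_eps => e e0.
have g1 : 0 < rnorm g + 1 by rewrite ltr_wpDl ?rnorm_ge0.
have [dl dl0 hd] := Hd (e / (rnorm g + 1)) (divr_gt0 e0 g1); exists dl => // h hh.
rewrite -ripZl -!ripBl; apply: (le_trans (rip_le _ _)).
apply: (@le_trans _ _ (e / (rnorm g + 1) * `|h| * (rnorm g + 1))).
  by apply: ler_pM; rewrite ?rnorm_ge0 ?hd // lerDl.
by rewrite mulrAC divfK // gt_eqF.
Qed.

Lemma rderiv_sqr (f : R -> H) s d : rderiv f s d ->
  is_derive s 1 (fun s => rnorm (f s) ^+ 2) (2 * rip d (f s)).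
Proof.
move=> Hd; apply: is_derive_eps => e e0.
(* The first summand serves the remainder paired with [f s], the second the quadratic term, of size
   [|h|^2 (1 + |d|)^2]. *)
set M := 2 * rnorm (f s) + 2 * (1 + rnorm d) ^+ 2.
have M0 : 0 <= M by apply: addr_ge0; apply: mulr_ge0; rewrite ?rnorm_ge0 ?sqr_ge0.
have [dl dl0 hd] := Hd (e / (M + 1)) (divr_gt0 e0 (ltr_wpDl M0 ltr01)).
have [dl1 dl10 hd1] := Hd 1 ltr01.
have d0 := rnorm_ge0 d; have f0 := rnorm_ge0 (f s).
exists (Num.min (Num.min dl dl1) (e / (M + 1))) => [|h].
  by rewrite !lt_min dl0 dl10 divr_gt0 // ltr_wpDl.
rewrite !lt_min => /andP[/andP[h1 h2] h3].
set r := f (s + h) - f s - h%:C *: d.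
have e1 : f (s + h) = f s + (r + h%:C *: d) by rewrite /r subrK addrCA subrr addr0.
rewrite e1 rnorm_sqrD.
have e2 : rip (f s) (r + h%:C *: d) = rip r (f s) + h * rip d (f s).
  by rewrite ripC ripDl ripZl.
set q := r + h%:C *: d in e1 e2 *; rewrite e2.
have -> : rnorm (f s) ^+ 2 + 2 * (rip r (f s) + h * rip d (f s)) + rnorm q ^+ 2
   - rnorm (f s) ^+ 2 - h * (2 * rip d (f s)) = 2 * rip r (f s) + rnorm q ^+ 2 by ring.
have hr : rnorm r <= e / (M + 1) * `|h| by exact: hd.
have hq : rnorm q <= `|h| * (1 + rnorm d).
  apply: (le_trans (rnormD _ _)); rewrite rnormZR mulrDr mulr1 lerD2r -[leRHS]mul1r.
  exact: hd1.
have n0 := normr_ge0 h.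
apply: (le_trans (ler_normD _ _)); rewrite normrM [`|2|]ger0_norm //.
have hrip : `|rip r (f s)| <= e / (M + 1) * `|h| * rnorm (f s).
  by apply: (le_trans (rip_le _ _)); rewrite ler_wpM2r.
have hq2 : `|rnorm q ^+ 2| <= e / (M + 1) * `|h| * (1 + rnorm d) ^+ 2.
  rewrite ger0_norm ?sqr_ge0 //.
  apply: (@le_trans _ _ ((`|h| * (1 + rnorm d)) ^+ 2)).
    by rewrite ler_pXn2r ?nnegrE ?rnorm_ge0 // mulr_ge0 // addr_ge0.
  by rewrite exprMn ler_wpM2r ?sqr_ge0 // expr2 ler_wpM2r // ltW.
have e3 : e / (M + 1) * `|h| * M <= e * `|h|.
  rewrite mulrAC ler_wpM2r // mulrAC ler_pdivrMr ?ltr_wpDl //.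
  by rewrite ler_wpM2l ?lerDl // ltW.
apply: le_trans (e3); rewrite /M; move: hrip hq2.
set c := e / (M + 1) * `|h|; have c0 : 0 <= c.
  by rewrite mulr_ge0 // divr_ge0 ?(ltW e0) // addr_ge0.
have := sqr_ge0 (1 + rnorm d).
set q2 := `|rnorm q ^+ 2|; set rr := `|rip _ _|; set a := (1 + rnorm d) ^+ 2.
nra.
Qed.

End Inner.

Section Cone.
Context {R : realType}.
Implicit Types (q : R) (z w : R[i]).

(* For 0 <= q < 1, the open sector of angle acos q. *)
Definition cone q z : Prop := q * cabs z < complex.Re z.

Lemma ReD z w : complex.Re (z + w) = complex.Re z + complex.Re w.
Proof. exact: raddfD. Qed.

Lemma cone_neq0 q z : cone q z -> z != 0.
Proof. by apply: contraTneq => ->; rewrite /cone cabs0 mulr0 ltxx. Qed.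

Lemma coneD q z w : 0 <= q -> cone q z -> cone q w -> cone q (z + w).
Proof.
move=> q0 hz hw; rewrite /cone ReD; apply: le_lt_trans (ltrD hz hw).
by rewrite -mulrDr ler_wpM2l // cabsD.
Qed.

Lemma coneZ q (t : R) z : 0 < t -> cone q z -> cone q (t%:C * z).
Proof.
move=> t0; rewrite /cone cabsM cabsC gtr0_norm // Re_realM mulrCA.
by rewrite ltr_pM2l.
Qed.

Lemma cone_real q (t : R) : q < 1 -> 0 < t -> cone q t%:C.
Proof. by move=> q1 t0; rewrite /cone cabsC gtr0_norm //= -[ltRHS]mul1r ltr_pM2r. Qed.

Lemma cone_open q z : 0 <= q -> cone q z ->
  exists2 dl : R, 0 < dl & forall h, cabs h < dl -> cone q (z + h).
Proof.
move=> q0 hz; exists ((complex.Re z - q * cabs z) / (q + 1)) => [|h].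
  by rewrite divr_gt0 ?subr_gt0 // ltr_wpDl.
have q1 : 0 < q + 1 by rewrite ltr_wpDl.
rewrite ltr_pdivlMr // => hh; rewrite /cone ReD.
have h1 : q * cabs (z + h) <= q * (cabs z + cabs h) by rewrite ler_wpM2l // cabsD.
have h2 : - cabs h <= complex.Re h.
  by have := abs_Re_le h; rewrite ler_norml => /andP[].
lra.
Qed.

Lemma half_add z : (2^-1)%:C * z + (2^-1)%:C * z = z.
Proof. by rewrite -mulrDl -rmorphD -mulr2n -[_ *+ 2]mulr_natl divff ?pnatr_eq0 // mul1r. Qed.

Lemma cone_half q z : cone q z -> cone q ((2^-1)%:C * z).
Proof. by apply: coneZ; rewrite invr_gt0. Qed.

End Cone.

Lemma subr_exchange (Z : zmodType) (a b c d : Z) : a - b - (c - d) = a - c - (b - d).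
Proof. by rewrite !opprB addrACA [RHS]addrACA [- b - c]addrC. Qed.

Section Semigroup.
Context {R : realType} {H : completeNormedModType R[i]}.

(** Weaker than [bounded_analytic_semigroup]: boundedness for each [z] separately, and continuity at
    0 along positive reals only. The uniform versions are regained from the energy estimates and the
    continuation. *)
Record csg (q : R) (E : R[i] -> H -> H) : Prop := Csg {
  csg_q : 0 <= q < 1 ;
  csg_lin : forall z, cone q z -> linear (E z) ;
  csg_law : forall z w, cone q z -> cone q w -> forall h, E (z + w) h = E z (E w h) ;
  csg_deriv : forall h z, cone q z -> exists d, cderiv (E^~ h) z d ;
  csg_bdd : forall z, cone q z -> exists M : R, forall h, rnorm (E z h) <= M * rnorm h ;
  csg_cont0 : forall h (e : R), 0 < e -> exists2 dl : R, 0 < dl &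
    forall t : R, 0 < t < dl -> rnorm (E t%:C h - h) < e }.

Definition cderivative (f : R[i] -> H) (z : R[i]) : H := xget 0 [set d | cderiv f z d].

Lemma cderivativeE f z d : cderiv f z d -> cderivative f z = d.
Proof.
move=> hd; rewrite /cderivative; case: xgetP => [d' _ hd'|/(_ d)//].
exact: cderiv_unique hd' hd.
Qed.

Fixpoint Dn (E : R[i] -> H -> H) (n : nat) (h : H) : R[i] -> H :=
  if n is n'.+1 then cderivative (Dn E n' h) else E^~ h.

Lemma DnS E n h z : Dn E n.+1 h z = cderivative (Dn E n h) z.
Proof. by []. Qed.

Section Laws.
Variables (q : R) (E : R[i] -> H -> H).
Hypothesis sg : csg q E.
Local Notation C := (cone q).

Let q0 : 0 <= q. Proof. by case/andP: (csg_q sg). Qed.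
Let q1 : q < 1. Proof. by case/andP: (csg_q sg). Qed.

Lemma csgB z x y : C z -> E z (x - y) = E z x - E z y.
Proof.
move=> hz; have := csg_lin sg hz (-1) y x.
by rewrite !scaleN1r [x - y]addrC => ->; rewrite addrC.
Qed.

Lemma csg0 z : C z -> E z 0 = 0.
Proof. by move=> hz; have := csgB 0 0 hz; rewrite subr0 subrr. Qed.

Lemma csgZ z a x : C z -> E z (a *: x) = a *: E z x.
Proof. by move=> hz; rewrite -[a *: x]addr0 (csg_lin sg hz) csg0 // addr0. Qed.

Lemma csgD z x y : C z -> E z (x + y) = E z x + E z y.
Proof. by move=> hz; have := csg_lin sg hz 1 x y; rewrite !scale1r. Qed.

Lemma cderiv_E h z : C z -> cderiv (E^~ h) z (Dn E 1 h z).
Proof. by move=> hz; have [d hd] := csg_deriv sg h hz; rewrite /= (cderivativeE hd). Qed.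

Lemma E1_law g z w : C z -> C w -> Dn E 1 g (z + w) = E z (Dn E 1 g w).
Proof.
move=> hz hw; apply: cderivativeE.
have [M hM] := csg_bdd sg hz.
have hL := cderiv_linear (fun x y => csgB x y hz) (fun a x => csgZ a x hz) hM (cderiv_E g hw).
have [dl dl0 hd] := cone_open q0 hw.
move=> e e0; have [dl' dl'0 hd'] := hL e e0.
exists (Num.min dl dl') => [|h]; first by rewrite lt_min dl0.
rewrite lt_min => /andP[/hd h1 h2]; rewrite -[z + w + h]addrA (csg_law sg hz h1) (csg_law sg hz hw).
exact: hd'.
Qed.

(** Since [E^(n+1)(z + w) h = E'(z) E^(n)(w) h], derivatives already taken move into the initial
    value and one derivative at [z] suffices. The three claims feed one another; splitting [w] into
    halves, both in the cone, makes the law available at every point. *)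
Lemma Dn_laws n : forall h,
  [/\ forall w, C w -> cderiv (Dn E n h) w (Dn E n.+1 h w),
      forall z w, C z -> C w -> Dn E n h (z + w) = E z (Dn E n h w) &
      forall z w, C z -> C w -> Dn E n.+1 h (z + w) = Dn E 1 (Dn E n h w) z].
Proof.
elim: n => [|n IH] h; last first.
  have [ha hb hc] := IH h.
  have hb' z w : C z -> C w -> Dn E n.+1 h (z + w) = E z (Dn E n.+1 h w).
    move=> hz hw; have hw2 := cone_half hw.
    rewrite -{1}(half_add w) addrA hc //; last exact: coneD.
    by rewrite E1_law // -hc // half_add.
  have aux w a : C w -> C a -> cderiv (Dn E n.+1 h) (w + a) (Dn E 1 (Dn E n.+1 h a) w).
    move=> hw ha'; have [dl dl0 hd] := cone_open q0 hw.
    have hE := cderiv_E (Dn E n.+1 h a) hw.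
    move=> e e0; have [dl' dl'0 hd'] := hE e e0.
    exists (Num.min dl dl') => [|x]; first by rewrite lt_min dl0.
    rewrite lt_min => /andP[/hd h1 h2]; rewrite [w + a + x]addrAC (hb' _ _ h1 ha') (hb' _ _ hw ha').
    exact: hd'.
  have hc' z w : C z -> C w -> Dn E n.+2 h (z + w) = Dn E 1 (Dn E n.+1 h w) z.
    by move=> hz hw; apply: cderivativeE; exact: aux.
  split=> // w hw; have hw2 := cone_half hw.
  by have := aux _ _ hw2 hw2; rewrite -(hc' _ _ hw2 hw2) half_add.
have hc' z w : C z -> C w -> Dn E 1 h (z + w) = Dn E 1 (Dn E 0 h w) z.
  move=> hz hw; apply: cderivativeE.
  have [dl dl0 hd] := cone_open q0 hz.
  have hE := cderiv_E (E w h) hz.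
  move=> e e0; have [dl' dl'0 hd'] := hE e e0.
  exists (Num.min dl dl') => [|x]; first by rewrite lt_min dl0.
  rewrite lt_min => /andP[/hd h1 h2]; rewrite [z + w + x]addrAC /= (csg_law sg h1 hw) (csg_law sg hz hw).
  exact: hd'.
split=> //; first by move=> w; exact: cderiv_E.
by move=> z w hz hw; rewrite /= (csg_law sg hz hw).
Qed.

Lemma cderiv_Dn n h w : C w -> cderiv (Dn E n h) w (Dn E n.+1 h w).
Proof. by case: (Dn_laws n h) => + _ _; apply. Qed.

Lemma Dn_add n h z w : C z -> C w -> Dn E n h (z + w) = E z (Dn E n h w).
Proof. by case: (Dn_laws n h) => _ + _; apply. Qed.

Lemma DnS_add n h z w : C z -> C w -> Dn E n.+1 h (z + w) = Dn E 1 (Dn E n h w) z.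
Proof. by case: (Dn_laws n h) => _ _; apply. Qed.

Lemma Dn_E n h z w : C z -> C w -> Dn E n (E w h) z = Dn E n h (z + w).
Proof.
move=> + hw; elim: n z => [|n IH] z hz; first by rewrite /= (csg_law sg).
rewrite [LHS]DnS; apply: cderivativeE; have [dl dl0 hd] := cone_open q0 hz.
have hE := cderiv_Dn n h (coneD q0 hz hw).
move=> e e0; have [dl' dl'0 hd'] := hE e e0.
exists (Num.min dl dl') => [|x]; first by rewrite lt_min dl0.
rewrite lt_min => /andP[/hd h1 h2]; rewrite !IH //.
by rewrite [z + x + w]addrAC; exact: hd'.
Qed.

Lemma cderiv0 z : cderiv (fun=> 0 : H) z 0.
Proof.
by move=> e e0; exists 1 => // h _; rewrite scaler0 !subr0 rnorm0 mulr_ge0 ?cabs_ge0 ?ltW.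
Qed.

Lemma Dn0 n z : C z -> Dn E n 0 z = 0.
Proof.
elim: n z => [|n IH] z hz; first exact: csg0.
rewrite [LHS]DnS; apply: cderivativeE; have [dl dl0 hd] := cone_open q0 hz.
apply: (@cderiv_near _ _ (fun=> 0) _ _ _ dl) (cderiv0 z) => // h hh.
by rewrite IH //; exact: hd.
Qed.

Lemma DnB n x y z : C z -> Dn E n (x - y) z = Dn E n x z - Dn E n y z.
Proof.
elim: n z => [|n IH] z hz; first exact: csgB.
rewrite [LHS]DnS; apply: cderivativeE; have [dl dl0 hd] := cone_open q0 hz.
move=> e e0; have e2 : 0 < e / 2 by rewrite divr_gt0.
have [d1 d10 h1] := cderiv_Dn n x hz e2.
have [d2 d20 h2] := cderiv_Dn n y hz e2.
exists (Num.min dl (Num.min d1 d2)) => [|h]; first by rewrite !lt_min dl0 d10.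
rewrite !lt_min => /andP[/hd hh /andP[hh1 hh2]]; rewrite !IH //.
have -> : Dn E n x (z + h) - Dn E n y (z + h) - (Dn E n x z - Dn E n y z) -
   h *: (Dn E n.+1 x z - Dn E n.+1 y z) =
   (Dn E n x (z + h) - Dn E n x z - h *: Dn E n.+1 x z) -
   (Dn E n y (z + h) - Dn E n y z - h *: Dn E n.+1 y z).
  by rewrite scalerBr (subr_exchange (Dn E n x (z + h))) [LHS]subr_exchange.
apply: (le_trans (rnormB _ _)); have := h1 h hh1; have := h2 h hh2.
set a := rnorm _; set b := rnorm _; lra.
Qed.

End Laws.
End Semigroup.

(** * Analytic continuation to a wider cone *)

Section RealTaylor.
Context {R : realType}.

Lemma mvt_le (f df : R -> R) (a b C : R) : a <= b ->
  (forall x, a <= x <= b -> is_derive x 1 f (df x)) ->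
  (forall x, a <= x <= b -> df x <= C) -> f b - f a <= C * (b - a).
Proof.
move=> ab hd hC.
have [||c hc ->] := @MVT_segment R f df a b ab.
- by move=> x; rewrite in_itv /= => /andP[h1 h2]; apply: hd; rewrite !ltW.
- apply: derivable_within_continuous => x; rewrite in_itv /= => hx.
  by case: (hd x hx).
by rewrite ler_wpM2r ?subr_ge0 // hC //; move: hc; rewrite in_itv.
Qed.

Lemma mvt_abs_le (f df : R -> R) (a b C : R) : a <= b ->
  (forall x, a <= x <= b -> is_derive x 1 f (df x)) ->
  (forall x, a <= x <= b -> `|df x| <= C) -> `|f b - f a| <= C * (b - a).
Proof.
move=> ab hd hC; rewrite ler_norml; apply/andP; split.
  rewrite lerNl; have := @mvt_le (fun x => - f x) (fun x => - df x) a b C ab.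
  rewrite opprK addrC opprB; apply=> x hx.
    by have := hd x hx => h; exact: is_deriveN.
  by have := hC x hx; rewrite ler_norml lerNl => /andP[].
by apply: (mvt_le ab hd) => x hx; have := hC x hx; rewrite ler_norml => /andP[].
Qed.

(** Taylor weights for stepping back by [s]: an expansion centred at [y + s] is evaluated at [y]. *)
Definition tcoef (n : nat) (s : R) : R := (- s) ^+ n / n`!%:R.

Lemma is_derive_tcoef (n : nat) (s : R) : is_derive s 1 (tcoef n.+1) (- tcoef n s).
Proof.
rewrite /tcoef.
have h0 : is_derive s 1 ((-%R : R -> R) ^+ n.+1) ((n.+1%:R * (-%R : R -> R) s ^+ n) *: (-1)).
  exact: is_deriveX.
have h : is_derive s 1 (n.+1`!%:R^-1 *: ((-%R : R -> R) ^+ n.+1))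
   (n.+1`!%:R^-1 *: ((n.+1%:R * (- s) ^+ n) *: (- 1) : R)).
  exact: is_deriveZ.
have e : n.+1`!%:R^-1 *: ((-%R : R -> R) ^+ n.+1) = (fun s : R => (- s) ^+ n.+1 / n.+1`!%:R).
  by apply/funext => x; rewrite !fctE [RHS]mulrC.
rewrite e in h; apply: (is_derive_eq h).
rewrite /GRing.scale /= factS natrM; field.
by rewrite nat1r !pnatr_eq0 -lt0n fact_gt0.
Qed.

Lemma tcoef0 n : tcoef n 0 = (n == 0%N)%:R.
Proof. by rewrite /tcoef oppr0 expr0n; case: n => [|n] /=; rewrite ?mul0r // divr1. Qed.

(** Differentiation in the centre of expansion: consecutive terms cancel and only the last survives,
    as in the integral form of the remainder. *)
Lemma real_taylor (a : nat -> R -> R) (t : R) (N : nat) :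
  (forall n s, 0 <= s <= t -> is_derive s 1 (a n) (a n.+1 s)) ->
  forall s, 0 <= s <= t ->
  is_derive s 1 (fun s => \sum_(n < N.+1) tcoef n s * a n s) (tcoef N s * a N.+1 s).
Proof.
move=> ha s hs; elim: N => [|N IH].
  have -> : (fun s => \sum_(n < 1) tcoef n s * a n s) = a 0%N.
    by apply/funext => x; rewrite big_ord1 /tcoef expr0 invr1 !mul1r.
  by rewrite /tcoef expr0 invr1 !mul1r; exact: ha.
have -> : (fun s => \sum_(n < N.+2) tcoef n s * a n s)
    = (fun s => (\sum_(n < N.+1) tcoef n s * a n s)) \+ (tcoef N.+1 \* a N.+1).
  by apply/funext => x; rewrite big_ord_recr.
have h1 := is_derive_tcoef N s; have h2 := ha N.+1 s hs.
have h3 : is_derive s 1 (tcoef N.+1 \* a N.+1)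
   (tcoef N.+1 s *: a N.+2 s + a N.+1 s *: (- tcoef N s)) by exact: is_deriveM.
have h4 : is_derive s 1 ((fun s => (\sum_(n < N.+1) tcoef n s * a n s)) \+ (tcoef N.+1 \* a N.+1))
  (tcoef N s * a N.+1 s + (tcoef N.+1 s *: a N.+2 s + a N.+1 s *: (- tcoef N s))).
  exact: is_deriveD.
apply: (is_derive_eq h4); rewrite /GRing.scale /=; ring.
Qed.

(** The induction step is [((n + 2) / (n + 1))^(n + 1) <= e]. *)
Lemma expn_le_fact n : n.+1%:R ^+ n <= n`!%:R * expR 1 ^+ n :> R.
Proof.
elim: n => [|n IH]; first by rewrite !expr0 mulr1.
have h : n.+2%:R <= n.+1%:R * expR (n.+1%:R^-1) :> R.
  have h1 : 1 + n.+1%:R^-1 <= expR (n.+1%:R^-1) :> R by exact: expR_ge1Dx.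
  apply: le_trans (ler_wpM2l (ler0n _ _) h1).
  by rewrite mulrDr mulr1 divff ?pnatr_eq0 // natr1.
have h2 : n.+2%:R ^+ n.+1 <= (n.+1%:R * expR (n.+1%:R^-1)) ^+ n.+1 :> R.
  by rewrite ler_pXn2r ?nnegrE ?ler0n // mulr_ge0 ?ler0n ?expR_ge0.
have e : expR (n.+1%:R^-1) ^+ n.+1 = expR 1 :> R.
  by rewrite -expRM_natl divff ?pnatr_eq0.
apply: (le_trans h2); rewrite exprMn e.
rewrite exprS factS natrM [expR 1 ^+ n.+1]exprSr !mulrA ler_pM2r ?expR_gt0 //.
by rewrite -!mulrA ler_wpM2l ?ler0n.
Qed.

Lemma geometric_small (e : R) : 0 < e -> exists N0 : nat, forall N, (N0 <= N)%N ->
  N.+1%:R / 2 ^+ N.+1 < e.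
Proof.
move=> e0.
(* A quadratic bound leaves one spare factor [N.+1], which exceeds [4 / e] for large [N]. *)
have sq n : n%:R * n%:R <= 4 * 2 ^+ n :> R.
  rewrite -natrM -natrX -[4]/(4%:R) -natrM ler_nat.
  elim: n => // n IH; rewrite expnS; case: n IH => [|[|[|n]]] // IH; nia.
have [N0 hN0] : exists N0 : nat, 4 / e < N0%:R.
  by exists (truncn (4 / e)).+1; exact: truncnS_gt.
exists N0 => N hN; have N1 : (0 : R) < N.+1%:R by rewrite ltr0n.
have p2 : (0 : R) < 2 ^+ N.+1 by rewrite exprn_gt0.
rewrite ltr_pdivrMr //.
have h1 : 4 < e * N.+1%:R.
  rewrite mulrC -ltr_pdivrMr //; apply: (lt_le_trans hN0).
  by rewrite ler_nat ltnW.
have h2 := sq N.+1.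
have h3 : 4 * 2 ^+ N.+1 < e * N.+1%:R * 2 ^+ N.+1 by rewrite ltr_pM2r.
have h4 : N.+1%:R * N.+1%:R < N.+1%:R * (e * 2 ^+ N.+1).
  by apply: (le_lt_trans h2); rewrite mulrA [N.+1%:R * e]mulrC.
by rewrite ltr_pM2l // in h4.
Qed.

End RealTaylor.

Section Complete.
Context {R : realType} {Y : completeNormedModType R[i]}.

Definition rcvg (u : nat -> Y) (l : Y) : Prop :=
  forall e : R, 0 < e -> exists N0 : nat, forall N, (N0 <= N)%N -> rnorm (u N - l) < e.

Lemma rcvg_cvg (u : nat -> Y) l : rcvg u l -> u n @[n --> \oo] --> l.
Proof.
move=> h; apply/cvg_rnormP => e e0; have [N0 hN] := h e e0.
by exists N0 => // n /= hn; exact: hN.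
Qed.

Lemma rcvg_unique (u : nat -> Y) l l' : rcvg u l -> rcvg u l' -> l = l'.
Proof. by move=> /rcvg_cvg h /rcvg_cvg h'; exact: (cvg_unique _ h h'). Qed.

Lemma rcvg_complete (u : nat -> Y) (M : R) :
  (forall n, rnorm (u n.+1 - u n) <= M * 2^-1 ^+ n) -> exists l, rcvg u l.
Proof.
move=> hu; have M0 : 0 <= M by have := hu 0%N; rewrite expr0 mulr1; apply: le_trans; exact: rnorm_ge0.
have dist n m : (n <= m)%N -> rnorm (u m - u n) <= M * 2 * 2^-1 ^+ n.
  move=> nm; have : rnorm (u m - u n) <= M * 2 * (2^-1 ^+ n - 2^-1 ^+ m).
    rewrite -(subnK nm); elim: (m - n)%N => [|j IH].
      by rewrite add0n !subrr rnorm0 mulr0.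
    have -> : u (j.+1 + n)%N - u n = (u (j + n).+1 - u (j + n)%N) + (u (j + n)%N - u n).
      by rewrite addrA subrK.
    apply: (le_trans (rnormD _ _)); apply: (le_trans (lerD (hu _) IH)).
    rewrite addSn exprS; lra.
  move/le_trans; apply; rewrite ler_wpM2l ?mulr_ge0 // gerBl exprn_ge0 // invr_ge0.
have : cauchy (u n @[n --> \oo]).
  apply: cauchy_exP => e e0; have re : 0 < complex.Re e by rewrite -ltcR ge0_Re // ltW.
  have [N0 hN0] : exists N0 : nat, M * 2 * 2^-1 ^+ N0 < complex.Re e / 2.
    have [N0 hN0] := geometric_small (divr_gt0 re (ltr_wpDl (mulr_ge0 M0 (ler0n R 8)) ltr01)).
    exists N0.+1; have := hN0 N0 (leqnn _).
    rewrite ltr_pdivlMr; last by rewrite ltr_wpDl // mulr_ge0.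
    have p2 : 0 < (2^-1 : R) ^+ N0.+1 by rewrite exprn_gt0 // invr_gt0.
    rewrite -exprVn; have : (1 : R) <= N0.+1%:R by rewrite ler1n.
    set c := _ ^+ N0.+1 in p2 *; set k := N0.+1%:R => k1 hk.
    have : c * (M * 8 + 1) <= k * c * (M * 8 + 1).
      by rewrite ler_pM2r ?ler_peMl ?(ltW p2) // ltr_wpDl // mulr_ge0.
    nra.
  exists (u N0); exists N0 => // n /= hn.
  rewrite -ball_normE /= -rnormE rdistC -(ge0_Re (ltW e0)) ltcR.
  by apply: (le_lt_trans (dist N0 n hn)); apply: (lt_trans hN0); lra.
move=> /cauchy_cvgP /cvg_ex [l hl]; exists l => e e0.
have /cvg_rnormP /(_ e e0) [N0 _ hN] := hl.
by exists N0 => N hNN; exact: hN.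
Qed.

End Complete.

Section Extension.
Context {R : realType} {V H V' D W X : completeNormedModType R[i]}.
Variable S : spaces V H V' D W X.
Variables (q K : R) (E : R[i] -> H -> H).
Hypothesis sg : csg q E.
Hypothesis q_gt0 : 0 < q.
Hypothesis contr : forall z h, cone q z -> rnorm (E z h) <= rnorm h.
Hypothesis K0 : 0 <= K.
Hypothesis E1_le : forall z h, cone q z -> rnorm (Dn E 1 h z) <= K / cabs z * rnorm h.
Local Notation C := (cone q).

Let q0 : 0 <= q. Proof. exact: ltW. Qed.
Let q1 : q < 1. Proof. by case/andP: (csg_q sg). Qed.

Lemma cone_cabs_gt0 z : C z -> 0 < cabs z.
Proof. by move=> /cone_neq0; rewrite cabs_gt0. Qed.

(** [E^(n)((n + 1) w) h = E'(w)^n E(w) h]: each of the [n] derivatives costs [K / |w|], and the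
    remaining step is a contraction. *)
Lemma Dn_le_aux n h w : C w ->
  rnorm (Dn E n h (n.+1%:R%:C * w)) <= (K / cabs w) ^+ n * rnorm h.
Proof.
move=> hw; have cw := cone_cabs_gt0 hw.
elim: n => [|n IH]; first by rewrite mul1r expr0 mul1r contr.
have -> : n.+2%:R%:C * w = w + n.+1%:R%:C * w.
  by rewrite -nat1r rmorphD mulrDl mul1r.
have hn : C (n.+1%:R%:C * w) by apply: coneZ; rewrite // ltr0n.
rewrite (DnS_add sg _ _ hw hn); apply: (le_trans (E1_le _ hw)).
by rewrite exprS -[leRHS]mulrA ler_wpM2l // divr_ge0 // ltW.
Qed.

(** [|z| / kap] is a lower bound for the Taylor radius at [z]. The factor [expR 1] comes from
    [expn_le_fact]; the summand 1 keeps [kap] positive when [K = 0]. *)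
Definition kap : R := expR 1 * K + 1.

Lemma kap_gt0 : 0 < kap.
Proof. by rewrite /kap ltr_wpDl // mulr_ge0 // expR_ge0. Qed.

(** A substitute for the Cauchy estimates: [z] is cut into [n + 1] equal steps, and [expn_le_fact]
    trades the resulting [(n + 1)^n] for [n! e^n]. *)
Lemma Dn_le n h z : C z -> rnorm (Dn E n h z) <= n`!%:R * (kap / cabs z) ^+ n * rnorm h.
Proof.
move=> hz; have cz := cone_cabs_gt0 hz.
have np : (0 : R) < n.+1%:R by rewrite ltr0n.
set w := (n.+1%:R^-1)%:C * z.
have hw : C w by apply: coneZ; rewrite // invr_gt0.
have -> : z = n.+1%:R%:C * w.
  by rewrite /w mulrA -rmorphM /= divff ?gt_eqF // mul1r.
apply: (le_trans (Dn_le_aux n h hw)); rewrite ler_wpM2r ?rnorm_ge0 //.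
have -> : cabs (n.+1%:R%:C * w) = n.+1%:R * cabs w by rewrite cabsM cabsC ger0_norm ?ler0n.
have cw := cone_cabs_gt0 hw.
have -> : (kap / (n.+1%:R * cabs w)) ^+ n = kap ^+ n / n.+1%:R ^+ n / cabs w ^+ n.
  by rewrite exprMn exprVn exprMn invfM mulrA.
rewrite expr_div_n mulrA ler_wpM2r ?invr_ge0 ?exprn_ge0 ?(ltW cw) //.
rewrite mulrA ler_pdivlMr ?exprn_gt0 //.
apply: (le_trans (ler_wpM2l (exprn_ge0 n K0) (@expn_le_fact R n))).
rewrite mulrCA ler_wpM2l ?ler0n // -exprMn.
have hk : K * expR 1 <= kap by rewrite /kap mulrC lerDl.
by apply: lerXn2r; rewrite ?nnegrE ?(ltW kap_gt0) // mulr_ge0 ?expR_ge0.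
Qed.

(** The Taylor polynomial of [E(.) h] centred at [c], evaluated at [c - t]. *)
Definition psum (c : R[i]) (t : R) (h : H) (N : nat) : H :=
  \sum_(n < N.+1) (tcoef n t)%:C *: Dn E n h c.

Lemma cabs_right (z : R[i]) (t : R) : 0 <= t -> 0 <= complex.Re z -> cabs z <= cabs (z + t%:C).
Proof.
move=> t0 z0; rewrite -(@ler_pXn2r _ 2) ?nnegrE ?cabs_ge0 // !cabs_sqr.
have -> : complex.Im (z + t%:C) = complex.Im z by case: z z0 => a b _ /=; rewrite addr0.
by rewrite ReD /= lerD2r ler_pXn2r ?nnegrE ?addr_ge0 // lerDl.
Qed.

Lemma cone_right z (t : R) : 0 <= t -> C z -> C (z + t%:C).
Proof.
rewrite le_eqVlt => /orP[/eqP <-|t0] hz; first by rewrite addr0.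
exact: coneD (cone_real q1 t0).
Qed.

Lemma cone_Re z : C z -> 0 < complex.Re z.
Proof. by apply: le_lt_trans; rewrite mulr_ge0 ?cabs_ge0. Qed.

(** Pairing the remainder [g] with itself leaves a real function of the centre [y + s], to which
    [real_taylor] and the mean value bound apply; one factor [|g|] then cancels. Moving right does
    not decrease the modulus, so [kap s / |y + s|] is at most 1/2 throughout. *)
Lemma taylor_bound y t h N : C y -> 0 <= t -> kap * t <= cabs y / 2 ->
  rnorm (psum (y + t%:C) t h N - E y h) <= N.+1%:R / 2 ^+ N.+1 * rnorm h.
Proof.
move=> hy t0 ht; have cy := cone_cabs_gt0 hy; have yR := cone_Re hy.
set g := psum _ _ _ _ - _.
pose a n s := rip S (Dn E n h (y + s%:C)) g.
have ha n s : 0 <= s <= t -> is_derive s 1 (a n) (a n.+1 s).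
  move=> /andP[s0 _].
  have hd := cderiv_Dn sg n h (cone_right s0 hy).
  have := @cderiv_line _ _ (Dn E n h) y 1 s (Dn E n.+1 h (y + s%:C)).
  rewrite !mulr1 => /(_ hd) /(rderiv_rip S g); rewrite scale1r.
  by under [X in is_derive _ _ X _]eq_fun do rewrite mulr1.
pose df s := tcoef N s * a N.+1 s.
have hT := real_taylor N ha.
have key : `|\sum_(n < N.+1) tcoef n t * a n t - \sum_(n < N.+1) tcoef n 0 * a n 0|
   <= (N.+1%:R * (2^-1 ^+ N * (kap / cabs y)) * rnorm h * rnorm g) * (t - 0).
  apply: (mvt_abs_le t0 hT) => s /andP[s0 st].
  rewrite normrM /a; apply: (le_trans (ler_wpM2l (normr_ge0 _) (rip_le _ _ _))).
  rewrite [leLHS]mulrA ler_wpM2r ?rnorm_ge0 //.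
  apply: (le_trans (ler_wpM2l (normr_ge0 _) (Dn_le N.+1 h (cone_right s0 hy)))).
  rewrite [leLHS]mulrA ler_wpM2r ?rnorm_ge0 //.
  have -> : `|tcoef N s| = s ^+ N / N`!%:R.
    rewrite /tcoef normrM normfV normr_nat normrX normrN ger0_norm //.
  rewrite factS natrM.
  have f0 : (0 : R) < N`!%:R by rewrite ltr0n fact_gt0.
  have -> : s ^+ N / N`!%:R * (N.+1%:R * N`!%:R * (kap / cabs (y + s%:C)) ^+ N.+1)
     = N.+1%:R * ((s * (kap / cabs (y + s%:C))) ^+ N * (kap / cabs (y + s%:C))).
    by move: (kap / _) => x; rewrite exprSr exprMn; field; rewrite gt_eqF.
  have c1 : kap / cabs (y + s%:C) <= kap / cabs y.
    rewrite ler_wpM2l ?(ltW kap_gt0) // lef_pV2 ?posrE // ?cabs_right ?(ltW yR) //.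
    by rewrite (lt_le_trans cy) // cabs_right // ltW.
  have c0 : 0 <= kap / cabs (y + s%:C) by rewrite divr_ge0 ?(ltW kap_gt0) ?cabs_ge0.
  rewrite ler_wpM2l ?ler0n //; apply: ler_pM => //.
    by rewrite exprn_ge0 // mulr_ge0.
  apply: lerXn2r; rewrite ?nnegrE ?invr_ge0 ?(mulr_ge0 s0 c0) //.
  apply: (@le_trans _ _ (t * (kap / cabs y))); first exact: ler_pM.
  by rewrite mulrA ler_pdivrMr // mulrC [2^-1 * _]mulrC.
have e1 : \sum_(n < N.+1) tcoef n t * a n t = rip S (psum (y + t%:C) t h N) g.
  rewrite /psum /a; elim/big_ind2 : _ => [|x1 x2 y1 y2 -> ->|n _].
  - by rewrite -(subrr (0 : H)) ripBl subrr.
  - by rewrite ripDl.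
  - by rewrite ripZl.
have e2 : \sum_(n < N.+1) tcoef n 0 * a n 0 = rip S (E y h) g.
  rewrite big_ord_recl big1 ?addr0 => [|n _]; last by rewrite tcoef0 mul0r.
  by rewrite tcoef0 mul1r /a addr0.
rewrite e1 e2 -ripBl -/g rip_sqr in key.
rewrite ger0_norm ?sqr_ge0 // subr0 in key.
have [g0|g0] := eqVneq (rnorm g) 0.
  by rewrite g0 mulr_ge0 ?rnorm_ge0 // divr_ge0 // exprn_ge0.
have gp : 0 < rnorm g by rewrite lt_neqAle eq_sym g0 rnorm_ge0.
have key2 : rnorm g <= N.+1%:R * (2^-1 ^+ N * (kap / cabs y)) * rnorm h * t.
  by rewrite -(ler_pM2r gp) -expr2 mulrAC.
apply: (le_trans key2).
have -> : N.+1%:R * (2^-1 ^+ N * (kap / cabs y)) * rnorm h * t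
   = (N.+1%:R * 2^-1 ^+ N * rnorm h) * (kap * t / cabs y) by ring.
have hk : kap * t / cabs y <= 2^-1 by rewrite ler_pdivrMr // [leRHS]mulrC.
apply: (le_trans (ler_wpM2l _ hk)).
  by rewrite !mulr_ge0 ?rnorm_ge0 ?exprn_ge0 ?invr_ge0.
by rewrite exprVn [2 ^+ N.+1]exprSr invfM; set u := (2 ^+ N)^-1; nra.
Qed.

Lemma taylor y t h : C y -> 0 <= t -> kap * t <= cabs y / 2 ->
  rcvg (psum (y + t%:C) t h) (E y h).
Proof.
move=> hy t0 ht e e0; have hp : 0 < rnorm h + 1 by rewrite ltr_wpDl ?rnorm_ge0.
have [N0 hN0] := geometric_small (divr_gt0 e0 hp).
exists N0 => N hN; apply: (le_lt_trans (taylor_bound h N hy t0 ht)).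
have := hN0 N hN; rewrite ltr_pdivlMr //; apply: le_lt_trans.
by rewrite ler_wpM2l ?lerDl // divr_ge0 // exprn_ge0.
Qed.

(** Here [c - t] may lie outside the cone: the geometric bound on the terms still gives a limit, and
    2 is the geometric sum. *)
Lemma psum_cvg c t h : C c -> 0 <= t -> kap * t <= cabs c / 2 ->
  exists2 g, rcvg (psum c t h) g & rnorm g <= 2 * rnorm h.
Proof.
move=> hc t0 ht; have cc := cone_cabs_gt0 hc.
have term n : rnorm ((tcoef n t)%:C *: Dn E n h c) <= rnorm h * 2^-1 ^+ n.
  rewrite rnormZR; apply: (le_trans (ler_wpM2l (normr_ge0 _) (Dn_le n h hc))).
  have f0 : (0 : R) < n`!%:R by rewrite ltr0n fact_gt0.
  have -> : `|tcoef n t| = t ^+ n / n`!%:R.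
    by rewrite /tcoef normrM normfV normr_nat normrX normrN ger0_norm.
  have -> : t ^+ n / n`!%:R * (n`!%:R * (kap / cabs c) ^+ n * rnorm h)
     = rnorm h * (t * (kap / cabs c)) ^+ n.
    by move: (kap / _) => x; rewrite exprMn; field; rewrite gt_eqF.
  rewrite ler_wpM2l ?rnorm_ge0 //; apply: lerXn2r; rewrite ?nnegrE ?invr_ge0 //.
    by rewrite mulr_ge0 // divr_ge0 ?(ltW kap_gt0) // ltW.
  by rewrite mulrA ler_pdivrMr // mulrC [2^-1 * _]mulrC.
have [g hg] : exists g, rcvg (psum c t h) g.
  apply: (@rcvg_complete _ _ _ (rnorm h)) => n.
  rewrite /psum big_ord_recr /= addrAC subrr add0r; apply: (le_trans (term _)).
  rewrite ler_wpM2l ?rnorm_ge0 // exprS ler_piMl ?exprn_ge0 ?invr_ge0 //.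
  by rewrite invf_le1 // ler1n.
exists g => //.
have bnd N : rnorm (psum c t h N) <= 2 * rnorm h.
  apply: (le_trans (rnorm_sum _ _ _)).
  apply: (@le_trans _ _ (\sum_(i < N.+1) rnorm h * 2^-1 ^+ i)).
    by apply: ler_sum => i _; exact: term.
  rewrite -mulr_sumr mulrC.
  rewrite ler_wpM2r ?rnorm_ge0 //.
  suff : \sum_(i < N.+1) (2^-1 : R) ^+ i <= 2 - 2^-1 ^+ N.
    by move/le_trans; apply; rewrite gerBl exprn_ge0 // invr_ge0.
  elim: N => [|N IH]; first by rewrite big_ord1 !expr0; lra.
  by rewrite big_ord_recr /= exprS; have := IH; lra.
apply/ler_addgt0Pr => e e0; have [N0 hN] := hg e e0.
have := hN N0 (leqnn _); have := bnd N0; have := rnorm_dist_le g (psum c t h N0).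
by rewrite (rdistC g) => h1 h2 h3; lra.
Qed.

(* Small enough for the Taylor series of E at z + r |z| to converge at z. *)
Definition ext_ratio : R := (2 * kap)^-1.

Lemma ext_ratio_gt0 : 0 < ext_ratio.
Proof. by rewrite invr_gt0 mulr_gt0 // kap_gt0. Qed.

Lemma ext_ratioE t c : t <= ext_ratio * c -> kap * t <= c / 2.
Proof.
move=> h; apply: (le_trans (ler_wpM2l (ltW kap_gt0) h)); rewrite /ext_ratio invfM.
by rewrite mulrA mulrCA mulfV ?gt_eqF ?kap_gt0 // mulr1 mulrC.
Qed.

(** With [y] the new time and [r] the ratio, [x = y (1 + r / 2) < y + r y]. All derivatives of
    [E(.) g] vanish beyond [x], hence so does the Taylor series at [y + r y], which reaches back to
    [y]. *)
Lemma E_injective_step x g : 0 < x -> E x%:C g = 0 -> E (x / (1 + ext_ratio / 2))%:C g = 0.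
Proof.
move=> x0 hx; have r0 := ext_ratio_gt0; set r := ext_ratio in r0 *.
have d0 : 0 < 1 + r / 2 by rewrite addr_gt0 // divr_gt0.
set y := x / (1 + r / 2); have y0 : 0 < y by rewrite divr_gt0.
have hy : C y%:C by exact: cone_real.
have t0 : 0 <= r * y by rewrite mulr_ge0 // ltW.
have ht : kap * (r * y) <= cabs y%:C / 2.
  by apply: ext_ratioE; rewrite cabsC gtr0_norm.
apply: (rcvg_unique (taylor g hy t0 ht)) => e e0; exists 0%N => N _.
rewrite /psum big1 ?subrr ?rnorm0 // => n _.
have d : 0 < y + r * y - x.
  have -> : x = y * (1 + r / 2) by rewrite /y divfK // gt_eqF.
  have : 0 < y * r by rewrite mulr_gt0.
  lra.
have -> : y%:C + (r * y)%:C = (y + r * y - x)%:C + x%:C by rewrite -!rmorphD /= subrK.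
rewrite -(Dn_E sg) ?hx ?(Dn0 sg) ?scaler0 //; exact: cone_real.
Qed.

(** Plays the role of the identity theorem: repeated steps bring the zero to times tending to 0,
    where [E(t) g] tends to [g]. *)
Lemma E_injective x g : 0 < x -> E x%:C g = 0 -> g = 0.
Proof.
move=> x0 hx; have r0 := ext_ratio_gt0.
have d1 : 1 < 1 + ext_ratio / 2 by rewrite ltrDl divr_gt0.
have d0 : 0 < 1 + ext_ratio / 2 by apply: lt_trans d1.
have it n : 0 < x / (1 + ext_ratio / 2) ^+ n /\ E (x / (1 + ext_ratio / 2) ^+ n)%:C g = 0.
  elim: n => [|n [p IH]]; first by rewrite expr0 divr1.
  split; first by rewrite divr_gt0 // exprn_gt0.
  by rewrite exprSr invfM mulrA E_injective_step.
apply/eqP; rewrite -rnorm_eq0 eq_le rnorm_ge0 andbT.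
apply/ler_addgt0Pr => e e0; rewrite add0r.
have [dl dl0 hd] := csg_cont0 sg g e0.
have [n hn] : exists n : nat, x / (1 + ext_ratio / 2) ^+ n < dl.
  exists (truncn (x / dl / (ext_ratio / 2))).+1; set n := (truncn _).+1.
  have hn : x / dl / (ext_ratio / 2) < n%:R by exact: truncnS_gt.
  rewrite ltr_pdivrMr ?exprn_gt0 // mulrC -ltr_pdivrMr //.
  have bern : 1 + n%:R * (ext_ratio / 2) <= (1 + ext_ratio / 2) ^+ n.
    elim: (n) => [|m IH]; first by rewrite mul0r addr0 expr0.
    rewrite exprS; have := ler_wpM2l (ltW d0) IH; apply: le_trans.
    have := sqr_ge0 (ext_ratio / 2); have : (0 : R) <= m%:R by [].
    rewrite -natr1; nra.
  apply: lt_le_trans bern; rewrite ltr_pdivrMr ?divr_gt0 // in hn.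
  by apply: (lt_trans hn); rewrite ltrDr.
have [p Eg] := it n.
by have := hd (x / (1 + ext_ratio / 2) ^+ n); rewrite p hn => /(_ isT); rewrite Eg sub0r rnormN => /ltW.
Qed.

(* By injectivity of E(x), g is the only candidate for the value at z of a
   continuation of E(.) h. *)
Definition extends_at (z : R[i]) (h g : H) : Prop :=
  exists2 x : R, 0 < x & C (z + x%:C) /\ E x%:C g = E (z + x%:C) h.

Lemma extends_at_shift z h g (x y : R) : 0 < x -> 0 < y -> C (z + x%:C) ->
  E x%:C g = E (z + x%:C) h ->
  C (z + (x + y)%:C) /\ E (x + y)%:C g = E (z + (x + y)%:C) h.
Proof.
move=> x0 y0 hc e; have hy : C y%:C by exact: cone_real.
have hx : C x%:C by exact: cone_real.
have -> : z + (x + y)%:C = y%:C + (z + x%:C) by rewrite rmorphD /= addrA addrC.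
split; first exact: coneD.
by rewrite rmorphD /= addrC (csg_law sg hy hx) e (csg_law sg hy hc).
Qed.

Lemma extends_at_unique z h g g' : extends_at z h g -> extends_at z h g' -> g = g'.
Proof.
move=> [x x0 [hc e]] [x' x'0 [hc' e']].
have [_ h1] := extends_at_shift x0 x'0 hc e.
have [_ h2] := extends_at_shift x'0 x0 hc' e'.
apply/eqP; rewrite -subr_eq0; apply/eqP.
have p : 0 < x + x' by rewrite addr_gt0.
apply: (E_injective p); rewrite (csgB sg) ?h1; last exact: cone_real.
by rewrite [x + x']addrC h2 subrr.
Qed.

Lemma E_psum x c t h N : 0 < x -> C c -> E x%:C (psum c t h N) = psum (x%:C + c) t h N.
Proof.
move=> x0 hc; have hx : C x%:C by exact: cone_real.
rewrite /psum; elim/big_ind2 : _ => [|x1 x2 y1 y2 <- <-|n _].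
- exact: (csg0 sg).
- exact: (csgD sg).
- by rewrite (csgZ sg) // (Dn_add sg).
Qed.

(** [g] is the sum of the Taylor series at [c = z + t]. The contraction [E(t)] acts on it termwise
    and yields the series at [c + t], whose sum at [c] is [E(c) h]. *)
Lemma extends_at_exists z h : 0 <= complex.Re z -> z != 0 ->
  C (z + (ext_ratio * cabs z)%:C) ->
  exists2 g, extends_at z h g & rnorm g <= 2 * rnorm h.
Proof.
move=> z0 zn hc; set t := ext_ratio * cabs z in hc *; set c := z + t%:C in hc *.
have t0 : 0 < t by rewrite mulr_gt0 ?ext_ratio_gt0 ?cabs_gt0.
have tge := ltW t0.
have ht : kap * t <= cabs c / 2.
  apply: ext_ratioE; rewrite ler_wpM2l ?(ltW ext_ratio_gt0) //; exact: cabs_right.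
have [g hg gle] := psum_cvg h hc tge ht; exists g => //.
exists t => //; split => //.
have hx : C t%:C by exact: cone_real.
have hT := taylor h hc tge ht; apply: rcvg_unique hT => e e0.
have [N0 hN] := hg e e0; exists N0 => N hNN.
rewrite [c + _]addrC -E_psum // -(csgB sg) //.
by apply: le_lt_trans (hN N hNN); exact: contr.
Qed.

Definition Eext (z : R[i]) (h : H) : H := xget 0 (extends_at z h).

Lemma EextE z h g : extends_at z h g -> Eext z h = g.
Proof.
move=> hg; rewrite /Eext; case: xgetP => [g' _ hg'|/(_ g)//].
exact: extends_at_unique hg' hg.
Qed.

Lemma Eext_E z h : C z -> Eext z h = E z h.
Proof.
move=> hz; apply: EextE; exists 1 => //.
have h1 : C (1 : R)%:C by exact: cone_real.
by split; [exact: coneD|rewrite -(csg_law sg h1 hz) addrC].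
Qed.

Section Wider.
Variable q' : R.
Hypothesis q'0 : 0 <= q'.
Hypothesis q'q : q' <= q.
Hypothesis wider : forall z, cone q' z -> C (z + (ext_ratio * cabs z)%:C).

Lemma Eext_spec z h : cone q' z -> extends_at z h (Eext z h) /\ rnorm (Eext z h) <= 2 * rnorm h.
Proof.
move=> hz; have zn := cone_neq0 hz.
have z0 : 0 <= complex.Re z by apply: ltW; apply: le_lt_trans hz; rewrite mulr_ge0 ?cabs_ge0.
have [g hg gle] := extends_at_exists h z0 zn (wider hz).
by rewrite (EextE hg).
Qed.

Lemma Eext_common z h w h' : cone q' z -> cone q' w ->
  exists2 x : R, 0 < x & [/\ C (z + x%:C), E x%:C (Eext z h) = E (z + x%:C) h,
    C (w + x%:C) & E x%:C (Eext w h') = E (w + x%:C) h'].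
Proof.
move=> hz hw; have [[x x0 [c1 e1]] _] := Eext_spec h hz.
have [[y y0 [c2 e2]] _] := Eext_spec h' hw.
exists (x + y); first exact: addr_gt0.
have [k1 k2] := extends_at_shift x0 y0 c1 e1.
by have [k3 k4] := extends_at_shift y0 x0 c2 e2; split; rewrite // [x + y]addrC.
Qed.

Lemma Eext_lin z : cone q' z -> linear (Eext z).
Proof.
move=> hz a h1 h2; apply: EextE.
have [x x0 [c1 e1 _ e2]] := Eext_common h1 h2 hz hz.
exists x => //; split => //; have hx : C x%:C by exact: cone_real.
by rewrite (csg_lin sg hx) e1 e2 (csg_lin sg c1).
Qed.

Lemma Eext_law z w : cone q' z -> cone q' w -> forall h, Eext (z + w) h = Eext z (Eext w h).
Proof.
move=> hz hw h; apply: EextE.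
have [x x0 [c1 e1 c2 e2]] := Eext_common (Eext w h) h hz hw.
have hx : C x%:C by exact: cone_real.
have e3 : z + w + (x + x)%:C = (z + x%:C) + (w + x%:C) by rewrite rmorphD /= addrACA.
exists (x + x); first exact: addr_gt0.
split; first by rewrite e3; exact: coneD.
rewrite e3 (csg_law sg c1 c2) -e2 -(csg_law sg c1 hx) [z + x%:C + x%:C]addrC.
by rewrite (csg_law sg hx c1) -e1 rmorphD /= (csg_law sg hx hx).
Qed.

Lemma Eext_shift z w h : C w -> cone q' z -> cone q' (w + z) -> Eext (w + z) h = E w (Eext z h).
Proof.
move=> hw hz hwz; apply: EextE; have [[x x0 [c1 e1]] _] := Eext_spec h hz.
have hx : C x%:C by exact: cone_real.
exists x => //; rewrite -addrA; split; first exact: coneD.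
by rewrite -(csg_law sg hx hw) [x%:C + w]addrC (csg_law sg hw hx) e1 (csg_law sg hw c1).
Qed.

(** Near [z] the continuation is [E(b + y)] applied to its value at [z - b], so differentiability is
    inherited from [E] at the real point [b] of the original cone. *)
Lemma Eext_deriv h z : cone q' z -> exists d, cderiv (Eext^~ h) z d.
Proof.
move=> hz; have [dl dl0 hd] := cone_open q'0 hz.
set b := dl / 2; have b0 : 0 < b by rewrite divr_gt0.
have hb : C b%:C by exact: cone_real.
have hzb : cone q' (z - b%:C).
  by apply: hd; rewrite cabsN cabsC gtr0_norm // ltr_pdivrMr // mulr_natr mulr2n ltrDl.
have [dl1 dl10 hd1] := cone_open q0 hb.
have [d hdr] := csg_deriv sg (Eext (z - b%:C) h) hb.
exists d => e e0; have [dl2 dl20 hd2] := hdr e e0.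
exists (Num.min dl (Num.min dl1 dl2)) => [|y]; first by rewrite !lt_min dl0 dl10.
rewrite !lt_min => /andP[/hd h1 /andP[/hd1 h2 h3]].
have e1 : Eext (z + y) h = E (b%:C + y) (Eext (z - b%:C) h).
  have ez : z + y = b%:C + y + (z - b%:C) by rewrite [RHS]addrC addrA subrK.
  by rewrite {1}ez Eext_shift // -ez.
have e2 : Eext z h = E b%:C (Eext (z - b%:C) h).
  have ez : z = b%:C + (z - b%:C) by rewrite [RHS]addrC subrK.
  by rewrite {1}ez Eext_shift // -ez.
by rewrite e1 e2; exact: hd2.
Qed.

(** [h] is approximated by [E(x) h]. On that vector the continuation is [E(x + z) h], continuous at
    [z = 0]; the difference is controlled by the uniform bound 2, and the three errors add up to
    less than [e]. *)
Lemma Eext_cont0 h (e : R) : 0 < e -> exists2 dl : R, 0 < dl &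
  forall z, cone q' z -> cabs z < dl -> rnorm (Eext z h - h) < e.
Proof.
move=> e0; have e4 : 0 < e / 4 by rewrite divr_gt0.
have [d1 d10 h1] := csg_cont0 sg h e4.
set x := d1 / 2; have x0 : 0 < x by rewrite divr_gt0.
have hx : C x%:C by exact: cone_real.
have hxe : rnorm (E x%:C h - h) < e / 4.
  by apply: h1; rewrite x0 ltr_pdivrMr // mulr_natr mulr2n ltrDl.
have [d hd] := csg_deriv sg h hx.
have [d2 d20 h2] := cderiv_cont hd e4.
have [d3 d30 h3] := cone_open q0 hx.
exists (Num.min d2 d3) => [|z hz]; first by rewrite lt_min d20.
rewrite lt_min => /andP[/h2 k2 /h3 k3].
have hB : Eext z (h - E x%:C h) = Eext z h - Eext z (E x%:C h).
  have := Eext_lin hz (-1) (E x%:C h) h.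
  by rewrite !scaleN1r [h - _]addrC => ->; rewrite addrC.
have e1 : Eext z (E x%:C h) = E (x%:C + z) h.
  apply: EextE; have [[y y0 [c1 ey]] _] := Eext_spec h hz.
  have hy : C y%:C by exact: cone_real.
  exists y => //; split => //.
  by rewrite -(csg_law sg hy k3) -(csg_law sg c1 hx) [y%:C + _]addrC -addrA addrC.
have -> : Eext z h - h = Eext z (h - E x%:C h) + (E (x%:C + z) h - E x%:C h) + (E x%:C h - h).
  by rewrite hB e1 [in RHS]addrA [in RHS]addrA subrK subrK.
have [_ le2] := Eext_spec (h - E x%:C h) hz.
have := rnormD (Eext z (h - E x%:C h) + (E (x%:C + z) h - E x%:C h)) (E x%:C h - h).
have := rnormD (Eext z (h - E x%:C h)) (E (x%:C + z) h - E x%:C h).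
rewrite rdistC in le2; move: hxe k2 le2.
set a := rnorm _; set a2 := rnorm _; set a3 := rnorm _.
set a4 := rnorm _; set a5 := rnorm _; lra.
Qed.

Lemma Eext_csg : csg q' Eext.
Proof.
split.
- by rewrite q'0 (le_lt_trans q'q).
- exact: Eext_lin.
- exact: Eext_law.
- exact: Eext_deriv.
- by move=> z hz; exists 2 => h; case: (Eext_spec h hz).
- move=> h e e0; have [dl dl0 hd] := Eext_cont0 h e0; exists dl => // t /andP[t0 td].
  by apply: hd; [apply: cone_real => //; exact: le_lt_trans q1|rewrite cabsC gtr0_norm].
Qed.

Lemma Eext_bounded z h : cone q' z -> rnorm (Eext z h) <= 2 * rnorm h.
Proof. by move=> hz; case: (Eext_spec h hz). Qed.

End Wider.

End Extension.

(** * The generator *)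

Section Pairing.
Context {R : realType} {V H V' D W X : completeNormedModType R[i]}.
Variable S : spaces V H V' D W X.
Local Notation mu := (@lebesgue_measure R).

Definition rpair (f : V') (v : V) : R := complex.Re (pairing S f v).

Lemma rpairDl f g v : rpair (f + g) v = rpair f v + rpair g v.
Proof. by rewrite /rpair linearDl raddfD. Qed.

Lemma rpairNl f v : rpair (- f) v = - rpair f v.
Proof. by rewrite /rpair linearNl raddfN. Qed.

Lemma rpairBl f g v : rpair (f - g) v = rpair f v - rpair g v.
Proof. by rewrite rpairDl rpairNl. Qed.

Lemma rpairZl (t : R) f v : rpair (t%:C *: f) v = t * rpair f v.
Proof. by rewrite /rpair linearZl_LR /= Re_realM. Qed.

Lemma rpair_sum (I : Type) (r : seq I) (P : pred I) (F : I -> V') v :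
  rpair (\sum_(i <- r | P i) F i) v = \sum_(i <- r | P i) rpair (F i) v.
Proof.
elim/big_ind2 : _ => [|x1 x2 y1 y2 <- <-|//]; last by rewrite rpairDl.
by rewrite -(subrr (0 : V')) rpairBl subrr.
Qed.

Lemma conjC_real (a : R) : conjC (a%:C : R[i]) = a%:C.
Proof. by apply/eqP; rewrite eq_complex /= oppr0 !eqxx. Qed.

Lemma pairing_realZ f (a : R) v : pairing S f (a%:C *: v) = a%:C * pairing S f v.
Proof. by rewrite linearZr_LR /= conjC_real. Qed.

Lemma pairing_le f v : cabs (pairing S f v) <= rnorm f * rnorm v.
Proof.
have := @opnorm_le R V (R[i]^o) (fun v => pairing S f v : R[i]^o) v.
rewrite pairing_norm /= => h; apply: h; first by move=> a x; exact: pairing_realZ.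
by rewrite ltry.
Qed.

Lemma rpair_le f v : `|rpair f v| <= rnorm f * rnorm v.
Proof. exact: le_trans (abs_Re_le _) (pairing_le f v). Qed.

(** Testing with [v] and with [i v] recovers both parts of the pairing, and the norm of [V'] is the
    operator norm of the pairing. *)
Lemma rpair_eq0 f : (forall v, rpair f v = 0) -> f = 0.
Proof.
move=> h; apply/eqP; rewrite -rnorm_eq0; apply/eqP.
have p0 v : pairing S f v = 0.
  have h1 := h v; have := h (('i%C : R[i]) *: v); rewrite /rpair linearZr_LR /=.
  have -> : conjC ('i%C : R[i]) = - 'i%C.
    by apply/eqP; rewrite eq_complex /= oppr0 !eqxx.
  move: h1; rewrite /rpair; case: (pairing S f v) => a b /= -> hb.
  apply/eqP; rewrite eq_complex /= eqxx /=; apply/eqP.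
  by move: hb; rewrite mulr0 sub0r mulN1r opprK.
have : ((rnorm f)%:E <= 0)%E.
  rewrite -(pairing_norm S); apply: ge_ereal_sup => _ [v _ <-].
  by rewrite p0 lee_fin rnorm0.
by rewrite lee_fin => h0; apply/eqP; rewrite eq_le h0 rnorm_ge0.
Qed.

Lemma rpair_H h v : rpair (HtoV' S h) v = rip S h (VtoH S v).
Proof. by rewrite /rpair pairingE. Qed.

Lemma sf_fun_rpair (s : stepfun V') t v :
  rpair (sf_fun s t) v = \sum_(i < sf_len s) \1_(sf_set i) t * rpair (sf_val i) v.
Proof. by rewrite /sf_fun rpair_sum; apply: eq_bigr => i _; rewrite rpairZl. Qed.

Lemma integrable_indic_fin (I A : set (measurableTypeR R)) : measurable I ->
  measurable A -> (mu A < +oo)%E -> mu.-integrable I (fun t => (\1_A t)%:E).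
Proof.
move=> mI mA fA; apply/integrableP; split.
  by apply/measurable_EFinP; exact: measurable_indic.
under eq_integral do rewrite gee0_abs ?lee_fin //.
rewrite integral_indic //; apply: le_lt_trans fA; apply: le_measure; rewrite ?inE //.
exact: measurableI.
Qed.

Lemma stepfun_integral (I : set R) (s : stepfun V') v :
  measurable (I : set (measurableTypeR R)) ->
  mu.-integrable I (fun t => (rpair (sf_fun s t) v)%:E) /\
  (\int[mu]_(t in I) (rpair (sf_fun s t) v)%:E = (rpair (sf_int I s) v)%:E)%E.
Proof.
move=> mI.
have ifin i : mu.-integrable I (fun t => ((\1_(@sf_set _ _ s i) t)%:E * (rpair (sf_val i) v)%:E)%E).
  by apply: integrableZr => //; apply: integrable_indic_fin => //; [exact: sf_meas|exact: sf_fin].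
have e : (fun t => (rpair (sf_fun s t) v)%:E) =
   (fun t => \sum_(i < sf_len s) ((\1_(@sf_set _ _ s i) t)%:E * (rpair (sf_val i) v)%:E)%E)%E.
  by apply/funext => t; rewrite sf_fun_rpair -sumEFin.
rewrite e; split; first exact: integrable_sum.
rewrite integral_sum //.
rewrite /sf_int rpair_sum -sumEFin; apply: eq_bigr => i _.
rewrite integralZr //; last by apply: integrable_indic_fin => //; [exact: sf_meas|exact: sf_fin].
rewrite integral_indic //; last exact: sf_meas.
have mSI : measurable (I `&` @sf_set _ _ s i : set (measurableTypeR R)).
  by apply: measurableI => //; exact: sf_meas.
have fin : mu (I `&` @sf_set _ _ s i) \is a fin_num.
  rewrite ge0_fin_numE; last exact: measure_ge0.
  apply: le_lt_trans (@sf_fin _ _ s i); apply: le_measure; rewrite ?inE //.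
  exact: sf_meas.
by rewrite setIC rpairZl EFinM fineK.
Qed.

End Pairing.

Section ScalarBound.
Context {R : realType} {V H V' D W X : completeNormedModType R[i]}.
Variable S : spaces V H V' D W X.
Local Notation mu := (@lebesgue_measure R).

Lemma cvge0_lt (u : nat -> \bar R) (e : R) : u n @[n --> \oo] --> 0%E -> 0 < e ->
  \forall n \near \oo, (u n < e%:E)%E.
Proof.
move=> h e0; apply: (h [set x | (x < e%:E)%E]).
have : \forall r \near (0 : R), r < e by exact: lt_nbhsl.
by apply: filterS => r /=; rewrite lte_fin.
Qed.

Lemma mu_segment (t : R) : 0 <= t -> mu `[0, t]%classic = t%:E.
Proof.
move=> t0; have := lebesgue_measure_itv `[0, t]; rewrite /= lte_fin => h.
apply: etrans h _; case: ltP => [_|h]; first by rewrite -EFinB subr0.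
by rewrite (@le_anti _ _ t 0) ?h.
Qed.

(** Signed integrals are taken of step functions only; [f] enters through the nonnegative integral
    of its distance to [s], for which monotonicity needs no measurability. *)
Lemma step_scalar_bound (f : R -> V') (s : stepfun V') (phi : V) (t c e : R) :
  0 <= t -> 0 <= e ->
  {ae mu, forall r, 0 <= r <= t -> `|rpair S (f r) phi - c| <= e} ->
  (`|rpair S (sf_int `[0%R, t]%classic s) phi - t * c|%:E <=
   (t * e)%:E + (rnorm phi + 1)%:E *
     \int[mu]_(r in `[0%R, t]%classic) (rnorm (f r - sf_fun s r))%:E)%E.
Proof.
move=> t0 e0 hf; set I : set R := `[0, t]%classic; set k := rnorm phi + 1.
have k0 : 0 < k by rewrite ltr_wpDl ?rnorm_ge0.
have mI : measurable (I : set (measurableTypeR R)) by exact: measurable_itv.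
have muI : mu I = t%:E by exact: mu_segment.
have fI : (mu I < +oo)%E by rewrite muI ltry.
have [int_s int_e] := stepfun_integral S s phi mI.
pose sg r := rpair S (sf_fun s r) phi.
have ms : measurable_fun I sg.
  by apply/measurable_EFinP; exact: measurable_int int_s.
have int_c (a : R) : mu.-integrable I (fun=> a%:E).
  apply/integrableP; split; first exact: measurable_cst.
  by rewrite integral_cst //= [X in (_ * X)%E]muI -EFinM ltry.
have e1 : (rpair S (sf_int I s) phi - t * c)%:E = (\int[mu]_(r in I) (sg r - c)%:E)%E.
  rewrite (_ : (fun r => (sg r - c)%:E) = (fun r => (sg r)%:E - c%:E)%E) //.
  rewrite integralB //= int_e integral_cst //= [X in (_ - _ * X)%E]muI.
  by rewrite EFinB EFinM muleC.
rewrite -[leLHS]/(`|(rpair S (sf_int I s) phi - t * c)%:E|)%E e1.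
have msc : measurable_fun I (fun r => sg r - c) by exact: measurable_funB.
have mab : measurable_fun I (fun r => `|sg r - c|) by exact: measurableT_comp.
(* The excess of [|sg - c|] over [e] is measurable and, almost everywhere, at most [rnorm phi] times
   the distance from [f] to the step function. *)
have mm : measurable_fun I (fun r => Num.max (`|sg r - c| - e) 0).
  apply: measurable_maxr => //; exact: measurable_funB.
apply: (@le_trans _ _ (\int[mu]_(r in I) (`|sg r - c|)%:E)%E).
  have := @le_abse_integral _ _ R mu I (fun r => (sg r - c)%:E) mI.
  by apply; apply/measurable_EFinP.
apply: (@le_trans _ _ (\int[mu]_(r in I) ((Num.max (`|sg r - c| - e) 0)%:E + e%:E))%E).
  apply: ge0_le_integral => //=.
  - exact/measurable_EFinP.
  - by apply/measurable_EFinP; apply: measurable_funD.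
  - by move=> r _; rewrite -EFinD lee_fin -lerBlDr le_max lexx.
rewrite [leLHS](_ : _ = (\int[mu]_(r in I) (Num.max (`|sg r - c| - e) 0)%:E
    + \int[mu]_(r in I) e%:E)%E); last first.
  by apply: ge0_integralD => //=; first [exact/measurable_EFinP |
    by move=> r _; rewrite lee_fin // le_max lexx orbT].
rewrite integral_cst //= [X in (_ + _ * X)%E]muI addeC; apply: leeD.
  by rewrite -EFinM mulrC.
(* The constant is moved into the integral of the measurable excess, leaving the integral of the
   distance untouched. *)
apply: (@le_trans _ _ (k%:E * \int[mu]_(r in I) (k^-1%:E * (Num.max (`|sg r - c| - e) 0)%:E))%E).
  rewrite [X in (_ <= _ * X)%E](_ : _ = (k^-1%:E *
      \int[mu]_(r in I) (Num.max (`|sg r - c| - e) 0)%:E)%E); last first.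
    by apply: ge0_integralZl_EFin => //=; first [exact/measurable_EFinP |
      by move=> r _; rewrite lee_fin le_max lexx orbT | by rewrite invr_ge0 ltW].
  by rewrite muleA -EFinM mulfV ?gt_eqF // mul1e.
apply: lee_wpmul2l; first by rewrite lee_fin ltW.
apply: ge0_le_integral_ae.
- by move=> r _; rewrite -EFinM lee_fin mulr_ge0 ?invr_ge0 ?(ltW k0) // le_max lexx orbT.
- by move=> r _; rewrite lee_fin rnorm_ge0.
case: hf => Nl [mN N0 hN]; exists Nl; split => // r /= hr; apply: hN => /= h.
apply: hr; rewrite /I /= in_itv /= => /h {}h.
rewrite -EFinM lee_fin ler_pdivrMl // ge_max mulr_ge0 ?rnorm_ge0 ?(ltW k0) // andbT.
have e2 : sg r - c = (rpair S (f r) phi - c) - rpair S (f r - sf_fun s r) phi.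
  by rewrite rpairBl /sg; ring.
rewrite lerBlDr e2; apply: (le_trans (ler_normB _ _)); rewrite addrC; apply: lerD => //.
apply: (le_trans (rpair_le S _ _)); rewrite mulrC ler_wpM2r ?rnorm_ge0 //.
by rewrite /k lerDl.
Qed.

(** The limit of [step_scalar_bound] along approximating step functions. It controls difference
    quotients of a primitive at 0, without a differentiation theorem. *)
Lemma bochner_scalar_bound (f : R -> V') (y : V') (phi : V) (t c e : R) :
  0 <= t -> 0 <= e -> is_bochner `[0%R, t]%classic f y ->
  {ae mu, forall r, 0 <= r <= t -> `|rpair S (f r) phi - c| <= e} ->
  `|rpair S y phi - t * c| <= t * e.
Proof.
move=> t0 e0 [_ [s [h1 h2]]] hf.
have k0 : 0 < rnorm phi + 1 by rewrite ltr_wpDl ?rnorm_ge0.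
apply/ler_addgt0Pr => eps eps0.
have d0 : 0 < eps / 2 / (rnorm phi + 1) by rewrite !divr_gt0.
have n1 := cvge0_lt h1 d0.
have /cvg_rnormP /(_ _ d0) n2 := h2.
have [n [k1 k2]] : exists n, (\int[mu]_(t in `[0%R, t]%classic) (rnorm (f t - sf_fun (s n) t))%:E
     < (eps / 2 / (rnorm phi + 1))%:E)%E /\
     rnorm (sf_int `[0, t]%classic (s n) - y) < eps / 2 / (rnorm phi + 1).
  by near \oo => n; exists n; split; near: n.
have := step_scalar_bound (s n) t0 e0 hf.
set J := integral _ _ _ in k1 *.
have J0 : (0 <= J)%E by apply: integral_ge0 => r _; rewrite lee_fin rnorm_ge0.
have Jfin : J \is a fin_num by rewrite ge0_fin_numE // (lt_trans k1) // ltry.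
rewrite -(fineK Jfin) in k1 *; rewrite lte_fin in k1.
rewrite -EFinM -EFinD lee_fin => h3.
have h4 : (rnorm phi + 1) * fine J <= eps / 2.
  by rewrite mulrC -ler_pdivlMr // ltW.
have h5 : `|rpair S (sf_int `[0, t]%classic (s n) - y) phi| <= eps / 2.
  apply: (le_trans (rpair_le S _ _)).
  apply: (@le_trans _ _ (eps / 2 / (rnorm phi + 1) * (rnorm phi + 1))).
    by apply: ler_pM; rewrite ?rnorm_ge0 ?(ltW k2) // lerDl.
  by rewrite divfK // gt_eqF.
have -> : rpair S y phi - t * c = (rpair S (sf_int `[0, t]%classic (s n)) phi - t * c)
   - rpair S (sf_int `[0, t]%classic (s n) - y) phi by rewrite rpairBl; ring.
apply: (le_trans (ler_normB _ _)); lra.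
Unshelve. all: end_near. Qed.

End ScalarBound.

Section GeneratorInCone.
Context {R : realType} {V H V' D W X : completeNormedModType R[i]}.
Variable S : spaces V H V' D W X.
Local Notation mu := (@lebesgue_measure R).
Variables (A : {linear V -> V'}) (q M : R) (E : R[i] -> H -> H).
Hypothesis A_cont : continuous A.
Hypothesis sg : csg q E.
Hypothesis sol_E : forall v0 v, is_solution S A v0 v ->
  forall t : R, 0 < t -> v t = E t%:C v0.
Hypothesis sol_ex : forall v0, exists v, is_solution S A v0 v.
Hypothesis gen_le : forall h y, generates S A h y ->
  exists2 v, VtoH S v = h & rnorm v <= M * (rnorm h + rnorm y).
Local Notation C := (cone q).

Let q0 : 0 <= q. Proof. by case/andP: (csg_q sg). Qed.
Let q1 : q < 1. Proof. by case/andP: (csg_q sg). Qed.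
Let cR (t : R) : 0 < t -> C t%:C. Proof. exact: cone_real. Qed.

(** Analyticity makes [s -> E(t + s) h] differentiable at 0, so [E(t) h] lies in the domain of the
    generator for every [h]. *)
Lemma generates_E (t : R) h : 0 < t -> generates S A (E t%:C h) (- Dn E 1 h t%:C).
Proof.
move=> t0; have [v hv] := sol_ex (E t%:C h); exists v => //; rewrite opprK.
apply/cvg_rnormP => e e0; have e2 : 0 < e / 2 by rewrite divr_gt0.
have [dl dl0 hd] := cderiv_E sg h (cR t0) e2.
near=> s; have s0 : 0 < s by near: s; exact: nbhs_right_gt.
have sd : s < dl by near: s; exact: nbhs_right_lt.
rewrite (sol_E hv s0) -(csg_law sg (cR s0) (cR t0)).
have -> : (s^-1)%:C *: (E (s%:C + t%:C) h - E t%:C h) - Dn E 1 h t%:C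
   = (s^-1)%:C *: (E (t%:C + s%:C) h - E t%:C h - s%:C *: Dn E 1 h t%:C).
  by rewrite [RHS]scalerBr scalerA -rmorphM /= mulVf ?gt_eqF // scale1r addrC [s%:C + _]addrC addrC.
have cs : cabs s%:C = s by rewrite cabsC gtr0_norm.
have hs : cabs s%:C < dl by rewrite cs.
rewrite rnormZR gtr0_norm ?invr_gt0 // ltr_pdivrMl //.
apply: (le_lt_trans (hd _ hs)); rewrite cs mulrC ltr_pM2l //; lra.
Unshelve. all: end_near. Qed.

(** The representative of [E(t) h] in [V]; the default of [xget] does not occur for [t > 0]. *)
Definition xof h (t : R) : V := xget 0 [set x | VtoH S x = E t%:C h].

Lemma xofE h t : 0 < t -> VtoH S (xof h t) = E t%:C h.
Proof.
move=> t0; rewrite /xof; case: xgetP => [x _ //|].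
by have [v hv _] := gen_le (generates_E h t0) => /(_ v).
Qed.

(** The difference represents [E(d) g], with [g] formed at times reduced by [d]; so the bound of the
    V-norm by the graph norm applies to it. *)
Lemma xof_dist h d t t' : 0 < d -> d < t -> d < t' ->
  rnorm (xof h t - xof h t')
  <= M * (rnorm (E t%:C h - E t'%:C h) + rnorm (Dn E 1 h t%:C - Dn E 1 h t'%:C)).
Proof.
move=> d0 dt dt'; set g := E (t - d)%:C h - E (t' - d)%:C h.
have c1 : C (t - d)%:C by apply: cR; rewrite subr_gt0.
have c2 : C (t' - d)%:C by apply: cR; rewrite subr_gt0.
have e (s : R) : d%:C + (s - d)%:C = s%:C :> R[i] by rewrite -rmorphD /= addrC subrK.
have Eg : E d%:C g = E t%:C h - E t'%:C h.
  rewrite (csgB sg); last exact: cR.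
  by rewrite -(csg_law sg (cR d0) c1) -(csg_law sg (cR d0) c2) !e.
have Dg : Dn E 1 g d%:C = Dn E 1 h t%:C - Dn E 1 h t'%:C.
  rewrite (DnB sg); last exact: cR.
  by rewrite (Dn_E sg 1 h (cR d0) c1) (Dn_E sg 1 h (cR d0) c2) !e.
have [v hv] := gen_le (generates_E g d0); rewrite rnormN Eg Dg => hvM.
suff -> : xof h t - xof h t' = v by [].
apply: (@VtoH_inj _ _ _ _ _ _ _ S); rewrite linearB /= !xofE ?(lt_trans d0) //.
by rewrite hv Eg.
Qed.

Lemma xof_cont h t0 (e : R) : 0 < t0 -> 0 < e -> exists2 dl : R, 0 < dl &
  forall s, 0 <= s < dl -> rnorm (xof h (t0 + s) - xof h t0) <= e.
Proof.
move=> t0p e0; have M1 : 0 < `|M| + 1 by rewrite ltr_wpDl.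
have e2 : 0 < e / (2 * (`|M| + 1)) by rewrite divr_gt0 // mulr_gt0.
have [d1 d10 h1] := cderiv_cont (cderiv_E sg h (cR t0p)) e2.
have [d2 d20 h2] := cderiv_cont (cderiv_Dn sg 1 h (cR t0p)) e2.
exists (Num.min d1 d2) => [|s /andP[s0]]; first by rewrite lt_min d10.
rewrite lt_min => /andP[sd1 sd2].
have cs : cabs s%:C = s by rewrite cabsC ger0_norm.
have h0 : 0 < t0 / 2 by rewrite divr_gt0.
have h00 : t0 / 2 < t0 by rewrite ltr_pdivrMr // mulr_natr mulr2n ltrDl.
have h01 : t0 / 2 < t0 + s by apply: (lt_le_trans h00); rewrite lerDl.
apply: (le_trans (xof_dist h h0 h01 h00)).
have k1 : rnorm (E (t0 + s)%:C h - E t0%:C h) < e / (2 * (`|M| + 1)).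
  by rewrite rmorphD /=; apply: h1; rewrite cs.
have k2 : rnorm (Dn E 1 h (t0 + s)%:C - Dn E 1 h t0%:C) < e / (2 * (`|M| + 1)).
  by rewrite rmorphD; apply: h2; rewrite cs.
have MM : M <= `|M| + 1 by have := ler_norm M; lra.
apply: (@le_trans _ _ ((`|M| + 1) * (e / (2 * (`|M| + 1)) + e / (2 * (`|M| + 1))))).
  apply: (le_trans (ler_wpM2r _ MM)); first by rewrite addr_ge0 ?rnorm_ge0.
  by rewrite ler_wpM2l ?(ltW M1) // lerD // ltW.
by rewrite le_eqVlt; apply/orP; left; apply/eqP; field; exact: lt0r_neq0.
Qed.

(** The weak solution from [E(t0) h] has derivative [- A (xof h (t0 + s))] for almost every [s]. Its
    mean over [[0, t]] tends to [- A (xof h t0)] by continuity in [V], and is also the difference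
    quotient of [E(.) h] at [t0]. *)
Lemma A_xof_rpair h t0 phi : 0 < t0 ->
  rpair S (A (xof h t0) + HtoV' S (Dn E 1 h t0%:C)) phi = 0.
Proof.
move=> t0p; have [w hw] := sol_ex (E t0%:C h).
have [_ [w0 [vV [g [_ _ prim aeV aeg]]]]] := hw.
have wE s : 0 <= s -> w s = E (t0 + s)%:C h.
  rewrite le_eqVlt => /orP[/eqP <-|s0]; first by rewrite w0 addr0.
  by rewrite (sol_E hw s0) -(csg_law sg (cR s0) (cR t0p)) addrC rmorphD.
have aeA : {ae mu, forall s, 0 <= s -> g s = - A (xof h (t0 + s))}.
  have [N1 [m1 z1 s1]] := aeV; have [N2 [m2 z2 s2]] := aeg.
  exists (N1 `|` N2); split; [exact: measurableU|exact: null_set_setU|].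
  move=> s /= hs; apply: contrapT => /not_orP[n1 n2]; apply: hs => s0.
  have k1 : VtoH S (vV s) = w s.
    by apply: contrapT => k; apply: n1; apply: s1 => /= /(_ s0).
  have k2 : g s + A (vV s) = 0.
    by apply: contrapT => k; apply: n2; apply: s2 => /= /(_ s0).
  have -> : xof h (t0 + s) = vV s.
    apply: (@VtoH_inj _ _ _ _ _ _ _ S); rewrite k1 wE // xofE //.
    by rewrite ltr_wpDr.
  by apply/eqP; rewrite -addr_eq0 k2.
set c := rpair S (- A (xof h t0)) phi.
set d := Dn E 1 h t0%:C.
have [MA MA0 hMA] := cont_bounded A_cont.
have P1 : 0 < rnorm phi + 1 by rewrite ltr_wpDl ?rnorm_ge0.
have Q1 : 0 < rnorm (VtoH S phi) + 1 by rewrite ltr_wpDl ?rnorm_ge0.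
suff key : forall e : R, 0 < e -> `|rip S d (VtoH S phi) - c| <= e.
  rewrite rpairDl rpair_H -/d; have -> : rpair S (A (xof h t0)) phi = - c.
    by rewrite /c rpairNl opprK.
  apply/eqP; rewrite addrC -normr_eq0 eq_le normr_ge0 andbT.
  by apply/ler_addgt0Pr => e e0; rewrite add0r key.
move=> e e0.
have e1p : 0 < e / 2 / MA / (rnorm phi + 1) by rewrite !divr_gt0.
have e2p : 0 < e / 2 / (rnorm (VtoH S phi) + 1) by rewrite !divr_gt0.
have [d1 d10 h1] := xof_cont h t0p e1p.
have [d2 d20 h2] := cderiv_E sg h (cR t0p) e2p.
pose t := Num.min d1 d2 / 2.
have m0 : 0 < Num.min d1 d2 by rewrite lt_min d10.
have tp : 0 < t by rewrite divr_gt0.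
have tm : t < Num.min d1 d2 by rewrite ltr_pdivrMr // mulr_natr mulr2n ltrDl.
have [td1 td2] : t < d1 /\ t < d2 by move: tm; rewrite lt_min => /andP[].
have boch : is_bochner `[0%R, t]%classic g (HtoV' S (w t) - HtoV' S (w 0)).
  by apply: prim; rewrite /= in_itv /= ltW.
have aec : {ae mu, forall r, 0 <= r <= t -> `|rpair S (g r) phi - c| <= e / 2}.
  have [N [mN zN sN]] := aeA; exists N; split => // r /= hr; apply: sN => /= k; apply: hr.
  move=> /andP[r0 rt]; rewrite k // /c -rpairBl; apply: (le_trans (rpair_le _ _ _)).
  have -> : - A (xof h (t0 + r)) - - A (xof h t0) = - A (xof h (t0 + r) - xof h t0).
    by rewrite linearB /= opprB opprK addrC.
  rewrite rnormN.
  have hr : rnorm (xof h (t0 + r) - xof h t0) <= e / 2 / MA / (rnorm phi + 1).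
    by apply: h1; rewrite r0 (le_lt_trans rt).
  apply: (@le_trans _ _ (MA * (e / 2 / MA / (rnorm phi + 1)) * (rnorm phi + 1))).
    apply: ler_pM; rewrite ?rnorm_ge0 //; last by rewrite lerDl.
    by apply: (le_trans (hMA _)); rewrite ler_wpM2l // ltW.
  rewrite le_eqVlt; apply/orP; left; apply/eqP; field.
  by rewrite !gt_eqF.
have e2' : 0 <= e / 2 by rewrite ltW // divr_gt0.
have := bochner_scalar_bound (ltW tp) e2' boch aec.
rewrite -linearB rpair_H w0 wE ?(ltW tp) // => hb.
have ct : cabs t%:C = t by rewrite cabsC gtr0_norm.
have hder : rnorm (E (t0 + t)%:C h - E t0%:C h - t%:C *: d) <= e / 2 / (rnorm (VtoH S phi) + 1) * t.
  by have := h2 t%:C; rewrite ct rmorphD /= => /(_ td2).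
have hd2 : `|rip S (E (t0 + t)%:C h - E t0%:C h - t%:C *: d) (VtoH S phi)| <= t * (e / 2).
  apply: (le_trans (rip_le _ _ _)).
  apply: (@le_trans _ _ (e / 2 / (rnorm (VtoH S phi) + 1) * t * (rnorm (VtoH S phi) + 1))).
    by apply: ler_pM; rewrite ?rnorm_ge0 // lerDl.
  rewrite le_eqVlt; apply/orP; left; apply/eqP; field.
  by rewrite gt_eqF.
rewrite ripBl ripZl in hd2.
have : `|t * (rip S d (VtoH S phi) - c)| <= t * e.
  move: hb hd2; set a := rip S _ _; set b := rip S d _ => hb hd2.
  have -> : t * (b - c) = (a - t * c) - (a - t * b) by ring.
  by apply: (le_trans (ler_normB _ _)); lra.
by rewrite normrM gtr0_norm // ler_pM2l.
Qed.

Lemma A_xof h t0 : 0 < t0 -> A (xof h t0) = - HtoV' S (Dn E 1 h t0%:C).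
Proof.
move=> t0p; apply/eqP; rewrite -addr_eq0; apply/eqP.
by apply: (rpair_eq0 (S := S)) => phi; exact: A_xof_rpair.
Qed.

(** A small real time is split off: [E(z) h = E(t) E(z - t) h], and the real case applies with
    initial value [E(z - t) h]. *)
Lemma generator_cone h z : C z -> exists2 x : V, VtoH S x = E z h &
  A x = - HtoV' S (Dn E 1 h z).
Proof.
move=> hz; have [dl dl0 hd] := cone_open q0 hz.
set t := dl / 2; have t0 : 0 < t by rewrite divr_gt0.
have hzt : C (z - t%:C).
  by apply: hd; rewrite cabsN cabsC gtr0_norm // ltr_pdivrMr // mulr_natr mulr2n ltrDl.
exists (xof (E (z - t%:C) h) t).
  by rewrite xofE // -(csg_law sg (cR t0) hzt) addrC subrK.
by rewrite A_xof // (Dn_E sg 1 h (cR t0) hzt) [t%:C + _]addrC subrK.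
Qed.

End GeneratorInCone.

(** * Energy estimates *)

Section Sector.
Context {R : realType}.

(** This is [cos (acos q + acos lambda^-1)], the worst cosine of [arg (z a)] for [z] in the cone and
    [a] a value of the sectorial form. *)
Definition coercivity (q lambda : R) : R :=
  (q - Num.sqrt (1 - q ^+ 2) * Num.sqrt (lambda ^+ 2 - 1)) / lambda.

Lemma Im_le (z : R[i]) (s : R) : 0 <= s -> s <= 1 -> s * cabs z <= complex.Re z ->
  `|complex.Im z| <= Num.sqrt (1 - s ^+ 2) * cabs z.
Proof.
move=> s0 s1 hs; have z0 := cabs_ge0 z.
have s2 : 0 <= 1 - s ^+ 2 by rewrite subr_ge0 exprn_ile1.
rewrite -(@ler_pXn2r _ 2) ?nnegrE ?mulr_ge0 ?sqrtr_ge0 //.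
rewrite exprMn sqr_sqrtr // -normrX ger0_norm ?sqr_ge0 //.
have := cabs_sqr z.
have : (s * cabs z) ^+ 2 <= complex.Re z ^+ 2.
  by rewrite ler_pXn2r // ?nnegrE ?mulr_ge0 // (le_trans _ hs) // mulr_ge0.
rewrite exprMn; lra.
Qed.

Lemma coercivityP (q lambda : R) (z a : R[i]) : 0 <= q <= 1 -> 1 <= lambda ->
  0 <= coercivity q lambda ->
  cone q z -> cabs a <= lambda * complex.Re a ->
  coercivity q lambda * (cabs z * cabs a) <= complex.Re (z * a).
Proof.
move=> /andP[q0 q1] l1 c0 hz ha.
have l0 : 0 < lambda by lra.
have hI := Im_le q0 q1 (ltW hz).
have a0 := cabs_ge0 a; have z0 := cabs_ge0 z.
have l2 : 0 <= lambda ^+ 2 - 1 by rewrite subr_ge0 expr_ge1 // ltW.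
have ra : 0 <= complex.Re a.
  by rewrite -(pmulr_rge0 _ l0); exact: le_trans ha.
have hA : `|complex.Im a| <= Num.sqrt (lambda ^+ 2 - 1) * complex.Re a.
  rewrite -(@ler_pXn2r _ 2) ?nnegrE ?mulr_ge0 ?sqrtr_ge0 //.
  rewrite exprMn sqr_sqrtr // -normrX ger0_norm ?sqr_ge0 //.
  have := cabs_sqr a.
  have : cabs a ^+ 2 <= (lambda * complex.Re a) ^+ 2.
    by rewrite ler_pXn2r // ?nnegrE // mulr_ge0 // ltW.
  rewrite exprMn; lra.
have -> : complex.Re (z * a) = complex.Re z * complex.Re a - complex.Im z * complex.Im a.
  by case: (z) (a) => ? ? [].
have hII : complex.Im z * complex.Im a <=
    (Num.sqrt (1 - q ^+ 2) * cabs z) * (Num.sqrt (lambda ^+ 2 - 1) * complex.Re a).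
  by apply: (le_trans (ler_norm _)); rewrite normrM ler_pM.
have hRR : q * cabs z * complex.Re a <= complex.Re z * complex.Re a.
  by rewrite ler_wpM2r // ltW.
apply: (@le_trans _ _ (coercivity q lambda * (cabs z * (lambda * complex.Re a)))).
  by rewrite ler_wpM2l // ler_wpM2l.
have -> : coercivity q lambda * (cabs z * (lambda * complex.Re a)) =
  q * cabs z * complex.Re a -
  (Num.sqrt (1 - q ^+ 2) * cabs z) * (Num.sqrt (lambda ^+ 2 - 1) * complex.Re a).
  by rewrite /coercivity; field; exact: lt0r_neq0.
lra.
Qed.

End Sector.

Section Form.
Context {R : realType} {V H V' D W X : completeNormedModType R[i]}.
Variable S : spaces V H V' D W X.
Variables (A : {linear V -> V'}) (z : R[i]) (c : R).
Hypothesis c0 : 0 < c.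

Definition form (x y : V) : R[i] := z * pairing S (A x) y.
Definition qform (x : V) : R := complex.Re (form x x).

Hypothesis coercive : forall x, c * cabs (form x x) <= qform x.

Lemma qform_ge0 x : 0 <= qform x.
Proof. by apply: le_trans (coercive x); rewrite mulr_ge0 ?cabs_ge0 // ltW. Qed.

Lemma formDl x1 x2 y : form (x1 + x2) y = form x1 y + form x2 y.
Proof. by rewrite /form linearD linearDl mulrDr. Qed.

Lemma formDr x y1 y2 : form x (y1 + y2) = form x y1 + form x y2.
Proof. by rewrite /form linearDr mulrDr. Qed.

Lemma formZl a x y : form (a *: x) y = a * form x y.
Proof. by rewrite /form linearZ linearZl_LR /= mulrCA. Qed.

Lemma formZr a x y : form x (a *: y) = conjC a * form x y.
Proof. by rewrite /form linearZr_LR /= mulrCA. Qed.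

Lemma formNl x y : form (- x) y = - form x y.
Proof. by rewrite -scaleN1r formZl mulN1r. Qed.

Lemma formNr x y : form x (- y) = - form x y.
Proof. by rewrite -scaleN1r formZr rmorphN1 mulN1r. Qed.

Lemma polarization x y :
  4%:R * form x y = (form (x + y) (x + y) - form (x - y) (x - y))
    + 'i * (form (x + 'i *: y) (x + 'i *: y) - form (x - 'i *: y) (x - 'i *: y)).
Proof.
have ii : 'i * 'i = -1 :> R[i] by rewrite -expr2 sqr_i.
have ci : conjC 'i = - 'i :> R[i] by apply/eqP; rewrite eq_complex /= oppr0 !eqxx.
rewrite !formDl !formDr !formNl !formNr !formZl !formZr ci.
ring: ii.
Qed.

(** The form need not be Hermitian, so polarization replaces Cauchy-Schwarz: coercivity bounds the
    four diagonal values, and the parallelogram identity sums them. *)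
Lemma form_le x y : cabs (form x y) <= c^-1 * (qform x + qform y).
Proof.
have hs w : cabs (form w w) <= c^-1 * qform w.
  by rewrite mulrC ler_pdivlMr // mulrC; exact: coercive.
have ci : cabs ('i : R[i]) = 1.
  by rewrite /cabs normc_def /= expr0n expr1n add0r sqrtr1.
have qZ a w : cabs a = 1 -> qform (a *: w) = qform w.
  move=> a1; rewrite /qform formZl formZr mulrA -normCK.
  by rewrite -cabsE a1 expr1n mul1r.
have par v w : qform (v + w) + qform (v - w) = 2 * (qform v + qform w).
  rewrite /qform !formDl !formDr !formNl !formNr opprK.
  rewrite !raddfD !raddfN /=; lra.
have k1 := par x y; have k2 := par x ('i *: y); rewrite qZ // in k2.
have c4 : cabs (4%:R * form x y) = 4 * cabs (form x y).
  rewrite cabsM; congr (_ * _); have -> : 4%:R = (4%:R : R)%:C by rewrite rmorph_nat.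
  by rewrite cabsC ger0_norm.
have : cabs (4%:R * form x y) <= cabs (form (x + y) (x + y)) + cabs (form (x - y) (x - y)) +
   (cabs (form (x + 'i *: y) (x + 'i *: y)) + cabs (form (x - 'i *: y) (x - 'i *: y))).
  rewrite polarization; apply: (le_trans (cabsD _ _)); apply: lerD.
    by apply: (le_trans (cabsD _ _)); rewrite cabsN.
  by rewrite cabsM ci mul1r; apply: (le_trans (cabsD _ _)); rewrite cabsN.
rewrite c4; have := hs (x + y); have := hs (x - y).
have := hs (x + 'i *: y); have := hs (x - 'i *: y).
have ic : 0 <= c^-1 by rewrite invr_ge0 ltW.
have e1 : c^-1 * qform (x + y) + c^-1 * qform (x - y) = c^-1 * (2 * (qform x + qform y)).
  by rewrite -mulrDr k1.
have e2 : c^-1 * qform (x + 'i *: y) + c^-1 * qform (x - 'i *: y) = c^-1 * (2 * (qform x + qform y)).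
  by rewrite -mulrDr k2.
lra.
Qed.

Lemma form_young x y (s : R) : 0 <= s ->
  s * `|complex.Re (form x y)| <= (c^-1) ^+ 2 * qform x + s ^+ 2 * qform y.
Proof.
move=> s0; set mu := Num.sqrt c^-1.
have ic : 0 < c^-1 by rewrite invr_gt0.
have mu0 : 0 < mu by rewrite sqrtr_gt0.
have mu2 : mu ^+ 2 = c^-1 by rewrite sqr_sqrtr // ltW.
(* These scalings leave [s * form x y]; the choice [mu^2 = c^-1] produces the weights [c^-2] and
   [s^2]. *)
have := form_le (mu%:C *: x) ((s / mu)%:C *: y).
have qR (a : R) w : qform (a%:C *: w) = a ^+ 2 * qform w.
  by rewrite /qform formZl formZr conjC_real !Re_realM mulrA -expr2.
rewrite !qR formZl formZr conjC_real mulrA -rmorphM /= [mu * _]mulrC divfK ?gt_eqF //.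
rewrite cabsM cabsC ger0_norm // expr_div_n mu2 invrK.
have := abs_Re_le (form x y) => h1 h2.
apply: (le_trans (ler_wpM2l s0 h1)); apply: (le_trans h2).
rewrite le_eqVlt; apply/orP; left; apply/eqP; field; exact: lt0r_neq0.
Qed.

End Form.

Section Energy.
Context {R : realType} {V H V' D W X : completeNormedModType R[i]}.
Variable S : spaces V H V' D W X.
Variables (A : {linear V -> V'}) (q lambda : R) (E : R[i] -> H -> H).
Hypothesis sg : csg q E.
Hypothesis generator : forall h z, cone q z ->
  exists2 x, VtoH S x = E z h & A x = - HtoV' S (Dn E 1 h z).
Hypothesis lambda1 : 1 <= lambda.
Hypothesis sectorial : forall v,
  cabs (pairing S (A v) v) <= lambda * complex.Re (pairing S (A v) v).
Local Notation c := (coercivity q lambda).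
Hypothesis c0 : 0 < c.
Local Notation C := (cone q).

Let q0 : 0 <= q. Proof. by case/andP: (csg_q sg). Qed.
Let q1 : q < 1. Proof. by case/andP: (csg_q sg). Qed.

Lemma form_coercive z x : C z -> c * cabs (form S A z x x) <= qform S A z x.
Proof.
move=> hz; rewrite /form cabsM; apply: coercivityP => //; last exact: ltW.
by rewrite q0 ltW.
Qed.

Lemma rip_generator z g k x y : HtoV' S g = - (A x) -> VtoH S y = k ->
  rip S (z *: g) k = - complex.Re (form S A z x y).
Proof.
move=> hg <-; rewrite -rpair_H linearZ /= hg scalerN rpairNl.
by rewrite /rpair linearZl_LR.
Qed.

Lemma is_derive_orbit n h w z s : C (w + s%:C * z) ->
  is_derive s 1 (fun s => rnorm (Dn E n h (w + s%:C * z)) ^+ 2)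
    (2 * rip S (z *: Dn E n.+1 h (w + s%:C * z)) (Dn E n h (w + s%:C * z))).
Proof.
by move=> hs; apply: rderiv_sqr; apply: cderiv_line; exact: (cderiv_Dn sg).
Qed.

Lemma cone_segment w z (s : R) : C w -> C z -> 0 <= s -> C (w + s%:C * z).
Proof.
move=> hw hz; rewrite le_eqVlt => /orP[/eqP <-|s0]; first by rewrite mul0r addr0.
by apply: coneD => //; exact: coneZ.
Qed.

(** Along [t + s z] the squared norm has derivative [-2 qform], which is nonpositive. The path
    starts at [t > 0] because 0 is not in the cone; then [t] tends to 0. *)
Lemma E_contraction z h : C z -> rnorm (E z h) <= rnorm h.
Proof.
move=> hz.
have step (t : R) : 0 < t -> rnorm (E (t%:C + z) h) <= rnorm (E t%:C h).
  move=> t0; have ht : C t%:C by exact: cone_real.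
  have hC (s : R) : 0 <= s <= 1 -> C (t%:C + s%:C * z) by move=> /andP[s0 _]; exact: cone_segment.
  have := @mvt_le _ (fun s => rnorm (Dn E 0 h (t%:C + s%:C * z)) ^+ 2) _ 0 1 0 ler01
    (fun s hs => is_derive_orbit 0 h (hC s hs)).
  rewrite mul0r mul1r mul0r addr0 subr_le0 => hle.
  rewrite -(@ler_pXn2r _ 2) ?nnegrE ?rnorm_ge0 //; apply: hle => s /hC hs.
  have [x hx hAx] := generator h hs.
  rewrite /Dn -/(Dn E 1 h) (rip_generator z (x := x) (y := x)) //; last first.
    by rewrite hAx opprK.
  by rewrite mulrN oppr_le0 mulr_ge0 // (qform_ge0 c0) // => y; exact: form_coercive.
apply/ler_addgt0Pr => e e0; have e2 : 0 < e / 2 by rewrite divr_gt0.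
have [d1 d10 h1] := csg_cont0 sg h e2.
have [d2 d20 h2] := cderiv_cont (cderiv_E sg h hz) e2.
set t := Num.min d1 d2 / 2.
have m0 : 0 < Num.min d1 d2 by rewrite lt_min d10.
have t0 : 0 < t by rewrite divr_gt0.
have : t < Num.min d1 d2 by rewrite ltr_pdivrMr // mulr_natr mulr2n ltrDl.
rewrite lt_min => /andP[td1 td2].
have := h1 t; rewrite t0 td1 => /(_ isT) k1.
have := h2 t%:C; rewrite cabsC gtr0_norm // => /(_ td2) k2.
have k3 := step t t0; rewrite [t%:C + z]addrC in k3.
have := rnorm_dist_le (E z h) (E (z + t%:C) h); rewrite rdistC.
have := rnorm_dist_le (E t%:C h) h.
lra.
Qed.

(* G(s) = s^2 |w(s)|^2 + c^-2 |v(s)|^2 decreases along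
   v(s) = E(z/2 + s z) h, w = v'. *)
Lemma E1_bound z h : C z -> rnorm (Dn E 1 h z) <= 2 / c / cabs z * rnorm h.
Proof.
move=> hz; have hz2 := cone_half hz; set z2 := (2^-1)%:C * z in hz2.
(* The path runs from [z / 2] to [z]. At [s = 0] the weight [s^2] removes the derivative, so the
   contraction bounds [G 0]. *)
pose G s := s ^+ 2 * (cabs z ^+ 2 * rnorm (Dn E 1 h (z2 + s%:C * z)) ^+ 2)
   + (c^-1) ^+ 2 * rnorm (Dn E 0 h (z2 + s%:C * z)) ^+ 2.
pose v s := Dn E 0 h (z2 + s%:C * z).
pose w s := Dn E 1 h (z2 + s%:C * z).
pose w' s := Dn E 2 h (z2 + s%:C * z).
have hC (s : R) : 0 <= s <= 2^-1 -> C (z2 + s%:C * z).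
  by move=> /andP[s0 _]; exact: cone_segment.
have dG (s : R) : 0 <= s <= 2^-1 -> is_derive s 1 G
   (2 * s * (cabs z ^+ 2 * rnorm (w s) ^+ 2)
    + s ^+ 2 * (cabs z ^+ 2 * (2 * rip S (z *: w' s) (w s)))
    + (c^-1) ^+ 2 * (2 * rip S (z *: w s) (v s))).
  move=> hs; have D1 := is_derive_orbit 0 h (hC s hs).
  have D2 := is_derive_orbit 1 h (hC s hs).
  rewrite /G; apply: is_derive_eq.
  rewrite /v /w /w' /GRing.scale /=; ring.
have hle : G 2^-1 - G 0 <= 0 * (2^-1 - 0).
  apply: (mvt_le _ dG) => [|s hs]; first by rewrite invr_ge0.
  have hw := hC s hs; have hw2 := cone_half hw.
  have [x hx hAx] := generator h hw.
  have [y hy hAy] := generator (Dn E 1 h ((2^-1)%:C * (z2 + s%:C * z))) hw2.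
  rewrite -(Dn_add sg) // half_add in hy.
  rewrite -(DnS_add sg) // half_add in hAy.
  have s0 : 0 <= s by case/andP: hs.
  have co u := form_coercive u hz.
  have gx : HtoV' S (w s) = - A x by rewrite hAx opprK.
  have gy : HtoV' S (w' s) = - A y by rewrite hAy opprK.
  have e1 : rip S (z *: w s) (v s) = - qform S A z x by exact: rip_generator.
  have e2 : rip S (z *: w' s) (w s) = - qform S A z y by exact: rip_generator.
  have e3 : cabs z ^+ 2 * rnorm (w s) ^+ 2 = - complex.Re (form S A z x (z *: y)).
    by rewrite -exprMn -rnormZ -(rip_sqr S); apply: rip_generator; rewrite // linearZ /= hy.
  have e4 : qform S A z (z *: y) = cabs z ^+ 2 * qform S A z y.
    by rewrite /qform formZl formZr mulrA -normCK -cabsE -rmorphXn Re_realM.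
  (* The only positive term, [2 s |z|^2 |w|^2], equals [-2 s Re form(x, z y)]; this inequality
     absorbs it into the two dissipation terms. *)
  have := form_young c0 co x (z *: y) s0; rewrite e1 e2 e3 e4 => hy2.
  have := ler_norm (- complex.Re (form S A z x (z *: y))); rewrite normrN => hn.
  have := ler_wpM2l s0 hn; move: hy2.
  set f := complex.Re _; set f' := `|f|; set a := qform _ _ _ x; set b := qform _ _ _ y.
  set cc := c^-1 ^+ 2; set cz := cabs z ^+ 2; lra.
move: hle; rewrite mul0r subr_le0 /G mul0r addr0 expr0n /= mul0r add0r.
have -> : z2 + (2^-1)%:C * z = z by exact: half_add.
have hc := E_contraction h hz2; move=> hle.
have cz : 0 < cabs z by rewrite cabs_gt0; exact: cone_neq0 hz.
have key : (2^-1 * (cabs z * rnorm (Dn E 1 h z))) ^+ 2 <= (c^-1 * rnorm h) ^+ 2.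
  rewrite !exprMn; apply: (@le_trans _ _ (c^-1 ^+ 2 * rnorm (E z2 h) ^+ 2)).
    by apply: le_trans hle; rewrite lerDl mulr_ge0 // sqr_ge0.
  by rewrite ler_wpM2l ?sqr_ge0 // ler_pXn2r ?nnegrE ?rnorm_ge0.
have ic : 0 <= c^-1 by rewrite invr_ge0 ltW.
rewrite ler_pXn2r ?nnegrE ?mulr_ge0 ?rnorm_ge0 ?invr_ge0 ?(ltW cz) // in key.
rewrite mulrAC ler_pdivlMr // mulrC; have := ler_wpM2l (ler0n R 2) key.
by rewrite mulrA divff // mul1r mulrA.
exact: ltW.
Qed.

End Energy.

(** * The angle of analyticity *)

Section SectorCone.
Context {R : realType}.

Lemma ratio_bounds (z : R[i]) : -1 <= complex.Re z / cabs z <= 1.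
Proof.
have [->|zn] := eqVneq (cabs z) 0; first by rewrite invr0 mulr0 lerN10 ler01.
have c0 : 0 < cabs z by rewrite lt_neqAle eq_sym zn cabs_ge0.
by rewrite -ler_norml normrM normfV (gtr0_norm c0) ler_pdivrMr // mul1r abs_Re_le.
Qed.

Lemma absarg_ge0 (z : R[i]) : 0 <= absarg z.
Proof. exact/acos_ge0/ratio_bounds. Qed.

Lemma absarg_lt (z : R[i]) (t : R) : 0 <= t <= pi ->
  (absarg z < t) = (cos t < complex.Re z / cabs z).
Proof.
move=> ht; have hb := ratio_bounds z.
rewrite -[X in _ = (_ < X)]acosK ?in_itv //= ltr_cos ?in_itv //=.
by rewrite acos_ge0 // acos_lepi.
Qed.

Lemma sectorP (phi : R) (z : R[i]) : 0 < phi <= pi / 2 -> sector phi z <-> cone (cos phi) z.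
Proof.
move=> /andP[p0 p2]; have pp : 0 <= phi <= pi.
  by rewrite ltW //= (le_trans p2) // ler_pdivrMr // ler_peMr ?pi_ge0 // ler1n.
split=> [[zn]|hz].
  by rewrite absarg_lt // ltr_pdivlMr // cabs_gt0.
have zn : z != 0 by exact: cone_neq0 hz.
by split=> //; rewrite absarg_lt // ltr_pdivlMr // cabs_gt0.
Qed.

Lemma absarg_le_pihalf (z : R[i]) : 0 <= complex.Re z -> absarg z <= pi / 2.
Proof.
move=> hz; rewrite leNgt; apply/negP => h.
have hb := ratio_bounds z.
have : cos (absarg z) < cos (pi / 2).
  rewrite ltr_cos ?in_itv //=; last by rewrite acos_ge0 // acos_lepi.
  by rewrite divr_ge0 ?pi_ge0 //= ler_pdivrMr // ler_peMr ?pi_ge0 // ler1n.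
rewrite cos_pihalf acosK ?in_itv //= => hlt.
have : 0 <= complex.Re z / cabs z by rewrite divr_ge0 ?cabs_ge0.
by rewrite leNgt hlt.
Qed.

(** The condition that [z + r |z|] lies in the cone of [q], solved for [Re z / |z|] after dropping
    the cross term of [(Re z + r |z|)^2]. Truncation at 0 keeps the new angle within [pi / 2]. *)
Definition widened (q r : R) : R := Num.sqrt (Num.max 0 (q ^+ 2 - r ^+ 2 * (1 - q ^+ 2))).

Lemma widened_lt (q r : R) : 0 < q < 1 -> 0 < r -> widened q r < q.
Proof.
move=> /andP[q0 q1] r0; rewrite -[ltRHS](ger0_norm (ltW q0)) -sqrtr_sqr ltr_sqrt ?exprn_gt0 //.
rewrite gt_max exprn_gt0 //= ltrBlDr ltrDl mulr_gt0 ?exprn_gt0 // subr_gt0.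
by rewrite expr_lt1 // ltW.
Qed.

Lemma widened_cone (q r : R) z : 0 < q < 1 -> 0 < r ->
  cone (widened q r) z -> cone q (z + (r * cabs z)%:C).
Proof.
move=> /andP[q0 q1] r0 hz; have p0 := cabs_ge0 z; have cz := cabs_sqr z.
have w0 : 0 <= widened q r by exact: sqrtr_ge0.
have x0 : 0 < complex.Re z by apply: le_lt_trans hz; rewrite mulr_ge0.
have hm : widened q r ^+ 2 * cabs z ^+ 2 < complex.Re z ^+ 2.
  by rewrite -exprMn ltr_pXn2r // ?nnegrE ?mulr_ge0 // ltW.
have hw : q ^+ 2 - r ^+ 2 * (1 - q ^+ 2) <= widened q r ^+ 2.
  by rewrite sqr_sqrtr ?le_max ?lexx ?orbT.
have X0 : 0 <= complex.Re z + r * cabs z.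
  by apply: addr_ge0; [exact: ltW|apply: mulr_ge0 => //; exact: ltW].
have e1 : complex.Re (z + (r * cabs z)%:C) = complex.Re z + r * cabs z by rewrite ReD.
have e2 : complex.Im (z + (r * cabs z)%:C) = complex.Im z by rewrite raddfD /= addr0.
rewrite /cone e1 -(@ltr_pXn2r _ 2) ?nnegrE ?mulr_ge0 ?cabs_ge0 ?(ltW q0) //.
rewrite exprMn cabs_sqr e1 e2.
have q2 : q ^+ 2 < 1 by rewrite expr_lt1 // ltW.
move: cz hm hw; set x := complex.Re z; set y := complex.Im z; set p := cabs z.
move=> cz hm hw.
have hm2 := ler_wpM2r (sqr_ge0 p) hw.
have hX : x ^+ 2 + r ^+ 2 * p ^+ 2 <= (x + r * p) ^+ 2.
  have : 0 <= x * (r * p).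
    by apply: mulr_ge0; [exact: ltW|apply: mulr_ge0 => //; exact: ltW].
  rewrite -exprMn sqrrD; lra.
have q3 : 0 <= 1 - q ^+ 2 by rewrite subr_ge0 ltW.
have := ler_wpM2l q3 hX; move: hm2 cz hm.
set X := (x + r * p) ^+ 2; set x2 := x ^+ 2; set y2 := y ^+ 2; set p2 := p ^+ 2.
set Q := q ^+ 2; set r2 := r ^+ 2 => h1 h2 h3.
have -> : y2 = p2 - x2 by rewrite h2 addrC addKr.
lra.
Qed.

End SectorCone.

Section Conversion.
Context {R : realType} {H : completeNormedModType R[i]}.

Lemma bas_csg (phi : R) (E : R[i] -> H -> H) : 0 < phi <= pi / 2 ->
  bounded_analytic_semigroup phi E -> csg (cos phi) E.
Proof.
move=> hp bas; have [p0 p2] := andP hp; have sc z := sectorP z hp.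
have q1 : cos phi < 1.
  rewrite -cos0 ltr_cos ?in_itv //= ?lexx ?pi_ge0 // (ltW p0) (le_trans p2) //.
  by rewrite ler_pdivrMr // ler_peMr ?pi_ge0 // ler1n.
split.
- rewrite q1 andbT cos_ge0_pihalf // p2 andbT (le_trans _ (ltW p0)) // oppr_le0.
  by rewrite divr_ge0 ?pi_ge0.
- by move=> z /sc; exact: bas_linear bas _.
- by move=> z w /sc hz /sc hw; exact: (@bas_law _ _ _ _ bas z w hz hw).
- by move=> h z /sc hz; exact: (derivable_cderiv (@bas_holo _ _ _ _ bas h z hz)).
- move=> z /sc[zn az]; have a0 := absarg_ge0 z.
  (* Bounds are available on strictly smaller sectors; an angle halfway between that of [z] and
     [phi] gives one that contains [z]. *)
  have := @bas_bounded _ _ _ _ bas ((absarg z + phi) / 2).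
  case=> [|M hM]; first by apply/andP; split; lra.
  by exists M => h; apply: hM; split=> //; lra.
- move=> h e e0; have hp2 : 0 < phi / 2 < phi by apply/andP; split; lra.
  have hq : 0 < phi / 2 <= pi / 2 by apply/andP; split; lra.
  have /cvg_rnormP/(_ e e0) := @bas_cont0 _ _ _ _ bas _ hp2 h.
  move=> /nbhs_rnormP[dl dl0 hd]; exists dl => // t /andP[t0 td].
  apply: hd; first by rewrite subr0; rewrite -[rnorm _]/(cabs t%:C) cabsC gtr0_norm.
  apply/(sectorP _ hq); apply: cone_real => //.
  suff : cos (phi / 2) < cos 0 by rewrite cos0.
  have := pi_ge0 R => pi0; case/andP: hp2 => h0 h1.
  by rewrite ltr_cos // in_itv /= ?lexx //; apply/andP; split; lra.
Qed.

Lemma csg_bas (q M : R) (E : R[i] -> H -> H) : csg q E ->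
  (forall z h, cone q z -> rnorm (E z h) <= M * rnorm h) ->
  (forall h (e : R), 0 < e -> exists2 dl : R, 0 < dl &
    forall z, cone q z -> cabs z < dl -> rnorm (E z h - h) < e) ->
  bounded_analytic_semigroup (acos q) E.
Proof.
move=> sg bd c0; have /andP[q0 q1] := csg_q sg.
have qb : -1 <= q <= 1 by rewrite (ltW q1) (le_trans _ q0) // lerN10.
have hp : 0 < acos q <= pi / 2.
  rewrite acos_gt0 /=; last by rewrite q1 (le_trans _ q0) // lerN10.
  rewrite leNgt; apply/negP => h; have : cos (acos q) < cos (pi / 2).
    rewrite ltr_cos ?in_itv //=; last by rewrite acos_ge0 // acos_lepi.
    by have := pi_ge0 R; move=> ?; apply/andP; split; lra.
  by rewrite cos_pihalf acosK ?in_itv // ltNge q0.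
have sc z : sector (acos q) z <-> cone q z.
  by rewrite -[X in cone X](acosK (x := q)) ?in_itv //; exact: sectorP.
have sW (psi : R) z : psi < acos q -> sector psi z -> cone q z.
  by move=> hpsi [zn az]; apply/sc; split=> //; exact: lt_trans hpsi.
split.
- by move=> z /sc; exact: csg_lin sg _.
- by move=> z w /sc hz /sc hw; exact: (csg_law sg).
- by move=> h z /sc hz; have [d /cderiv_derivable] := csg_deriv sg h hz.
- by move=> psi /andP[_ hpsi]; exists M => z /(sW _ _ hpsi) hz h; exact: bd.
- move=> psi /andP[_ hpsi] h; apply/cvg_rnormP => e e0.
  have [dl dl0 hd] := c0 h e e0.
  apply/nbhs_rnormP; exists dl => // z; rewrite subr0 => hz /(sW _ _ hpsi) hzz.
  exact: hd.
Qed.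

End Conversion.

Section Angle.
Context {R : realType} {V H V' D W X : completeNormedModType R[i]}.
Variable S : spaces V H V' D W X.

(** The angle [phi + acos lambda^-1] stays below [pi / 2]; after squaring this is
    [(sin phi * lambda)^2 < 1]. *)
Lemma coercivity_gt0 (lambda phi : R) : 1 <= lambda -> 0 < phi < pi / 2 ->
  sin phi < lambda^-1 -> 0 < coercivity (cos phi) lambda.
Proof.
move=> l1 /andP[p0 p2] hs; have l0 : 0 < lambda by lra.
have pp := pi_ge0 R.
have s0 : 0 <= sin phi by apply: sin_ge0_pi; apply/andP; split; lra.
have c0 : 0 < cos phi by apply: cos_gt0_pihalf; apply/andP; split; lra.
have sc := cos2Dsin2 phi.
have l2 : 0 <= lambda ^+ 2 - 1 by rewrite subr_ge0 expr_ge1 // ltW.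
have -> : coercivity (cos phi) lambda =
   (cos phi - sin phi * Num.sqrt (lambda ^+ 2 - 1)) / lambda.
  by rewrite /coercivity -sin2cos2 sqrtr_sqr ger0_norm.
rewrite divr_gt0 // subr_gt0 -(@ltr_pXn2r _ 2) ?nnegrE ?mulr_ge0 ?sqrtr_ge0 ?(ltW c0) //.
rewrite exprMn sqr_sqrtr //.
have hl : sin phi * lambda < 1 by rewrite -ltr_pdivlMr // div1r.
have : (sin phi * lambda) ^+ 2 < 1 by rewrite expr_lt1 // mulr_ge0 // ltW.
rewrite exprMn; lra.
Qed.

(** The derivative bound holds with [K = 2 / coercivity] on the whole open sector, so the extension
    ratio does not degenerate towards the boundary and the cone widens. *)
Lemma analyticity_extends (A : {linear V -> V'}) (M lambda phi : R) :
  continuous A -> (forall v0, exists v, is_solution S A v0 v) ->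
  (forall h y, generates S A h y ->
    exists2 v, VtoH S v = h & rnorm v <= M * (rnorm h + rnorm y)) ->
  1 <= lambda ->
  (forall v, cabs (pairing S (A v) v) <= lambda * complex.Re (pairing S (A v) v)) ->
  0 < phi < pi / 2 -> sin phi < lambda^-1 -> extends_analytically S A phi ->
  exists2 psi, phi < psi <= pi / 2 & extends_analytically S A psi.
Proof.
move=> Ac ex gl l1 sect hp hs [E [bas solE]].
have hp' : 0 < phi <= pi / 2 by case/andP: hp => -> /ltW.
have sg := bas_csg hp' bas; set q := cos phi in sg.
have cg := coercivity_gt0 l1 hp hs.
have gen := generator_cone Ac sg solE ex gl.
have contr z h (hz : cone q z) := E_contraction sg gen l1 sect cg h hz.
have K0 : 0 <= 2 / coercivity q lambda by rewrite divr_ge0 // ltW.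
have E1_le z h (hz : cone q z) := E1_bound sg gen l1 sect cg h hz.
have pp := pi_ge0 R; have [p0 p2] := andP hp.
have q0 : 0 < q by apply: cos_gt0_pihalf; apply/andP; split; lra.
have q01 : 0 < q < 1 by rewrite q0; case/andP: (csg_q sg).
have r0 : 0 < ext_ratio (2 / coercivity q lambda) by exact: ext_ratio_gt0.
set r := ext_ratio _ in r0; have w0 : 0 <= widened q r by exact: sqrtr_ge0.
have wq := widened_lt q01 r0.
have wd z := @widened_cone _ q r z q01 r0.
have sg' := Eext_csg S sg q0 contr K0 E1_le w0 (ltW wq) wd.
have bd z h := @Eext_bounded _ _ _ _ _ _ _ S _ _ _ sg q0 contr K0 E1_le _ w0 wd z h.
have c0 h (e : R) := @Eext_cont0 _ _ _ _ _ _ _ S _ _ _ sg q0 contr K0 E1_le _ w0 wd h e.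
have wb : -1 <= widened q r <= 1.
  by case/andP: q01 => _ q1; apply/andP; split; lra.
have basE := csg_bas sg' bd c0.
exists (acos (widened q r)).
  have ab : 0 <= acos (widened q r) <= pi by rewrite acos_ge0 // acos_lepi.
  apply/andP; split.
    rewrite -ltr_cos ?in_itv //=; last by apply/andP; split; lra.
    by rewrite acosK ?in_itv.
  rewrite leNgt; apply/negP => h.
  have : cos (acos (widened q r)) < cos (pi / 2).
    by rewrite ltr_cos ?in_itv //=; apply/andP; split; lra.
  by rewrite cos_pihalf acosK ?in_itv // ltNge w0.
exists (Eext q E); split=> // v0 v hv t t0; rewrite (solE _ _ hv) //.
have ct : cone q t%:C by apply: cone_real => //; case/andP: q01.
by symmetry; exact: (Eext_E S sg q0 contr K0 E1_le _ ct).
Qed.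

(** [sin phi < lambda^-1] means [phi < pi / 2 - acos lambda^-1]; below that threshold the attained
    maximal angle could be enlarged, against its being a supremum. *)
Lemma analyticity_angle_ge (A : {linear V -> V'}) (M lambda : R) :
  continuous A -> (forall v0, exists v, is_solution S A v0 v) ->
  (forall h y, generates S A h y ->
    exists2 v, VtoH S v = h & rnorm v <= M * (rnorm h + rnorm y)) ->
  1 <= lambda ->
  (forall v, cabs (pairing S (A v) v) <= lambda * complex.Re (pairing S (A v) v)) ->
  0 < analyticity_angle S A <= pi / 2 ->
  extends_analytically S A (analyticity_angle S A) ->
  pi / 2 - acos lambda^-1 <= analyticity_angle S A.
Proof.
move=> Ac ex gl l1 sect hp ext; rewrite leNgt; apply/negP => hlt.
set phi := analyticity_angle S A in hp ext hlt.
have pp := pi_ge0 R; have /andP[p0 p2] := hp.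
have l0 : 0 < lambda by lra.
have lb : -1 <= lambda^-1 <= 1.
  by rewrite invf_le1 // l1 andbT (le_trans (lerN10 R)) // invr_ge0 ltW.
have ab := acos_ge0 lb.
have hp' : 0 < phi < pi / 2 by apply/andP; split; lra.
have hs : sin phi < lambda^-1.
  rewrite -cosBpihalf -cosN opprB -[ltRHS]acosK ?in_itv //.
  have ap := acos_lepi lb.
  by rewrite ltr_cos ?in_itv //=; try (apply/andP; split); lra.
have [psi /andP[h1 h2] hpsi] := analyticity_extends Ac ex gl l1 sect hp' hs ext.
have : psi <= phi.
  apply: ub_le_sup; first by exists (pi / 2) => x [/andP[]].
  by split=> //; rewrite h2 (lt_trans p0).
by rewrite leNgt h1.
Qed.

End Angle.

(** * Stability angles of the BDF methods and the condition in (A2) *)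

Section BDFAngle.
Context {R : realType}.

(** It suffices that the generating polynomial has nonnegative real part on the unit disc. For
    [k = 2], eliminating [Im z] by [|z| <= 1] leaves the lower bound [(1 - Re z)^2]. *)
Lemma alpha_ge (k : nat) : (0 < k <= 2)%N -> pi / 2 <= @alpha R k.
Proof.
move=> hk; apply: ub_le_sup; first by exists (pi / 2) => x [/andP[]].
split; first by rewrite lexx andbT divr_gt0 ?pi_gt0.
move=> z hz _; have -> : (pi - pi / 2 : R) = pi / 2 by lra.
apply: absarg_le_pihalf.
have cz : cabs z <= 1 by rewrite -lecR cabsE.
have rz := Re_le_cabs z.
case: k hk => [|[|[|//]]] // _; rewrite /bdf_delta.
  rewrite big_nat1 invr1 mul1r expr1 !hornerE /= raddfB /=; lra.
rewrite big_nat_recr //= big_nat1 invr1 mul1r expr1 !hornerE.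
have -> : (2%:R^-1 : R[i]) = (2^-1)%:C by rewrite fmorphV rmorph_nat.
have := cabs_sqr z; have : cabs z ^+ 2 <= 1 by rewrite expr_le1 ?cabs_ge0.
have -> : complex.Re (1 - z + (2^-1)%:C * (1 - z) * (1 - z)) =
   1 - complex.Re z + 2^-1 * ((1 - complex.Re z) ^+ 2 - complex.Im z ^+ 2).
  rewrite ReD -mulrA Re_realM; case: (z) => a b /=; rewrite !expr2; ring.
have := sqr_ge0 (1 - complex.Re z); rewrite sqrrB; lra.
Qed.

Lemma alpha_bounds (k : nat) : 0 <= @alpha R k <= pi / 2.
Proof.
rewrite /alpha; set Q := [set a | _]; have pp := pi_ge0 R.
have [[a Qa]|Q0] := pselect (Q !=set0).
  have uQ : ubound Q (pi / 2) by move=> x [/andP[]].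
  apply/andP; split; last by apply: ge_sup => //; exists a.
  apply: (@le_trans _ _ a); first by case: Qa => /andP[/ltW].
  by apply: ub_le_sup => //; exists (pi / 2).
(* An empty set has supremum 0 by convention, still within the bounds. *)
have -> : Q = set0 by apply/seteqP; split=> // x Qx; apply: Q0; exists x.
by rewrite sup0 lexx divr_ge0.
Qed.

Lemma pihalf_alpha_lt (k : nat) (lambda : R) : 1 <= lambda -> lambda < (cos (alpha k))^-1 ->
  pi / 2 - @alpha R k < pi / 2 - acos lambda^-1.
Proof.
move=> l1 hl; have l0 : 0 < lambda by lra.
have /andP[a0 a2] := alpha_bounds k; have pp := pi_ge0 R.
(* The inverse exceeds the positive [lambda]; this excludes a zero cosine, whose inverse is 0 by
   convention. *)
have c0 : 0 < cos (@alpha R k) by rewrite -invr_gt0 (lt_trans l0).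
have lb : -1 <= lambda^-1 <= 1.
  by rewrite invf_le1 // l1 andbT (le_trans (lerN10 R)) // invr_ge0 ltW.
have ap := acos_lepi lb; have ag := acos_ge0 lb.
have cl : cos (@alpha R k) < cos (acos lambda^-1).
  by rewrite acosK ?in_itv // -[ltLHS]invrK ltf_pV2 ?posrE ?invr_gt0.
by rewrite ltrD2l ltrN2 -ltr_cos // in_itv /=; apply/andP; split; lra.
Qed.

End BDFAngle.

Section AngleCondition.
Context {R : realType} {V H V' D W X : completeNormedModType R[i]}.
Variable S : spaces V H V' D W X.

Lemma inf_angle_ge (T lambda : R) (A : linear_family S T) : 0 < T ->
  semigroup_assumption A -> stability_assumption lambda A ->
  pi / 2 - acos lambda^-1 <= inf_angle S T (opA A).
Proof.
move=> T0 [ex an [DH hD] _] [_ [l1 sect]].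
apply: lb_le_inf => [|_ [s hs <-]].
  by exists (analyticity_angle S (opA A 0)), 0 => //=; rewrite in_itv /= lexx ltW.
have {}hs : 0 <= s <= T by move: hs; rewrite /= in_itv.
have [hp ext] := an s hs; have [_ [M hM] _] := hD s hs.
apply: analyticity_angle_ge (opA_cont hs) _ hM l1 _ hp ext => [v0|v].
  by have [v hv _] := ex s v0 hs; exists v.
exact: sect.
Qed.

Lemma angle_condition (k : nat) (T lambda : R) (A : linear_family S T) :
  (0 < k)%N -> 0 < T -> semigroup_assumption A -> stability_assumption lambda A ->
  ((2 < k)%N -> lambda < (cos (alpha k))^-1) ->
  pi / 2 - alpha k < inf_angle S T (opA A).
Proof.
(* For [k <= 2] the left-hand side is at most 0, and (A1) makes the infimum of the angles
   positive. *)
move=> k0 T0 sa st hk; have [k2|k3] := leqP k 2.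
  have [_ _ _ hi] := sa; apply: le_lt_trans hi.
  by rewrite subr_le0 alpha_ge // k0.
apply: lt_le_trans (inf_angle_ge T0 sa st).
by apply: pihalf_alpha_lt (hk k3); case: st => _ [].
Qed.

End AngleCondition.

(** The order of the quantifiers carries the dependence of the constants: [ltilde0] precedes the
    data of the nonlinearity and the bounds [MW], [MD] on the exact solution, while [delta0] and [C]
    follow them but precede the solution, the grid and the errors. *)
Theorem proposition5p1 (R : realType)
  (V H V' D W X : completeNormedModType R[i]) (S : spaces V H V' D W X)
  (k : nat) (T p lambda : R) (A : linear_family S T) :
  (1 <= k <= 6)%N -> 0 < T -> 1 < p ->
  semigroup_assumption A -> discrete_maximal_regularity k p A -> stability_assumption lambda A ->
  embedding_assumption S T p ->
  ((2 < k)%N -> lambda < (cos (alpha k))^-1) ->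
  exists2 ltilde0 : R, 0 < ltilde0 &
  forall r0 ltilde CB MW MD : R,
  0 < r0 -> 0 <= ltilde -> 0 <= CB -> ltilde <= ltilde0 ->
  exists delta0 C : R, 0 < delta0 /\ 0 < C /\
  forall (B : nonlinear_family S T) (u0 : D) (u : R -> D),
  solves_ivp A B u0 u -> local_lipschitz_assumption r0 ltilde CB u B ->
  forall (N : nat), (k <= N)%N ->
  let tau := T / N%:R in
  let ustar := fun n : nat => u (n%:R * tau) in
  dLoo 0 N (fun n => DtoW S (ustar n)) <= MW -> dLp p tau 0 N ustar <= MD ->
  forall (d : nat -> X) (v : nat -> D) (delta : R),
  (forall n, (k <= n <= N)%N ->
     bdf_diff k tau (fun m => DtoX S (ustar m)) n
       + opAX A (n%:R * tau) (ustar n)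
     = bdf_rhs k tau B ustar n + d n) ->
  (forall n, (k <= n <= N)%N ->
     bdf_diff k tau (fun m => DtoX S (v m)) n + opAX A (n%:R * tau) (v n)
     = bdf_rhs k tau B v n) ->
  let e := fun n => v n - ustar n in
  dLp p tau k N d <= delta ->
  tau^-1 * dLp p tau 0 k.-1 (fun i => DtoX S (e i)) + dLp p tau 0 k.-1 e
    <= delta ->
  delta <= delta0 ->
  tau^-1 * dLp p tau k N (fun n => DtoX S (e n - e n.-1)) + dLp p tau k N e
    <= C * delta /\
  dLoo k N (fun n => DtoW S (e n)) <= C * delta.
Proof.
move=> /andP[k1 _] T0 p1 sa dmr st ea hk.
exact: (discrete_stability k1 T0 p1 dmr (angle_condition k1 T0 sa st hk) st ea).
Qed.
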